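(* Let $\mathcal{H}$ be any well-behaved family of graphs and let $\Pi=$ \textsc{Dominating Set}. Then the following are equivalent: (1) $\Pi$ admits an FPT-AS parameterized by $\mathbf{mod}_{\mathcal{H}}(\cdot)$ and $\epsilon$; (2) $\Pi$ admits an FPT-AS parameterized by $\mathbf{ed}_{\mathcal{H}}(\cdot)$ and $\epsilon$; (3) $\Pi$ admits an FPT-AS parameterized by $\mathbf{tw}_{\mathcal{H}}(\cdot)$ and $\epsilon$.
   Context: A family is well-behaved if hereditary and closed under disjoint union. \textsc{Dominating Set}: find a minimum-size $S\subseteq V(G)$ such that every vertex is in $S$ or has a neighbour in $S$. An FPT-AS parameterized by $p$ and $\epsilon$ returns a dominating set of size at most $(1+\epsilon)\mathrm{OPT}$ in time $f(p,\epsilon)n^{O(1)}$; by convention it is given a modulator / decomposition of size / depth / width equal to the parameter. $\mathbf{mod}_{\mathcal{H}}(G)$: minimum $|S|$ with $G-S\in\mathcal{H}$. $\mathcal{H}$-elimination decomposition $(T,\chi,L)$: $T$ rooted forest, $\chi:V(T)\to 2^{V(G)}$, $L\subseteq V(G)$; internal nodes have $|\chi(t)|\le1$, $\chi(t)\cap L=\emptyset$; bags partition $V(G)$; each leaf bag lies in $L$ and induces a graph of $\mathcal{H}$, leaf bags partition $L$; each edge joins bags of nodes in ancestor–descendant relation; $\mathbf{ed}_{\mathcal{H}}$ = minimum depth (edges on a longest root-to-leaf path). $\mathcal{H}$-tree decomposition $(T,\chi,L)$: $T$ rooted tree; bags containing a vertex form a nonempty connected subtree; each edge in a bag; each $v\in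 L$ in the bag of a unique node, which is a leaf; each leaf $t$ has $G[\chi(t)\cap L]\in\mathcal{H}$; width $\max\{0,\max_t|\chi(t)\setminus L|-1\}$; $\mathbf{tw}_{\mathcal{H}}$ = minimum width. *)

(* Defs.v *)
From HB Require Import structures.
From mathcomp Require Import all_boot all_order all_algebra.
Set Implicit Arguments.
Unset Strict Implicit.
Unset Printing Implicit Defensive.

(** Finite simple graphs and families of graphs *)

Record sgraph := SGraph {
  vertex :> finType;
  adj : rel vertex;
  adj_sym : symmetric adj;
  adj_irr : irreflexive adj }.

Section Induced.
Variables (G : sgraph) (A : {set G}).

Definition induced_adj : rel {x : G | x \in A} :=
  fun x y => adj (val x) (val y).

Lemma induced_sym : symmetric induced_adj.
Proof. by move=> x y; apply: adj_sym. Qed.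

Lemma induced_irr : irreflexive induced_adj.
Proof. by move=> x; apply: adj_irr. Qed.

Definition induced : sgraph := SGraph induced_sym induced_irr.
End Induced.

Section DisjointUnion.
Variables (G1 G2 : sgraph).

Definition dunion_adj : rel (G1 + G2)%type :=
  fun x y => match x, y with
             | inl a, inl b => adj a b
             | inr a, inr b => adj a b
             | _, _ => false
             end.

Lemma dunion_sym : symmetric dunion_adj.
Proof. by move=> [a|a] [b|b] //=; apply: adj_sym. Qed.

Lemma dunion_irr : irreflexive dunion_adj.
Proof. by move=> [a|a] /=; apply: adj_irr. Qed.

Definition dunion : sgraph := SGraph dunion_sym dunion_irr.
End DisjointUnion.

Definition graph_iso (G1 G2 : sgraph) : Prop :=
  exists2 f : G1 -> G2, bijective f & forall x y, adj (f x) (f y) = adj x y.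

(* The first clause says that H is a class of abstract (unlabelled) graphs.   *)
Definition well_behaved (H : sgraph -> Prop) : Prop :=
  [/\ forall G1 G2 : sgraph, graph_iso G1 G2 -> H G1 -> H G2,
      forall (G : sgraph) (A : {set G}), H G -> H (induced A)
    & forall G1 G2 : sgraph, H G1 -> H G2 -> H (dunion G1 G2)].

(** Dominating sets *)

Definition dominating (G : sgraph) (S : {set G}) : bool :=
  [forall v, (v \in S) || [exists u in S, adj u v]].

Definition opt_DS (G : sgraph) : nat :=
  #|[arg min_(S < [set: G] | dominating S) #|S|]|.

(** Rooted forests *)

(* The forest is given by its parent function; roots have parent None.        *)
Record rforest := RForest {
  node :> finType;
  parent : node -> option node;
  parent_wf : well_founded (fun s t : node => parent t = Some s) }.

Section Forest.
Variable T : rforest.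

Definition is_root (t : T) : bool := parent t == None.

Definition is_parent : rel T := fun s t => parent t == Some s.

Definition leaf (t : T) : bool := [forall s, ~~ is_parent t s].

(* Reflexive: every node is an ancestor of itself.                            *)
Definition ancestor : rel T := connect is_parent.

Definition tree_adj : rel T := fun s t => is_parent s t || is_parent t s.

Definition is_tree : Prop := exists! r : T, is_root r.

(* The edges on the path from a root to t correspond to the proper ancestors  *)
(* of t.                                                                      *)
Definition depth : nat :=
  \max_(t : T | leaf t) #|[set s | ancestor s t && (s != t)]|.
End Forest.

(** Decompositions (T, chi, L) *)

Record decomp (G : sgraph) := Decomp {
  dforest : rforest;
  bag : dforest -> {set G};
  dL : {set G} }.

Section Decompositions.
Variables (H : sgraph -> Prop) (G : sgraph).

Definition modulator (S : {set G}) : Prop := H (induced (~: S)).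

(* Bags may be empty: a family of bags partitions a set when every element of *)
(* that set lies in exactly one bag of the family.                            *)
Record elim_decomp (D : decomp G) : Prop := {
  ed_internal_card : forall t : dforest D, ~~ leaf t -> #|bag t| <= 1;
  ed_internal_L : forall t : dforest D, ~~ leaf t -> bag t :&: dL D = set0;
  ed_partition : forall v : G, exists! t : dforest D, v \in bag t;
  ed_leaf_L : forall t : dforest D, leaf t -> bag t \subset dL D;
  ed_leaf_H : forall t : dforest D, leaf t -> H (induced (bag t));
  ed_leaf_partition : forall v : G, v \in dL D ->
    exists! t : dforest D, leaf t /\ v \in bag t;
  ed_edge : forall (u v : G) (s t : dforest D),
    adj u v -> u \in bag s -> v \in bag t -> ancestor s t || ancestor t s }.

Record tree_decomp (D : decomp G) : Prop := {
  td_tree : is_tree (dforest D);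
  td_cover : forall v : G, exists t : dforest D, v \in bag t;
  td_connected : forall (v : G) (s t : dforest D),
    v \in bag s -> v \in bag t ->
    connect [rel x y | [&& tree_adj x y, v \in bag x & v \in bag y]] s t;
  td_edge : forall u v : G, adj u v ->
    exists t : dforest D, (u \in bag t) && (v \in bag t);
  td_L : forall v : G, v \in dL D ->
    exists t : dforest D, leaf t /\ forall s : dforest D, (v \in bag s) = (s == t);
  td_leaf_H : forall t : dforest D, leaf t -> H (induced (bag t :&: dL D)) }.

(* Truncated subtraction accounts for the outer max with 0.                   *)
Definition width (D : decomp G) : nat :=
  \max_(t : dforest D) (#|bag t :\: dL D| - 1).
End Decompositions.

(** Model of computation: the weak call-by-value lambda-calculus, in de Bruijn
    notation, with the number of beta-steps as running time.  Turing machines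
    and this calculus simulate each other with an overhead polynomial in the
    number of steps and the size of the input (Forster, Kunze and Roth, "The
    weak call-by-value lambda-calculus is reasonable for both time and space",
    POPL 2020), so bounds of the form f(p, eps) * n^O(1) mean the same thing in
    both models. *)

Inductive term := Var of nat | App of term & term | Lam of term.

(* No lifting of u: only closed terms are ever substituted.                   *)
Fixpoint subst (s : term) (k : nat) (u : term) : term :=
  match s with
  | Var n => if n == k then u else Var n
  | App s1 s2 => App (subst s1 k u) (subst s2 k u)
  | Lam s1 => Lam (subst s1 k.+1 u)
  end.

Definition closed_term (s : term) : Prop := forall k u, subst s k u = s.

(* eval s k v : s reaches the value v in k beta-steps.                        *)
Inductive eval : term -> nat -> term -> Prop :=
| eval_Lam s : eval (Lam s) 0 (Lam s)
| eval_App s t s' t' v i j k :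
    eval s i (Lam s') -> eval t j (Lam t') -> eval (subst s' 0 (Lam t')) k v ->
    eval (App s t) (i + j + k).+1 v.

Fixpoint term_size (s : term) : nat :=
  match s with
  | Var n => n.+1
  | App s1 s2 => (term_size s1 + term_size s2).+1
  | Lam s1 => (term_size s1).+1
  end.

(** Scott encodings of data *)

Definition enc_bool (b : bool) : term := Lam (Lam (Var (if b then 1 else 0))).

Fixpoint enc_nat (n : nat) : term :=
  match n with
  | 0 => Lam (Lam (Var 1))
  | m.+1 => Lam (Lam (App (Var 0) (enc_nat m)))
  end.

Definition enc_pair (s t : term) : term := Lam (App (App (Var 0) s) t).

Definition enc_option (A : Type) (enc : A -> term) (o : option A) : term :=
  match o with
  | Some x => Lam (Lam (App (Var 1) (enc x)))
  | None => Lam (Lam (Var 0))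
  end.

Fixpoint enc_seq (A : Type) (enc : A -> term) (l : seq A) : term :=
  match l with
  | [::] => Lam (Lam (Var 1))
  | x :: l' => Lam (Lam (App (App (Var 0) (enc x)) (enc_seq enc l')))
  end.

(* An element of a finite type is represented by its (unary) rank, and a set  *)
(* by the increasing list of its elements.                                    *)
Definition enc_elt (T : finType) (x : T) : term := enc_nat (enum_rank x).

Definition enc_set (T : finType) (A : {set T}) : term :=
  enc_seq (@enc_elt T) (enum A).

(* A graph is represented by its adjacency matrix.                            *)
Definition enc_graph (G : sgraph) : term :=
  enc_seq (enc_seq enc_bool) [seq [seq adj u v | v <- enum G] | u <- enum G].

Definition enc_decomp (G : sgraph) (D : decomp G) : term :=
  enc_pair
    (enc_seq (fun t : dforest D =>
                enc_pair (enc_option (@enc_elt (dforest D)) (parent t))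
                         (enc_set (bag t)))
             (enum (dforest D)))
    (enc_set (dL D)).

Definition enc_rat (q : rat) : term :=
  enc_pair (enc_nat `|numq q|%N) (enc_nat `|denq q|%N).

(** Structural parameters and FPT approximation schemes *)

(* A graph parameter defined as the minimum of a measure over a class of      *)
(* structures associated with G.  Algorithms are handed such a structure with *)
(* the instance, and the parameter is the measure of that structure.          *)
Record graph_param := GraphParam {
  witness : sgraph -> Type;
  valid : forall G : sgraph, witness G -> Prop;
  measure : forall G : sgraph, witness G -> nat;
  enc_witness : forall G : sgraph, witness G -> term }.

Definition mod_param (H : sgraph -> Prop) : graph_param :=
  {| witness := fun G => {set G};
     valid := modulator H;
     measure := fun G S => #|S|;
     enc_witness := fun G S => enc_set S |}.

Definition ed_param (H : sgraph -> Prop) : graph_param :=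
  {| witness := decomp;
     valid := elim_decomp H;
     measure := fun G D => depth (dforest D);
     enc_witness := enc_decomp |}.

Definition tw_param (H : sgraph -> Prop) : graph_param :=
  {| witness := decomp;
     valid := tree_decomp H;
     measure := width;
     enc_witness := enc_decomp |}.

Definition instance (Q : graph_param) (G : sgraph) (w : witness Q G) : term :=
  enc_pair (enc_graph G) (enc_witness w).

(* In the time bound, n is the size of the whole instance, since forests with *)
(* empty or repeated bags can be arbitrarily large compared to the graph.     *)
Definition DS_FPT_AS (Q : graph_param) : Prop :=
  exists (P : term) (f : nat -> rat -> nat) (c : nat),
    closed_term P /\
    forall (G : sgraph) (w : witness Q G) (eps : rat),
      valid w -> (0 < eps)%R ->
      exists (S : {set G}) (k : nat),
        [/\ eval (App (App P (instance w)) (enc_rat eps)) k (enc_set S),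
            k <= f (measure w) eps * term_size (instance w) ^ c,
            dominating S
          & (#|S|%:R <= (1 + eps) * (opt_DS G)%:R)%R].

(* Main.v *)
Require Import Defs.
From HB Require Import structures.
From mathcomp Require Import all_boot all_order all_algebra.
From mathcomp Require Import zify.
From Stdlib Require Import Classical IndefiniteDescription.
Set Implicit Arguments.
Unset Strict Implicit.
Unset Printing Implicit Defensive.
Import Order.TTheory GRing.Theory Num.Theory.

(** A modulator [S] is an elimination decomposition in disguise (a path through the
    vertices of [S] that ends in a leaf with bag [~: S]), and adding to every bag the
    bags of its ancestors turns an elimination decomposition into a tree decomposition.
    So (3) => (2) => (1), and only (1) => (3) needs an idea.

    Run the usual dynamic program over the tree decomposition, with tables of partial
    solutions: for every pair [X, Y] of subsets of the bag, keep a smallest partial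
    solution that contains [X] and covers [Y].  At a leaf with bag [A], put
    [B = A :\: L].  For [X, Z] subsets of [B], force [X] into the solution and exempt
    [Z] from domination by a gadget with [#|B| + 2] new vertices; [B] and these vertices
    form a modulator of bounded size, and the gadget raises the optimum by one.  A call
    to the given scheme with error [1 / (q (#|B| + 2))], where [q] is the denominator of
    [eps], then yields a solution that is exact when the optimum has no vertex in [L]
    and otherwise exceeds it by at most [1 / q] per such vertex.  As every vertex of [L]
    lies in one leaf, these errors add up to at most [eps] times the optimum.

    Programs are not written as terms: a type system of computable families, closed
    under case analysis and recursion on numbers and lists, provides them.  As time is
    counted in beta-steps, the size of intermediate results matters only where the
    given scheme is called. *)

(** The vertices of [B] dictate the choice of the error: one of them may lie in the bags of
    unboundedly many leaves, so a relative error charged to it would be paid at each of them. If the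
    part of the optimum in a leaf bag has [s <= b + o] vertices, [o] of them in [L] and [b = #|B|],
    the gadget has a solution of size [s + 1], and the scheme exceeds it by at most
    [(b + o + 1) / (q * (b + 2))]. Times [q] this excess is an integer smaller than [o + 1], hence
    at most [o]: nothing is charged to [B]. The factor [f] of a given scheme need be neither
    monotone nor computable, while the parameter of a constructed instance is only known up to an
    upper bound. The new time bounds therefore sum [f] over all values that may occur; no program
    evaluates these sums, they only enter through [bound]. A scheme may be called on valid instances
    only, so computability is relative to a promise on the inputs, the predicate [dom], which case
    analysis refines branch by branch. *)

(** * Terms, scoping and simultaneous substitution *)

Fixpoint scoped (n : nat) (t : term) : bool :=
  match t with
  | Var m => m < n
  | App s u => scoped n s && scoped n u
  | Lam s => scoped n.+1 s
  end.

Definition is_value (t : term) : bool :=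
  scoped 0 t && (if t is Lam _ then true else false).

(** Instantiates a program under an environment of closed values. Indices are not lowered, in
    accordance with [subst]. *)
Fixpoint msubst (s : seq term) (k : nat) (t : term) : term :=
  match t with
  | Var n => if n < k then Var n else nth (Var n) s (n - k)
  | App t1 t2 => App (msubst s k t1) (msubst s k t2)
  | Lam t1 => Lam (msubst s k.+1 t1)
  end.

Fixpoint lift_term (k : nat) (t : term) : term :=
  match t with
  | Var n => Var (if n < k then n else n.+1)
  | App t1 t2 => App (lift_term k t1) (lift_term k t2)
  | Lam t1 => Lam (lift_term k.+1 t1)
  end.

Lemma is_valueP v : is_value v -> exists s, v = Lam s.
Proof. by case/andP=> _; case: v => // s; exists s. Qed.

Lemma scoped_le t m n : m <= n -> scoped m t -> scoped n t.
Proof.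
elim: t m n => [x|t1 IH1 t2 IH2|t IH] m n le_mn /=.
- by move/leq_trans; apply.
- by case/andP=> /(IH1 _ _ le_mn)-> /(IH2 _ _ le_mn).
- exact: IH.
Qed.

Lemma subst_scoped t n k u : n <= k -> scoped n t -> subst t k u = t.
Proof.
elim: t n k => [x|t1 IH1 t2 IH2|t IH] n k le_nk /=.
- by move=> lt_xn; case: eqP => // xk; lia.
- by case/andP=> /(IH1 _ _ le_nk)-> /(IH2 _ _ le_nk)->.
- by move=> /(IH n.+1 k.+1 le_nk)->.
Qed.

Lemma msubst_scoped t s n k : n <= k -> scoped n t -> msubst s k t = t.
Proof.
elim: t n k => [x|t1 IH1 t2 IH2|t IH] n k le_nk /=.
- by move=> lt_xn; rewrite ifT // (leq_trans lt_xn).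
- by case/andP=> /(IH1 _ _ le_nk)-> /(IH2 _ _ le_nk)->.
- by move=> /(IH n.+1 k.+1 le_nk)->.
Qed.

Lemma value_scoped n v : is_value v -> scoped n v.
Proof. by case/andP=> /(@scoped_le _ 0 n)->. Qed.

Lemma subst_value v k u : is_value v -> subst v k u = v.
Proof. by case/andP=> sv _; apply: subst_scoped sv. Qed.

Lemma msubst_value v s k : is_value v -> msubst s k v = v.
Proof. by case/andP=> sv _; apply: msubst_scoped sv. Qed.

(** A beta-step pushes its argument onto the environment: the values substituted earlier are closed,
    so the new substitution does not reach into them. *)
Lemma subst_msubst t s k v : all is_value s ->
  subst (msubst s k.+1 t) k v = msubst (v :: s) k t.
Proof.
move=> val_s; elim: t k => [x|t1 IH1 t2 IH2|t IH] k /=; last by rewrite IH.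
  case: (ltngtP x k) => [lt_xk|lt_kx|->].
  - by rewrite ltnW //= ltn_eqF.
  - rewrite ltnNge lt_kx /= -[x - k]prednK ?subn_gt0 //= -subnS.
    have [lt_xs|le_sx] := ltnP (x - k.+1) (size s).
      by rewrite subst_value // (all_nthP _ val_s).
    by rewrite !nth_default //= gtn_eqF.
  - by rewrite ltnSn subnn /= eqxx.
by rewrite IH1 IH2.
Qed.

Lemma msubst_lift t s k v : scoped (k + size s) t ->
  msubst (v :: s) k (lift_term k t) = msubst s k t.
Proof.
elim: t k => [x|t1 IH1 t2 IH2|t IH] k /=.
- move=> lt_x; have [//|le_kx] := ltnP x k; first by move->.
  rewrite ltnNge (leqW le_kx) /= subSn //=; apply: set_nth_default; lia.
- by case/andP=> /IH1-> /IH2->.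
- by rewrite -addSn => /IH->.
Qed.

Lemma scoped_lift t n k : scoped n t -> scoped n.+1 (lift_term k t).
Proof.
elim: t n k => [x|t1 IH1 t2 IH2|t IH] n k /=; first by case: ifP => _; lia.
  by case/andP=> /IH1-> /IH2->.
exact: IH.
Qed.

Lemma scoped_msubst t s k : all is_value s -> scoped (k + size s) t ->
  scoped k (msubst s k t).
Proof.
move=> val_s; elim: t k => [x|t1 IH1 t2 IH2|t IH] k /=.
- have [//|le_kx lt_x] := ltnP x k; apply: value_scoped.
  by apply: (all_nthP _ val_s); lia.
- by case/andP=> /IH1-> /IH2->.
- by rewrite -addSn => /IH.
Qed.

(** * Reduction in a given number of steps *)

(* Head expansion: [s] evaluates to whatever [t] evaluates to, in at most [n] more
   steps.  Unlike [eval], this relation can be chained and used under [App]. *)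
Record reduces (s : term) (n : nat) (t : term) : Prop := Reduces {
  reducesP : forall k v, eval t k v -> exists2 m, m <= n + k & eval s m v }.

Lemma reduces_refl s n : reduces s n s.
Proof. by split=> k v e; exists k; first exact: leq_addl. Qed.

Lemma reduces_trans s t u m n p :
  reduces s m t -> reduces t n u -> m + n <= p -> reduces s p u.
Proof.
move=> [st] [tu] le_p; split=> k v /tu[k1 le_k1 /st[k2 le_k2 e]].
by exists k2 => //; lia.
Qed.

Lemma reduces_le s m n t : m <= n -> reduces s m t -> reduces s n t.
Proof. by move=> le_mn st; apply: reduces_trans st (reduces_refl _ 0) _; rewrite addn0. Qed.

Lemma reduces_beta b v : is_value v -> reduces (App (Lam b) v) 1 (subst b 0 v).
Proof.
case/is_valueP=> v' ->; split=> k w e; exists k.+1; first by lia.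
by apply: (eval_App (i := 0) (j := 0)) e; apply: eval_Lam.
Qed.

Lemma reduces_fun s n s' t : reduces s n s' -> reduces (App s t) n (App s' t).
Proof.
move=> [ss']; split=> k v e; inversion e as [|? ? ? ? ? i j l es et eb]; subst.
by have [i' le_i es'] := ss' _ _ es; exists (i' + j + l).+1; [lia | apply: eval_App et eb].
Qed.

Lemma reduces_arg s n t t' : reduces t n t' -> reduces (App s t) n (App s t').
Proof.
move=> [tt']; split=> k v e; inversion e as [|? ? ? ? ? i j l es et eb]; subst.
by have [j' le_j et'] := tt' _ _ et; exists (i + j' + l).+1; [lia | apply: eval_App es _ eb].
Qed.

Lemma eval_reduces s k v : is_value v -> eval s k v -> reduces s k v.
Proof.
case/is_valueP=> v' -> e; split=> m w ew; inversion ew; subst.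
by exists k => //; lia.
Qed.

Lemma reduces_eval s n v : is_value v -> reduces s n v -> exists2 k, k <= n & eval s k v.
Proof.
case/is_valueP=> v' -> [sv]; have [k le_k e] := sv _ _ (eval_Lam _).
by exists k => //; lia.
Qed.

(** * Encodable types and computable families *)

Record etype := EType {
  car :> Type;
  encode : car -> term;
  encodeP : forall x, is_value (encode x) }.
Arguments encode : clear implicits.
Arguments encode {e} x.

(* A context is a class of inputs [env i], valid when [dom i] holds, together with the
   quantity [bound i] in which running times are polynomial; an FPT bound is obtained by
   including a function of the parameter in [bound].  [computable c X x] asserts that one
   term computes [x i] from [env i], for all [i]. *)
Record context := Context {
  idx :> Type;
  dom : idx -> Prop;
  bound : idx -> nat;
  arity : nat;
  env : idx -> seq term;
  size_env : forall i, size (env i) = arity;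
  env_values : forall i, all is_value (env i) }.

(** The base is at least 2 even if [bound i] is 0, so that a single exponent absorbs constants, sums
    and products. *)
Definition polybounded (c : context) (f : c -> nat) : Prop :=
  exists e, forall i, dom i -> f i <= (bound i).+2 ^ e.

Definition computable (c : context) (X : c -> etype) (x : forall i, X i) : Prop :=
  exists t T, [/\ scoped (arity c) t, polybounded T
    & forall i, dom i -> reduces (msubst (env i) 0 t) (T i) (encode (x i))].
Arguments computable : clear implicits.

Section PolyBounded.
Variable c : context.
Implicit Types f g : c -> nat.

Lemma polybounded_le g f : (forall i, dom i -> f i <= g i) ->
  polybounded g -> polybounded f.
Proof.
by move=> le_fg [e ge]; exists e => i ci; apply: leq_trans (le_fg i ci) (ge i ci).
Qed.

Lemma polybounded_const n : polybounded (fun _ : c => n).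
Proof.
exists n => i _; apply: leq_trans (ltnW (ltn_expl n (ltnSn 1))) _.
by case: n => // n; rewrite leq_exp2r.
Qed.

Lemma polybounded_bound : polybounded (@bound c).
Proof. by exists 1 => i _; rewrite expn1; lia. Qed.

Lemma polyboundedM f g : polybounded f -> polybounded g ->
  polybounded (fun i => f i * g i).
Proof.
case=> d fd [e ge]; exists (d + e) => i ci.
by rewrite expnD leq_mul ?fd ?ge.
Qed.

Lemma polyboundedD f g : polybounded f -> polybounded g ->
  polybounded (fun i => f i + g i).
Proof.
case=> d fd [e ge]; exists (d + e).+1 => i ci.
have := fd i ci; have := ge i ci; rewrite expnS expnD.
have : 0 < (bound i).+2 ^ d by rewrite expn_gt0.
have : 0 < (bound i).+2 ^ e by rewrite expn_gt0.
by set a := _ ^ d; set b := _ ^ e; nia.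
Qed.

Lemma polyboundedS f : polybounded f -> polybounded (fun i => (f i).+1).
Proof.
move=> pf; apply: (@polybounded_le (fun i => f i + 1)) => [i _|]; first by lia.
by apply: polyboundedD => //; apply: polybounded_const.
Qed.

Lemma polyboundedX f n : polybounded f -> polybounded (fun i => f i ^ n).
Proof.
move=> pf; elim: n => [|n IH]; first exact: polybounded_const.
apply: (@polybounded_le (fun i => f i * f i ^ n)) => [i _|]; first by rewrite expnS.
exact: polyboundedM.
Qed.

End PolyBounded.

Ltac polybound := repeat first [assumption | apply: polyboundedD | apply: polyboundedS
  | apply: polyboundedM | apply: polyboundedX | exact: polybounded_const
  | exact: polybounded_bound].

(** Only the promise on the inputs changes, not the environment. A branch of a case analysis is
    typed under the condition that selects it, so its value and its time matter only there. *)
Definition restrict (c : context) (p : c -> Prop) : context :=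
  {| idx := idx c; dom i := dom i /\ p i; bound := @bound c; arity := arity c;
     env := @env c; size_env := @size_env c; env_values := @env_values c |}.
Arguments restrict : clear implicits.

Section Extension.
Variables (c : context) (X : c -> etype) (Q : forall i, X i -> Prop).

Definition ext_env (k : {i : c & X i}) : seq term :=
  encode (projT2 k) :: env (projT1 k).

Fact size_ext_env k : size (ext_env k) = (arity c).+1.
Proof. by rewrite /= size_env. Qed.

Fact ext_env_values k : all is_value (ext_env k).
Proof. by rewrite /= encodeP env_values. Qed.

(** One more variable, of which [Q] may be assumed. As [bound] ignores the new value, times must be
    polynomial uniformly in it; any size on which they depend has to be controlled by [Q]. *)
Definition ext : context :=
  {| idx := {i : c & X i};
     dom := fun k => dom (projT1 k) /\ Q (projT2 k);
     bound := fun k => bound (projT1 k);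
     arity := (arity c).+1; env := ext_env;
     size_env := size_ext_env; env_values := ext_env_values |}.

End Extension.
Arguments ext : clear implicits.

Section Rules.
Variable c : context.

Lemma computable_ext (X : c -> etype) (x y : forall i, X i) :
  (forall i, dom i -> y i = x i) -> computable c X x -> computable c X y.
Proof.
move=> exy [t [T [st pT et]]]; exists t, T; split=> // i ci.
by rewrite exy //; apply: et.
Qed.

(** Computability sees only codes: elements of a finite type may be treated as numbers, and sets as
    lists, wherever the codes coincide. *)
Lemma computable_recode (X Y : c -> etype) (x : forall i, X i) (y : forall i, Y i) :
  (forall i, dom i -> encode (y i) = encode (x i)) ->
  computable c X x -> computable c Y y.
Proof.
move=> exy [t [T [st pT et]]]; exists t, T; split=> // i ci.
by rewrite exy //; apply: et.
Qed.

Lemma polybounded_restrict (p : c -> Prop) (f : c -> nat) :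
  polybounded f -> @polybounded (restrict c p) f.
Proof. by case=> e fe; exists e => i /= [/fe]. Qed.

Lemma computable_restrict (p : c -> Prop) (X : c -> etype) (x : forall i, X i) :
  computable c X x -> computable (restrict c p) X x.
Proof.
case=> t [T [st pT et]]; exists t, T; split=> //.
  exact: polybounded_restrict.
by move=> i [/et].
Qed.

Lemma polybounded_wk (X : c -> etype) (Q : forall i, X i -> Prop) f :
  polybounded f -> @polybounded (ext c X Q) (fun k => f (projT1 k)).
Proof. by case=> e fe; exists e => i /= [/fe]. Qed.

Lemma computable_wk (X : c -> etype) (Q : forall i, X i -> Prop)
    (Y : c -> etype) (y : forall i, Y i) :
  computable c Y y ->
  computable (ext c X Q) (fun k => Y (projT1 k)) (fun k => y (projT1 k)).
Proof.
case=> t [T [st pT et]]; exists (lift_term 0 t), (fun k => T (projT1 k)); split.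
- exact: scoped_lift.
- exact: polybounded_wk.
- by move=> [i x] [/= ci _]; rewrite /ext_env msubst_lift ?size_env //; apply: et.
Qed.

Lemma computable_var (X : c -> etype) (Q : forall i, X i -> Prop) :
  computable (ext c X Q) (fun k => X (projT1 k)) (fun k => projT2 k).
Proof.
exists (Var 0), (fun=> 0); split=> //; first exact: polybounded_const.
by move=> [i x] _ /=; apply: reduces_refl.
Qed.

Lemma computable_const (X : etype) (x : X) : computable c (fun=> X) (fun=> x).
Proof.
exists (encode x), (fun=> 0); split; first exact/value_scoped/encodeP.
  exact: polybounded_const.
by move=> i ci; rewrite msubst_value ?encodeP //; apply: reduces_refl.
Qed.

(* The term [F] need not be a value: this also covers calls to a given program. *)
Lemma computable_app (F : term) (X Y : c -> etype)
    (x : forall i, X i) (y : forall i, Y i) (T : c -> nat) :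
  scoped 0 F -> polybounded T ->
  (forall i, dom i -> reduces (App F (encode (x i))) (T i) (encode (y i))) ->
  computable c X x -> computable c Y y.
Proof.
move=> sF pT eF [t [T' [st pT' et]]]; exists (App F t), (fun i => T' i + T i).
split; [by rewrite /= st (scoped_le _ sF) | by polybound |].
move=> i ci /=; rewrite (msubst_scoped _ _ sF) //.
by apply: reduces_trans (reduces_arg _ (et i ci)) (eF i ci) _.
Qed.

Lemma computable_app2 (F : term) (X1 X2 Y : c -> etype)
    (x1 : forall i, X1 i) (x2 : forall i, X2 i) (y : forall i, Y i) (T : c -> nat) :
  scoped 0 F -> polybounded T ->
  (forall i, dom i ->
     reduces (App (App F (encode (x1 i))) (encode (x2 i))) (T i) (encode (y i))) ->
  computable c X1 x1 -> computable c X2 x2 -> computable c Y y.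
Proof.
move=> sF pT eF [t1 [T1 [st1 pT1 et1]]] [t2 [T2 [st2 pT2 et2]]].
exists (App (App F t1) t2), (fun i => T1 i + (T2 i + T i)); split.
- by rewrite /= st1 st2 (scoped_le _ sF).
- by polybound.
move=> i ci /=; rewrite (msubst_scoped _ _ sF) //.
apply: reduces_trans (reduces_fun _ (reduces_arg _ (et1 i ci))) _ (leqnn _).
by apply: reduces_trans (reduces_arg _ (et2 i ci)) (eF i ci) _.
Qed.

End Rules.

(** * Encoded data types and their elementary reductions *)

Fact enc_bool_value b : is_value (enc_bool b). Proof. by case: b. Qed.
Definition eBool : etype := EType enc_bool_value.

Fact enc_nat_value n : is_value (enc_nat n).
Proof.
have sc : scoped 0 (enc_nat n) by elim: n => //= n sc; apply: (@scoped_le _ 0).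
by rewrite /is_value sc; case: n {sc}.
Qed.
Definition eNat : etype := EType enc_nat_value.

Fact enc_seq_value (X : etype) (l : seq X) : is_value (enc_seq encode l).
Proof.
have sc : scoped 0 (enc_seq encode l).
  by elim: l => //= x l sc; rewrite value_scoped ?encodeP //=; apply: (@scoped_le _ 0).
by rewrite /is_value sc; case: l {sc}.
Qed.
Definition eSeq (X : etype) : etype := EType (@enc_seq_value X).

Fact enc_pair_value (X Y : etype) (p : X * Y) :
  is_value (enc_pair (encode p.1) (encode p.2)).
Proof. by rewrite /is_value /= !value_scoped ?encodeP. Qed.
Definition ePair (X Y : etype) : etype := EType (@enc_pair_value X Y).

Fact enc_option_value (X : etype) (o : option X) : is_value (enc_option encode o).
Proof. by case: o => // x; rewrite /is_value /= value_scoped ?encodeP. Qed.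
Definition eOption (X : etype) : etype := EType (@enc_option_value X).

Fact enc_elt_value (T : finType) (x : T) : is_value (enc_elt x).
Proof. exact: enc_nat_value. Qed.
Definition eElt (T : finType) : etype := EType (@enc_elt_value T).

Fact enc_set_value (T : finType) (A : {set T}) : is_value (enc_set A).
Proof. exact: (enc_seq_value (enum A : seq (eElt T))). Qed.
Definition eSet (T : finType) : etype := EType (@enc_set_value T).

Fact enc_graph_value G : is_value (enc_graph G).
Proof. exact: (@enc_seq_value (eSeq eBool)). Qed.
Definition eGraph : etype := EType enc_graph_value.

Lemma closure_value s b : all is_value s -> scoped (size s).+1 b ->
  is_value (Lam (msubst s 1 b)).
Proof. by move=> val_s sc_b; rewrite /is_value /= andbT scoped_msubst. Qed.

Section Evaluation.
#[local] Arguments subst : simpl never.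
#[local] Arguments enc_nat : simpl never.

Lemma substE :
  (forall n k u, subst (Var n) k u = if n == k then u else Var n) *
  (forall s t k u, subst (App s t) k u = App (subst s k u) (subst t k u)) *
  (forall s k u, subst (Lam s) k u = Lam (subst s k.+1 u)).
Proof. by []. Qed.

(** Dummy argument that releases a delayed branch. Evaluation is call-by-value, so undelayed
    branches of a case analysis would all be run, even those whose promise fails. *)
Definition idT : term := Lam (Var 0).

Lemma subst_lift_msubst s t v : all is_value s -> scoped (size s) t ->
  subst (msubst s 1 (lift_term 0 t)) 0 v = msubst s 0 t.
Proof. by move=> val_s sc_t; rewrite subst_msubst // msubst_lift. Qed.

Lemma reduces_step s s' t n : reduces s 1 s' -> reduces s' n t -> reduces s n.+1 t.
Proof. by move=> ss' s't; apply: reduces_trans ss' s't _. Qed.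

Lemma reduces_bool b v w : is_value v -> is_value w ->
  reduces (App (App (enc_bool b) v) w) 2 (if b then v else w).
Proof.
move=> vv vw; apply: reduces_step (reduces_fun _ (reduces_beta _ vv)) _; rewrite substE.
apply: reduces_step (reduces_beta _ vw) _.
by case: b; rewrite !substE /= ?subst_value //; apply: (reduces_refl _ 0).
Qed.

Lemma reduces_zero v w : is_value v -> is_value w ->
  reduces (App (App (enc_nat 0) v) w) 2 v.
Proof.
move=> vv vw; apply: reduces_step (reduces_fun _ (reduces_beta _ vv)) _; rewrite substE.
apply: reduces_step (reduces_beta _ vw) _; rewrite !substE /=.
by rewrite subst_value //; apply: (reduces_refl _ 0).
Qed.

Lemma reduces_succ n v w : is_value v -> is_value w ->
  reduces (App (App (enc_nat n.+1) v) w) 2 (App w (enc_nat n)).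
Proof.
have -> : enc_nat n.+1 = Lam (Lam (App (Var 0) (enc_nat n))) by [].
have := enc_nat_value n; move: (enc_nat n) => m vm vv vw.
apply: reduces_step (reduces_fun _ (reduces_beta _ vv)) _; rewrite substE.
apply: reduces_step (reduces_beta _ vw) _; rewrite !substE /=.
by rewrite !subst_value //; apply: (reduces_refl _ 0).
Qed.

Lemma reduces_nil (X : etype) v w : is_value v -> is_value w ->
  reduces (App (App (encode ([::] : eSeq X)) v) w) 2 v.
Proof.
move=> vv vw; apply: reduces_step (reduces_fun _ (reduces_beta _ vv)) _; rewrite substE.
apply: reduces_step (reduces_beta _ vw) _; rewrite !substE /=.
by rewrite subst_value //; apply: (reduces_refl _ 0).
Qed.

Lemma reduces_cons (X : etype) x l v w : is_value v -> is_value w ->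
  reduces (App (App (encode (x :: l : eSeq X)) v) w) 2
          (App (App w (encode x)) (encode (l : eSeq X))).
Proof.
have -> : encode (x :: l : eSeq X) = Lam (Lam (App (App (Var 0) (encode x))
  (encode (l : eSeq X)))) by [].
have := encodeP (l : eSeq X); have := encodeP x.
move: (encode x) (encode _) => x' l' vx vl vv vw.
apply: reduces_step (reduces_fun _ (reduces_beta _ vv)) _; rewrite substE.
apply: reduces_step (reduces_beta _ vw) _; rewrite !substE /=.
by rewrite !subst_value //; apply: (reduces_refl _ 0).
Qed.

Lemma reduces_option (X : etype) (o : option X) v w : is_value v -> is_value w ->
  reduces (App (App (enc_option encode o) v) w) 2
          (if o is Some x then App v (encode x) else w).
Proof.
move=> vv vw; case: o => [x|];
  apply: reduces_step (reduces_fun _ (reduces_beta _ vv)) _; rewrite substE;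
  apply: reduces_step (reduces_beta _ vw) _; rewrite !substE /=;
  by rewrite ?subst_value ?encodeP //; apply: (reduces_refl _ 0).
Qed.
Lemma reduces_closure1 s t v : all is_value s -> scoped (size s).+1 t -> is_value v ->
  reduces (App (App (Lam (Lam (msubst s 2 (lift_term 0 t)))) v) idT) 2
          (msubst (v :: s) 0 t).
Proof.
move=> vs st vv; apply: reduces_step (reduces_fun _ (reduces_beta _ vv)) _.
rewrite substE subst_msubst //; apply: reduces_step (reduces_beta _ _) _ => //.
by rewrite subst_lift_msubst /= ?vv //; apply: reduces_refl.
Qed.

Lemma reduces_closure2 s t u v :
  all is_value s -> scoped (size s).+2 t -> is_value u -> is_value v ->
  reduces (App (App (App (Lam (Lam (Lam (msubst s 3 (lift_term 0 t))))) u) v) idT) 3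
          (msubst (v :: u :: s) 0 t).
Proof.
move=> vs st vu vv.
apply: reduces_step (reduces_fun _ (reduces_fun _ (reduces_beta _ vu))) _.
by rewrite !substE subst_msubst //; apply: reduces_closure1; rewrite /= ?vu.
Qed.

Lemma thunk_value s t : all is_value s -> scoped (size s) t ->
  is_value (Lam (msubst s 1 (lift_term 0 t))).
Proof. by move=> vs st; apply: closure_value => //; apply: scoped_lift. Qed.

Lemma reduces_thunk s t : all is_value s -> scoped (size s) t ->
  reduces (App (Lam (msubst s 1 (lift_term 0 t))) idT) 1 (msubst s 0 t).
Proof.
move=> vs st; apply: reduces_step (reduces_beta _ _) _ => //.
by rewrite subst_lift_msubst //; apply: reduces_refl.
Qed.

(** * Computability of constructors and case analysis *)

Section Constructors.
Variable c : context.

Lemma computable_if (X : c -> etype) (b : c -> bool) (x y : forall i, X i) :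
  computable c (fun=> eBool) b ->
  computable (restrict c b) X x ->
  computable (restrict c (fun i => ~~ b i)) X y ->
  computable c X (fun i => if b i then x i else y i).
Proof.
move=> [tb [Tb [sb pb rb]]] [tx [Tx [sx [ex px] rx]]] [ty [Ty [sy [ey py] ry]]].
exists (App (App (App tb (Lam (lift_term 0 tx))) (Lam (lift_term 0 ty))) idT).
(* [Tx] and [Ty] are under control only where their branch is taken, so the total refers to their
   polynomial bounds instead. *)
exists (fun i => Tb i + (2 + (1 + ((bound i).+2 ^ ex + (bound i).+2 ^ ey)))); split.
- by rewrite /= sb !scoped_lift.
- by polybound.
move=> i ci /=; have val_i := env_values i.
move: sb sx sy px py rx ry; rewrite /= -(size_env i) => sb sx sy px py rx ry.
have vx := thunk_value val_i sx; have vy := thunk_value val_i sy.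
apply: reduces_trans _ _ (leqnn _).
  by do 3 apply: reduces_fun; apply: rb.
apply: reduces_trans (reduces_fun _ (reduces_bool _ vx vy)) _ (leqnn _).
case: (boolP (b i)) => bi.
  apply: (@reduces_le _ (1 + Tx i)); first by have /= := px i (conj ci bi); lia.
  by apply: reduces_trans (reduces_thunk _ _) (rx i _) _.
apply: (@reduces_le _ (1 + Ty i)); first by have /= := py i (conj ci bi); lia.
by apply: reduces_trans (reduces_thunk _ _) (ry i _) _.
Qed.

Lemma computable_natcase (Y : c -> etype) (n : c -> nat) (z : forall i, Y i)
    (f : forall i, nat -> Y i) :
  computable c (fun=> eNat) n ->
  computable (restrict c (fun i => n i = 0)) Y z ->
  computable (ext c (fun=> eNat) (fun i m => n i = m.+1))
    (fun k => Y (projT1 k)) (fun k => f (projT1 k) (projT2 k)) ->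
  computable c Y (fun i => if n i is m.+1 then f i m else z i).
Proof.
move=> [tn [Tn [sn pn rn]]] [tz [Tz [sz [ez pz] rz]]] [tf [Tf [sf [ef pf] rf]]].
exists (App (App (App tn (Lam (lift_term 0 tz))) (Lam (Lam (lift_term 0 tf)))) idT).
exists (fun i => Tn i + (2 + (2 + ((bound i).+2 ^ ez + (bound i).+2 ^ ef)))); split.
- by rewrite /= sn !scoped_lift.
- by polybound.
move=> i ci /=; have val_i := env_values i.
move: sn sz sf; rewrite /= -(size_env i) => sn sz sf.
have vz := thunk_value val_i sz.
have vf : is_value (Lam (Lam (msubst (env i) 2 (lift_term 0 tf)))).
  by rewrite /is_value /= andbT scoped_msubst // scoped_lift.
apply: reduces_trans _ _ (leqnn _); first by do 3 apply: reduces_fun; apply: rn.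
case def_n: (n i) => [|m].
  apply: reduces_trans (reduces_fun _ (reduces_zero vz vf)) _ (leqnn _).
  apply: (@reduces_le _ (1 + Tz i)); first by have /= := pz i (conj ci def_n); lia.
  by apply: reduces_trans (reduces_thunk _ _) (rz i _) _.
apply: reduces_trans (reduces_fun _ (reduces_succ _ vz vf)) _ (leqnn _).
have cm : dom (existT _ i m : ext c (fun=> eNat) (fun i m => n i = m.+1)) by [].
apply: (@reduces_le _ (2 + Tf (existT _ i m))); first by have /= := pf _ cm => /=; lia.
apply: reduces_trans (reduces_closure1 _ _ (enc_nat_value m)) (rf _ cm) (leqnn _) => //.
Qed.

Lemma computable_seqcase (X Y : c -> etype) (l : forall i, seq (X i))
    (z : forall i, Y i) (f : forall i, X i -> seq (X i) -> Y i) :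
  computable c (fun i => eSeq (X i)) l ->
  computable (restrict c (fun i => l i = [::])) Y z ->
  computable (ext (ext c X (fun _ _ => True)) (fun k => eSeq (X (projT1 k)))
                  (fun k l' => l (projT1 k) = projT2 k :: l'))
    (fun k => Y (projT1 (projT1 k)))
    (fun k => f (projT1 (projT1 k)) (projT2 (projT1 k)) (projT2 k)) ->
  computable c Y (fun i => if l i is x :: l' then f i x l' else z i).
Proof.
move=> [tn [Tn [sn pn rn]]] [tz [Tz [sz [ez pz] rz]]] [tf [Tf [sf [ef pf] rf]]].
exists (App (App (App tn (Lam (lift_term 0 tz))) (Lam (Lam (Lam (lift_term 0 tf))))) idT).
exists (fun i => Tn i + (2 + (3 + ((bound i).+2 ^ ez + (bound i).+2 ^ ef)))); split.
- by rewrite /= sn !scoped_lift.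
- by polybound.
move=> i ci /=; have val_i := env_values i.
move: sn sz sf; rewrite /= -(size_env i) => sn sz sf.
have vz := thunk_value val_i sz.
have vf : is_value (Lam (Lam (Lam (msubst (env i) 3 (lift_term 0 tf))))).
  by rewrite /is_value /= andbT scoped_msubst // scoped_lift.
apply: reduces_trans _ _ (leqnn _); first by do 3 apply: reduces_fun; apply: rn.
case def_l: (l i) => [|x l'].
  apply: reduces_trans (reduces_fun _ (reduces_nil _ vz vf)) _ (leqnn _).
  apply: (@reduces_le _ (1 + Tz i)); first by have /= := pz i (conj ci def_l); lia.
  by apply: reduces_trans (reduces_thunk _ _) (rz i _) _.
apply: reduces_trans (reduces_fun _ (reduces_cons _ _ vz vf)) _ (leqnn _).
pose k : ext (ext c X (fun _ _ => True)) (fun k => eSeq (X (projT1 k)))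
     (fun k l' => l (projT1 k) = projT2 k :: l') := existT _ (existT _ i x) l'.
have ck : dom k by [].
apply: (@reduces_le _ (3 + Tf k)); first by have /= := pf _ ck => /=; lia.
have vl' := encodeP (l' : eSeq (X i)).
apply: reduces_trans (reduces_closure2 _ _ (encodeP x) vl') (rf _ ck) (leqnn _) => //.
Qed.

Lemma computable_optioncase (X Y : c -> etype) (o : forall i, option (X i))
    (z : forall i, Y i) (f : forall i, X i -> Y i) :
  computable c (fun i => eOption (X i)) o ->
  computable (restrict c (fun i => o i = None)) Y z ->
  computable (ext c X (fun i x => o i = Some x))
    (fun k => Y (projT1 k)) (fun k => f (projT1 k) (projT2 k)) ->
  computable c Y (fun i => if o i is Some x then f i x else z i).
Proof.
move=> [tn [Tn [sn pn rn]]] [tz [Tz [sz [ez pz] rz]]] [tf [Tf [sf [ef pf] rf]]].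
exists (App (App (App tn (Lam (Lam (lift_term 0 tf)))) (Lam (lift_term 0 tz))) idT).
exists (fun i => Tn i + (2 + (2 + ((bound i).+2 ^ ez + (bound i).+2 ^ ef)))); split.
- by rewrite /= sn !scoped_lift.
- by polybound.
move=> i ci /=; have val_i := env_values i.
move: sn sz sf; rewrite /= -(size_env i) => sn sz sf.
have vz := thunk_value val_i sz.
have vf : is_value (Lam (Lam (msubst (env i) 2 (lift_term 0 tf)))).
  by rewrite /is_value /= andbT scoped_msubst // scoped_lift.
apply: reduces_trans _ _ (leqnn _); first by do 3 apply: reduces_fun; apply: rn.
case def_o: (o i) => [x|]; last first.
  apply: reduces_trans (reduces_fun _ (reduces_option None vf vz)) _ (leqnn _).
  apply: (@reduces_le _ (1 + Tz i)); first by have /= := pz i (conj ci def_o); lia.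
  by apply: reduces_trans (reduces_thunk _ _) (rz i _) _.
apply: reduces_trans (reduces_fun _ (reduces_option (Some x) vf vz)) _ (leqnn _).
have cm : dom (existT _ i x : ext c X (fun i x => o i = Some x)) by [].
apply: (@reduces_le _ (2 + Tf (existT _ i x))); first by have /= := pf _ cm => /=; lia.
apply: reduces_trans (reduces_closure1 _ _ (encodeP x)) (rf _ cm) (leqnn _) => //.
Qed.

End Constructors.

Section Basic.
Variable c : context.

Lemma computable_succ (n : c -> nat) :
  computable c (fun=> eNat) n -> computable c (fun=> eNat) (fun i => (n i).+1).
Proof.
apply: (@computable_app _ (Lam (Lam (Lam (App (Var 0) (Var 2))))) _ _ _ _ (fun=> 1)) => //.
  exact: polybounded_const.
move=> i _; apply: reduces_step (reduces_beta _ (encodeP _)) _.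
by rewrite !substE; apply: reduces_refl.
Qed.

Lemma computable_cons (X : c -> etype) (x : forall i, X i) (l : forall i, seq (X i)) :
  computable c X x -> computable c (fun i => eSeq (X i)) l ->
  computable c (fun i => eSeq (X i)) (fun i => x i :: l i).
Proof.
apply: (@computable_app2 _ (Lam (Lam (Lam (Lam
  (App (App (Var 0) (Var 3)) (Var 2))))))  _ _ _ _ _ _ (fun=> 2)) => //.
  exact: polybounded_const.
move=> i _; have vx := encodeP (x i); have vl := encodeP (l i : eSeq (X i)).
apply: reduces_step (reduces_fun _ (reduces_beta _ vx)) _; rewrite !substE /=.
apply: reduces_step (reduces_beta _ vl) _; rewrite !substE /= subst_value //.
exact: reduces_refl.
Qed.

Lemma computable_pair (X Y : c -> etype) (x : forall i, X i) (y : forall i, Y i) :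
  computable c X x -> computable c Y y ->
  computable c (fun i => ePair (X i) (Y i)) (fun i => (x i, y i)).
Proof.
apply: (@computable_app2 _ (Lam (Lam (Lam
  (App (App (Var 0) (Var 2)) (Var 1))))) _ _ _ _ _ _ (fun=> 2)) => //.
  exact: polybounded_const.
move=> i _; have vx := encodeP (x i); have vy := encodeP (y i).
apply: reduces_step (reduces_fun _ (reduces_beta _ vx)) _; rewrite !substE /=.
apply: reduces_step (reduces_beta _ vy) _; rewrite !substE /= subst_value //.
exact: reduces_refl.
Qed.

Lemma computable_Some (X : c -> etype) (x : forall i, X i) :
  computable c X x -> computable c (fun i => eOption (X i)) (fun i => Some (x i)).
Proof.
apply: (@computable_app _ (Lam (Lam (Lam (App (Var 1) (Var 2))))) _ _ _ _ (fun=> 1)) => //.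
  exact: polybounded_const.
move=> i _; apply: reduces_step (reduces_beta _ (encodeP _)) _.
by rewrite !substE; apply: reduces_refl.
Qed.

Lemma computable_fst (X Y : c -> etype) (p : forall i, (X i * Y i)%type) :
  computable c (fun i => ePair (X i) (Y i)) p -> computable c X (fun i => (p i).1).
Proof.
apply: (@computable_app _ (Lam (App (Var 0) (Lam (Lam (Var 1))))) _ _ _ _ (fun=> 4)) => //.
  exact: polybounded_const.
move=> i _; have vx := encodeP (p i).1; have vy := encodeP (p i).2.
apply: reduces_step (reduces_beta _ (encodeP _)) _; rewrite !substE /=.
apply: reduces_step (reduces_beta _ _) _ => //; rewrite !substE /= !subst_value //.
apply: reduces_step (reduces_fun _ (reduces_beta _ vx)) _; rewrite !substE /=.
apply: reduces_step (reduces_beta _ vy) _; rewrite ?subst_value //.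
exact: reduces_refl.
Qed.

Lemma computable_snd (X Y : c -> etype) (p : forall i, (X i * Y i)%type) :
  computable c (fun i => ePair (X i) (Y i)) p -> computable c Y (fun i => (p i).2).
Proof.
apply: (@computable_app _ (Lam (App (Var 0) (Lam (Lam (Var 0))))) _ _ _ _ (fun=> 4)) => //.
  exact: polybounded_const.
move=> i _; have vx := encodeP (p i).1; have vy := encodeP (p i).2.
apply: reduces_step (reduces_beta _ (encodeP _)) _; rewrite !substE /=.
apply: reduces_step (reduces_beta _ _) _ => //; rewrite !substE /= !subst_value //.
apply: reduces_step (reduces_fun _ (reduces_beta _ vx)) _; rewrite !substE /=.
apply: reduces_step (reduces_beta _ vy) _; rewrite !substE /=.
exact: reduces_refl.
Qed.

End Basic.

(** * Recursion *)

(* [rec_nat rec_nat f z n] iterates [f] from [z]; self-application replaces a fixed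
   point, and the branches of the case analysis are delayed by a dummy abstraction. *)
Definition rec_nat : term :=
  Lam (Lam (Lam (Lam (App (App (App (Var 0) (Lam (Var 2)))
    (Lam (Lam (App (Var 4) (App (App (App (App (Var 5) (Var 5)) (Var 4)) (Var 3))
                                (Var 1)))))) idT)))).

Definition rec_seq : term :=
  Lam (Lam (Lam (Lam (App (App (App (Var 0) (Lam (Var 2)))
    (Lam (Lam (Lam (App (App (Var 5) (Var 2))
       (App (App (App (App (Var 6) (Var 6)) (Var 5)) (Var 4)) (Var 1))))))) idT)))).

Lemma reduces_rec_nat f (a : nat -> term) (T n : nat) :
  is_value f -> (forall j, is_value (a j)) ->
  (forall j, j < n -> reduces (App f (a j)) T (a j.+1)) ->
  reduces (App (App (App (App rec_nat rec_nat) f) (a 0)) (enc_nat n))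
          (n.+1 * (T + 8)) (a n).
Proof.
move=> vf va; have vr : is_value rec_nat by [].
have unfold r m : is_value r -> reduces (App (App (App (App rec_nat r) f) (a 0)) (enc_nat m)) 4
   (App (App (App (enc_nat m) (Lam (a 0))) (Lam (Lam (App f
     (App (App (App (App r r) f) (a 0)) (Var 1)))))) idT).
  move=> {}vr; apply: reduces_step; first by do 3 apply: reduces_fun; apply: reduces_beta vr.
  rewrite !substE /=.
  apply: reduces_step; first by do 2 apply: reduces_fun; apply: reduces_beta vf.
  rewrite !substE /= !(subst_value _ _ vr).
  apply: reduces_step; first by apply: reduces_fun; apply: reduces_beta (va 0).
  rewrite !substE /= !(subst_value _ _ vr) !(subst_value _ _ vf).
  apply: reduces_step; first by apply: reduces_beta (enc_nat_value m).
  rewrite !substE /= !(subst_value _ _ vr) !(subst_value _ _ vf) !(subst_value _ _ (va 0)).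
  exact: reduces_refl.
have v0 : is_value (Lam (a 0)) by rewrite /is_value /= value_scoped.
have vS : is_value (Lam (Lam (App f
     (App (App (App (App rec_nat rec_nat) f) (a 0)) (Var 1))))).
  by rewrite /is_value /= !value_scoped.
(* Only the unfolding property is needed from here on; abstracting the recursor keeps simplification
   out of its body. *)
move: rec_nat vr unfold => r vr unfold in v0 vS *.
elim: n => [|n IH] step.
  apply: reduces_trans (unfold _ _ vr) _ _.
    apply: reduces_trans (reduces_fun _ (reduces_zero v0 vS)) _ (leqnn _).
    apply: reduces_trans (reduces_beta _ _) _ (leqnn _) => //.
    by rewrite subst_value //; apply: (reduces_refl _ 0).
  lia.
apply: reduces_trans (unfold _ _ vr) _ _.
  apply: reduces_trans (reduces_fun _ (reduces_succ n v0 vS)) _ (leqnn _).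
  apply: reduces_trans (reduces_fun _ (reduces_beta _ (enc_nat_value n))) _ (leqnn _).
  rewrite !substE /= !(subst_value _ _ vf) !(subst_value _ _ vr) !(subst_value _ _ (va 0)).
  apply: reduces_trans (reduces_beta _ _) _ (leqnn _) => //.
  rewrite !substE !(subst_value _ _ vf) !(subst_value _ _ vr) !(subst_value _ _ (va 0)).
  rewrite (subst_value _ _ (enc_nat_value n)).
  apply: reduces_trans (reduces_arg _ (IH _)) (step _ (ltnSn n)) (leqnn _).
  by move=> j lt_jn; apply: step; rewrite ltnW.
rewrite !mulSn; lia.
Qed.

(** [a j] stands for the value of the fold on [drop j l]; hence the indices decrease, from
    [a (size l)] at the end of the list. *)
Lemma reduces_rec_seq f (X : etype) (l : seq X) (a : nat -> term) (T : nat) :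
  is_value f -> (forall j, is_value (a j)) ->
  (forall j x, j < size l -> drop j l = x :: drop j.+1 l ->
     reduces (App (App f (encode x)) (a j.+1)) T (a j)) ->
  reduces (App (App (App (App rec_seq rec_seq) f) (a (size l))) (encode (l : eSeq X)))
          ((size l).+1 * (T + 9)) (a 0).
Proof.
move=> vf va; have vr : is_value rec_seq by [].
have unfold r z (m : seq X) : is_value r -> is_value z ->
  reduces (App (App (App (App rec_seq r) f) z) (encode (m : eSeq X))) 4
   (App (App (App (encode (m : eSeq X)) (Lam z)) (Lam (Lam (Lam (App (App f (Var 2))
     (App (App (App (App r r) f) z) (Var 1))))))) idT).
  move=> {}vr vz; apply: reduces_step; first by do 3 apply: reduces_fun; apply: reduces_beta vr.
  rewrite !substE /=.
  apply: reduces_step; first by do 2 apply: reduces_fun; apply: reduces_beta vf.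
  rewrite !substE /= !(subst_value _ _ vr).
  apply: reduces_step; first by apply: reduces_fun; apply: reduces_beta vz.
  rewrite !substE /= !(subst_value _ _ vr) !(subst_value _ _ vf).
  apply: reduces_step; first by apply: reduces_beta (encodeP (m : eSeq X)).
  rewrite !substE /= !(subst_value _ _ vr) !(subst_value _ _ vf) !(subst_value _ _ vz).
  exact: reduces_refl.
move: rec_seq vr unfold => r vr unfold.
elim: l a va => [|x l IH] a va step.
  have vz := va 0; have v0 : is_value (Lam (a 0)) by rewrite /is_value /= value_scoped.
  have vS : is_value (Lam (Lam (Lam (App (App f (Var 2))
     (App (App (App (App r r) f) (a 0)) (Var 1)))))).
    by rewrite /is_value /= !value_scoped.
  apply: reduces_trans (unfold _ _ _ vr vz) _ _.
    apply: reduces_trans (reduces_fun _ (reduces_nil _ v0 vS)) _ (leqnn _).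
    apply: reduces_trans (reduces_beta _ _) _ (leqnn _) => //.
    by rewrite subst_value //; apply: (reduces_refl _ 0).
  by rewrite /= mul1n; lia.
have vz := va (size l).+1.
have vl := encodeP (l : eSeq X).
have v0 : is_value (Lam (a (size l).+1)) by rewrite /is_value /= value_scoped.
have vS : is_value (Lam (Lam (Lam (App (App f (Var 2))
     (App (App (App (App r r) f) (a (size l).+1)) (Var 1)))))).
  by rewrite /is_value /= !value_scoped.
apply: reduces_trans (unfold _ _ _ vr vz) _ _.
  apply: reduces_trans (reduces_fun _ (reduces_cons x l v0 vS)) _ (leqnn _).
  apply: reduces_trans (reduces_fun _ (reduces_fun _ (reduces_beta _ (encodeP x)))) _ (leqnn _).
  rewrite !substE /= !(subst_value _ _ vf) !(subst_value _ _ vr) !(subst_value _ _ vz).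
  apply: reduces_trans (reduces_fun _ (reduces_beta _ vl)) _ (leqnn _).
  rewrite !substE /= !(subst_value _ _ vf) !(subst_value _ _ vr) !(subst_value _ _ vz).
  rewrite ?(subst_value _ _ (encodeP x)).
  apply: reduces_trans (reduces_beta _ _) _ (leqnn _) => //.
  rewrite !substE !(subst_value _ _ vf) !(subst_value _ _ vr) !(subst_value _ _ vz).
  rewrite !(subst_value _ _ (encodeP x)) !(subst_value _ _ vl).
  apply: reduces_trans (reduces_arg _ (IH (fun j => a j.+1) _ _)) (step 0 x _ _) (leqnn _).
  - by move=> j; apply: va.
  - by move=> j y lt_j def_y; apply: step.
  - by [].
  - by rewrite /= drop0.
rewrite /= !mulSn; lia.
Qed.

End Evaluation.

Section Recursion.
Variable c : context.

(** The invariant [Q] has to carry whatever keeps each round cheap, such as the length of an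
    accumulated list. *)
Lemma computable_iter (X : c -> etype) (Q : forall i, X i -> Prop) (n : c -> nat)
    (z : forall i, X i) (f : forall i, X i -> X i) :
  (forall i, dom i -> Q i (z i)) ->
  (forall i x, dom i -> Q i x -> Q i (f i x)) ->
  polybounded n ->
  computable c (fun=> eNat) n -> computable c X z ->
  computable (ext c X Q) (fun k => X (projT1 k)) (fun k => f (projT1 k) (projT2 k)) ->
  computable c X (fun i => iter (n i) (f i) (z i)).
Proof.
move=> Qz Qf bn [tn [Tn [sn pn rn]]] [tz [Tz [sz pz rz]]] [tf [Tf [sf [ef pf] rf]]].
exists (App (App (App (App rec_nat rec_nat) (Lam tf)) tz) tn).
exists (fun i => Tz i + (Tn i + (n i).+1 * ((1 + (bound i).+2 ^ ef) + 8))); split.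
- by rewrite /= sn sz sf.
- by polybound.
move=> i ci; have val_i := env_values i.
move: sn sz sf; rewrite /= -(size_env i) => sn sz sf.
apply: reduces_trans (reduces_fun _ (reduces_arg _ (rz i ci))) _ (leqnn _).
apply: reduces_trans (reduces_arg _ (rn i ci)) _ (leqnn _).
apply: (@reduces_rec_nat _ (fun j => encode (iter j (f i) (z i)))).
- exact: closure_value.
- by move=> j; apply: encodeP.
move=> j _; apply: reduces_trans (reduces_beta _ (encodeP _)) _ (leqnn _).
rewrite subst_msubst //; set x := iter j _ _.
have Qx : Q i x by rewrite /x; elim: j {x} => /= [|j IH]; auto.
have ck : dom (existT _ i x : ext c X Q) by [].
by apply: reduces_le (rf _ ck); apply: (pf _ ck).
Qed.

(** The invariant is asked only of the folds over suffixes of [l i], so exact knowledge of the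
    intermediate results may serve to prove it. Membership is [List.In] because an [etype] carries
    no decidable equality. *)
Lemma computable_foldr (X Y : c -> etype) (Q : forall i, Y i -> Prop)
    (l : forall i, seq (X i)) (z : forall i, Y i) (f : forall i, X i -> Y i -> Y i) :
  (forall i s1 s2, dom i -> l i = s1 ++ s2 -> Q i (foldr (f i) (z i) s2)) ->
  polybounded (fun i => size (l i)) ->
  computable c (fun i => eSeq (X i)) l -> computable c Y z ->
  computable (ext (ext c X (fun i x => List.In x (l i)))
                  (fun k => Y (projT1 k)) (fun k y => Q (projT1 k) y))
    (fun k => Y (projT1 (projT1 k)))
    (fun k => f (projT1 (projT1 k)) (projT2 (projT1 k)) (projT2 k)) ->
  computable c Y (fun i => foldr (f i) (z i) (l i)).
Proof.
move=> Qf bl [tl [Tl [sl pl rl]]] [tz [Tz [sz pz rz]]] [tf [Tf [sf [ef pf] rf]]].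
exists (App (App (App (App rec_seq rec_seq) (Lam (Lam tf))) tz) tl).
exists (fun i => Tz i + (Tl i + (size (l i)).+1 * ((1 + (1 + (bound i).+2 ^ ef)) + 9))).
split; [by rewrite /= sl sz sf | by polybound |].
move=> i ci; have val_i := env_values i.
move: sl sz sf; rewrite /= -(size_env i) => sl sz sf.
apply: reduces_trans (reduces_fun _ (reduces_arg _ (rz i ci))) _ (leqnn _).
apply: reduces_trans (reduces_arg _ (rl i ci)) _ (leqnn _).
pose a j := encode (foldr (f i) (z i) (drop j (l i))).
have -> : encode (z i) = a (size (l i)) by rewrite /a drop_size.
have -> : encode (foldr (f i) (z i) (l i)) = a 0 by rewrite /a drop0.
apply: reduces_rec_seq.
- by rewrite /is_value /= andbT scoped_msubst.
- by move=> j; apply: encodeP.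
move=> j x lt_j def_x.
have vx := encodeP x.
apply: reduces_trans (reduces_fun _ (reduces_beta _ vx)) _ (leqnn _).
rewrite substE subst_msubst //.
apply: reduces_trans (reduces_beta _ (encodeP _)) _ (leqnn _).
rewrite subst_msubst ?/a /= ?vx //; set y := foldr _ _ (drop j.+1 _).
have In_drop m u : List.In u (drop m (l i)) -> List.In u (l i).
  by elim: (l i) m => [|w s IHs] [|m] //= /IHs; right.
have Qy : Q i y by apply: Qf (esym (cat_take_drop j.+1 _)).
have In_x : List.In x (l i) by apply: (In_drop j); rewrite def_x; left.
pose k : ext (ext c X (fun i x => List.In x (l i)))
      (fun k => Y (projT1 k)) (fun k y => Q (projT1 k) y) := existT _ (existT _ i x) y.
have ck : dom k by [].
apply: reduces_le (pf _ ck) _.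
by have := rf _ ck; rewrite /= def_x.
Qed.

End Recursion.

(** Elements are coded by their ranks, so this amounts to computing a polynomially bounded cardinal;
    see [listable_card]. *)
Definition listable (c : context) (T : c -> finType) : Prop :=
  polybounded (fun i => #|T i|) /\
  computable c (fun i => eSeq (eElt (T i))) (fun i => enum (T i)).
Arguments listable : clear implicits.

Lemma listable_wk (c : context) (X : c -> etype) (Q : forall i, X i -> Prop) T :
  listable c T -> listable (ext c X Q) (fun k => T (projT1 k)).
Proof. by case=> bT cT; split; [exact: polybounded_wk bT | exact: computable_wk cT]. Qed.

Lemma listable_restrict (c : context) (p : c -> Prop) T :
  listable c T -> listable (restrict c p) T.
Proof. by case=> bT cT; split; [exact: polybounded_restrict bT | exact: computable_restrict cT]. Qed.

(* [known] closes a goal that some hypothesis, or a variable of the context, provides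
   up to weakening by [ext] and [restrict]. *)
Ltac weaken H ctx :=
  let base := lazymatch type of H with
    | computable ?b _ _ => eval cbv beta in b
    | listable ?b _ => eval cbv beta in b
    | @polybounded ?b _ => eval cbv beta in b
    end in
  match ctx with
  | base => constr:(H)
  | ext ?c ?X ?Q =>
    let K := weaken H c in
    lazymatch type of H with
    | computable _ _ _ => constr:(@computable_wk c X Q _ _ K)
    | listable _ _ => constr:(@listable_wk c X Q _ K)
    | @polybounded _ _ => constr:(@polybounded_wk c X Q _ K)
    end
  | restrict ?c ?p =>
    let K := weaken H c in
    lazymatch type of H with
    | computable _ _ _ => constr:(@computable_restrict c p _ _ K)
    | listable _ _ => constr:(@listable_restrict c p _ K)
    | @polybounded _ _ => constr:(@polybounded_restrict c p _ K)
    end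
  | _ =>
    let d := eval unfold ctx in ctx in
    let d := eval cbv beta in d in weaken H d
  end.
Ltac variables ctx :=
  lazymatch ctx with
  | ext ?c ?X ?Q => pose proof (@computable_var c X Q); variables c
  | restrict ?c ?p => variables c
  | _ =>
    tryif is_var ctx then
      try (let d := eval unfold ctx in ctx in
           let d := eval cbv beta in d in variables d)
    else idtac
  end.
Ltac known :=
  lazymatch goal with
  | |- listable ?ctx _ =>
    let ctx := eval cbv beta in ctx in
    match goal with H : listable _ _ |- _ => let K := weaken H ctx in exact K end
  | |- @polybounded ?ctx _ =>
    let ctx := eval cbv beta in ctx in
    match goal with H : @polybounded _ _ |- _ => let K := weaken H ctx in exact K end
  | |- computable ?ctx _ _ =>
    let ctx := eval cbv beta in ctx in
    variables ctx;
    match goal with H : computable _ _ _ |- _ => let K := weaken H ctx in exact K end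
  end.

(** * Computing with booleans, lists and numbers *)

Lemma computable_bool (c : context) b : computable c (fun=> eBool) (fun=> b).
Proof. exact: (@computable_const _ eBool). Qed.

Lemma computable_neg (c : context) (b : c -> bool) :
  computable c (fun=> eBool) b -> computable c (fun=> eBool) (fun i => ~~ b i).
Proof.
move=> cb; have: computable c (fun=> eBool) (fun i => if b i then false else true).
  by apply: computable_if => //; apply: (@computable_const _ eBool).
by apply: computable_ext => i _; case: (b i).
Qed.

Lemma computable_and (c : context) (a b : c -> bool) :
  computable c (fun=> eBool) a -> computable (restrict c a) (fun=> eBool) b ->
  computable c (fun=> eBool) (fun i => a i && b i).
Proof.
by move=> ca cb; apply: computable_if => //; apply: (@computable_const _ eBool).
Qed.

Lemma computable_or (c : context) (a b : c -> bool) :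
  computable c (fun=> eBool) a -> computable (restrict c (fun i => ~~ a i)) (fun=> eBool) b ->
  computable c (fun=> eBool) (fun i => a i || b i).
Proof.
by move=> ca cb; apply: computable_if => //; apply: (@computable_const _ eBool).
Qed.

Lemma computable_nil (c : context) (X : c -> etype) :
  computable c (fun i => eSeq (X i)) (fun i => [::]).
Proof.
by apply: computable_recode (@computable_const c (eSeq eNat) [::]).
Qed.

Lemma computable_map (c : context) (X Y : c -> etype) (l : forall i, seq (X i))
    (f : forall i, X i -> Y i) :
  polybounded (fun i => size (l i)) ->
  computable c (fun i => eSeq (X i)) l ->
  computable (ext c X (fun i x => List.In x (l i))) (fun k => Y (projT1 k))
    (fun k => f (projT1 k) (projT2 k)) ->
  computable c (fun i => eSeq (Y i)) (fun i => [seq f i x | x <- l i]).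
Proof.
move=> bl cl cf.
apply: (@computable_ext _ (fun i => eSeq (Y i)) (fun i => foldr (fun x s => f i x :: s) [::] (l i))).
  by move=> i _; elim: (l i) => //= x s ->.
apply: (@computable_foldr _ X (fun i => eSeq (Y i)) (fun _ _ => True)) => //.
  exact: computable_nil.
apply: computable_cons; known.
Qed.

Lemma computable_filter (c : context) (X : c -> etype) (l : forall i, seq (X i))
    (p : forall i, X i -> bool) :
  polybounded (fun i => size (l i)) ->
  computable c (fun i => eSeq (X i)) l ->
  computable (ext c X (fun i x => List.In x (l i))) (fun=> eBool)
    (fun k => p (projT1 k) (projT2 k)) ->
  computable c (fun i => eSeq (X i)) (fun i => [seq x <- l i | p i x]).
Proof.
move=> bl cl cp.
apply: (@computable_ext _ (fun i => eSeq (X i)) (fun i => foldr (fun x s => if p i x then x :: s else s) [::] (l i))).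
  by move=> i _; elim: (l i) => //= x s ->.
apply: (@computable_foldr _ X (fun i => eSeq (X i)) (fun _ _ => True)) => //.
  exact: computable_nil.
apply: computable_if; try known.
by apply: computable_cons; known.
Qed.

Lemma computable_has (c : context) (X : c -> etype) (l : forall i, seq (X i)) (p : forall i, X i -> bool) :
  polybounded (fun i => size (l i)) ->
  computable c (fun i => eSeq (X i)) l ->
  computable (ext c X (fun i x => List.In x (l i))) (fun=> eBool)
    (fun k => p (projT1 k) (projT2 k)) ->
  computable c (fun=> eBool) (fun i => has (p i) (l i)).
Proof.
move=> bl cl cp.
apply: (@computable_ext _ (fun=> eBool) (fun i => foldr (fun x b => p i x || b) false (l i))) => //.
apply: (@computable_foldr _ X (fun=> eBool) (fun _ _ => True)) => //.
  exact: computable_bool.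
by apply: computable_or; known.
Qed.

Lemma computable_all (c : context) (X : c -> etype) (l : forall i, seq (X i)) (p : forall i, X i -> bool) :
  polybounded (fun i => size (l i)) ->
  computable c (fun i => eSeq (X i)) l ->
  computable (ext c X (fun i x => List.In x (l i))) (fun=> eBool)
    (fun k => p (projT1 k) (projT2 k)) ->
  computable c (fun=> eBool) (fun i => all (p i) (l i)).
Proof.
move=> bl cl cp.
apply: (@computable_ext _ (fun=> eBool) (fun i => foldr (fun x b => p i x && b) true (l i))) => //.
apply: (@computable_foldr _ X (fun=> eBool) (fun _ _ => True)) => //.
  exact: computable_bool.
by apply: computable_and; known.
Qed.

Lemma computable_cat (c : context) (X : c -> etype) (l m : forall i, seq (X i)) :
  polybounded (fun i => size (l i)) ->
  computable c (fun i => eSeq (X i)) l -> computable c (fun i => eSeq (X i)) m ->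
  computable c (fun i => eSeq (X i)) (fun i => l i ++ m i).
Proof.
move=> bl cl cm.
apply: (@computable_ext _ (fun i => eSeq (X i)) (fun i => foldr (fun x s => x :: s) (m i) (l i))).
  by move=> i _; elim: (l i) => //= x s ->.
apply: (@computable_foldr _ X (fun i => eSeq (X i)) (fun _ _ => True)) => //.
by apply: computable_cons; known.
Qed.

Lemma computable_flatten (c : context) (X : c -> etype) (l : forall i, seq (seq (X i))) :
  polybounded (fun i => size (l i)) ->
  @polybounded (ext c (fun i => eSeq (X i)) (fun i x => List.In x (l i)))
    (fun k => size (projT2 k)) ->
  computable c (fun i => eSeq (eSeq (X i))) l ->
  computable c (fun i => eSeq (X i)) (fun i => flatten (l i)).
Proof.
move=> bl bx cl.
apply: (@computable_foldr _ (fun i => eSeq (X i)) (fun i => eSeq (X i)) (fun _ _ => True)) => //.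
  exact: computable_nil.
by apply: computable_cat; [exact: polybounded_wk bx | known | known].
Qed.

Lemma computable_size (c : context) (X : c -> etype) (l : forall i, seq (X i)) :
  polybounded (fun i => size (l i)) ->
  computable c (fun i => eSeq (X i)) l -> computable c (fun=> eNat) (fun i => size (l i)).
Proof.
move=> bl cl.
apply: (@computable_ext _ (fun=> eNat) (fun i => foldr (fun _ n => n.+1) 0 (l i))).
  by move=> i _; elim: (l i) => //= x s ->.
apply: (@computable_foldr _ X (fun=> eNat) (fun _ _ => True)) => //.
  exact: (@computable_const _ eNat).
by apply: computable_succ; known.
Qed.

Lemma computable_head (c : context) (X : c -> etype) (x0 : forall i, X i) (l : forall i, seq (X i)) :
  computable c X x0 -> computable c (fun i => eSeq (X i)) l ->
  computable c X (fun i => head (x0 i) (l i)).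
Proof. by move=> cx cl; apply: computable_seqcase cl _ _; known. Qed.

Lemma computable_behead (c : context) (X : c -> etype) (l : forall i, seq (X i)) :
  computable c (fun i => eSeq (X i)) l ->
  computable c (fun i => eSeq (X i)) (fun i => behead (l i)).
Proof.
move=> cl; apply: computable_seqcase cl _ _; last by known.
exact: computable_nil.
Qed.

Lemma computable_nat (c : context) n : computable c (fun=> eNat) (fun=> n).
Proof. exact: (@computable_const _ eNat). Qed.

Lemma computable_pred (c : context) (n : c -> nat) :
  computable c (fun=> eNat) n -> computable c (fun=> eNat) (fun i => (n i).-1).
Proof. by move=> cn; apply: (@computable_natcase _ (fun=> eNat) n n (fun _ m => m)) => //; known. Qed.

Lemma computable_eq0 (c : context) (n : c -> nat) :
  computable c (fun=> eNat) n -> computable c (fun=> eBool) (fun i => n i == 0).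
Proof.
move=> cn; have: computable c (fun=> eBool) (fun i => if n i is _.+1 then false else true).
  by apply: computable_natcase cn _ _; apply: computable_bool.
by apply: computable_ext => i _; case: (n i).
Qed.

Lemma computable_add (c : context) (m n : c -> nat) : polybounded m ->
  computable c (fun=> eNat) m -> computable c (fun=> eNat) n ->
  computable c (fun=> eNat) (fun i => m i + n i).
Proof.
move=> bm cm cn; apply: (@computable_ext _ (fun=> eNat) (fun i => iter (m i) succn (n i))).
  by move=> i _; rewrite iter_succn addnC.
by apply: (@computable_iter _ (fun=> eNat) (fun _ _ => True)) => //; apply: computable_succ; known.
Qed.

Lemma computable_sub (c : context) (m n : c -> nat) : polybounded n ->
  computable c (fun=> eNat) m -> computable c (fun=> eNat) n ->
  computable c (fun=> eNat) (fun i => m i - n i).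
Proof.
move=> bn cm cn; apply: (@computable_ext _ (fun=> eNat) (fun i => iter (n i) predn (m i))).
  by move=> i _; rewrite iter_predn.
by apply: (@computable_iter _ (fun=> eNat) (fun _ _ => True)) => //; apply: computable_pred; known.
Qed.

Lemma computable_leq (c : context) (m n : c -> nat) : polybounded n ->
  computable c (fun=> eNat) m -> computable c (fun=> eNat) n ->
  computable c (fun=> eBool) (fun i => m i <= n i).
Proof. by move=> *; apply: computable_eq0; apply: computable_sub. Qed.

Lemma computable_eqn (c : context) (m n : c -> nat) : polybounded m -> polybounded n ->
  computable c (fun=> eNat) m -> computable c (fun=> eNat) n ->
  computable c (fun=> eBool) (fun i => m i == n i).
Proof.
move=> bm bn cm cn; apply: (@computable_ext _ (fun=> eBool) (fun i => (m i <= n i) && (n i <= m i))).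
  by move=> i _; rewrite eqn_leq.
apply: computable_and; first exact: computable_leq.
by apply: computable_leq; [apply: polybounded_restrict | known | known].
Qed.

Lemma computable_iota0 (c : context) (n : c -> nat) : polybounded n ->
  computable c (fun=> eNat) n -> computable c (fun=> eSeq eNat) (fun i => iota 0 (n i)).
Proof.
move=> bn cn.
(* Counting down from [n i] lets [cons] build the list in increasing order; the first component is
   the lower end reached so far. *)
pose f (p : nat * seq nat) := (p.1.-1, p.1.-1 :: p.2).
apply: (@computable_ext _ (fun=> eSeq eNat) (fun i => (iter (n i) f (n i, [::])).2)).
  move=> i _; have iterE k : k <= n i -> iter k f (n i, [::]) = (n i - k, iota (n i - k) k).
    elim: k => [|k IH] lt_k; first by rewrite subn0.
    rewrite iterS IH ?(ltnW lt_k) // /f /= -!subnS.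
    by rewrite -[(n i - k.+1).+1]subSn // subSS.
  by rewrite iterE // subnn.
apply: (@computable_snd _ (fun=> eNat) (fun=> eSeq eNat)).  
apply: (@computable_iter _ (fun=> ePair eNat (eSeq eNat)) (fun _ _ => True)) => //.
  by apply: computable_pair => //; apply: computable_nil.
have cp : computable (ext c (fun=> ePair eNat (eSeq eNat)) (fun _ _ => True))
    (fun=> eNat) (fun k => (projT2 k).1.-1).
  by apply: computable_pred; apply: (@computable_fst _ _ (fun=> eSeq eNat)); known.
apply: computable_pair => //; apply: computable_cons => //.
by apply: (@computable_snd _ (fun=> eNat) (fun=> eSeq eNat)); known.
Qed.

Lemma computable_drop (c : context) (X : c -> etype) (n : c -> nat) (l : forall i, seq (X i)) :
  polybounded n ->
  computable c (fun=> eNat) n -> computable c (fun i => eSeq (X i)) l ->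
  computable c (fun i => eSeq (X i)) (fun i => drop (n i) (l i)).
Proof.
move=> bn cn cl; apply: (@computable_ext _ (fun i => eSeq (X i)) (fun i => iter (n i) behead (l i))).
  move=> i _; elim: (n i) (l i) => [|k IH] s; first by rewrite drop0.
  by rewrite iterSr -IH; case: s.
apply: (@computable_iter _ (fun i => eSeq (X i)) (fun _ _ => True)) => //.
by apply: computable_behead; known.
Qed.

Lemma computable_nth (c : context) (X : c -> etype) (x0 : forall i, X i) (n : c -> nat)
    (l : forall i, seq (X i)) :
  polybounded n -> computable c X x0 ->
  computable c (fun=> eNat) n -> computable c (fun i => eSeq (X i)) l ->
  computable c X (fun i => nth (x0 i) (l i) (n i)).
Proof.
move=> bn cx cn cl; apply: (@computable_ext _ X (fun i => head (x0 i) (drop (n i) (l i)))).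
  by move=> i _; rewrite -nth0 nth_drop addn0.
by apply: computable_head => //; apply: computable_drop.
Qed.

Lemma computable_absurd (c : context) (X : c -> etype) (x : forall i, X i) :
  (forall i : c, dom i -> False) -> computable c X x.
Proof.
move=> nd; exists idT, (fun=> 0); split=> //; first exact: polybounded_const.
by move=> i /nd.
Qed.

(** * Finite types, their elements and their subsets *)

Lemma enc_seq_map (A B : Type) (e : B -> term) (f : A -> B) (l : seq A) :
  enc_seq e [seq f x | x <- l] = enc_seq (fun x => e (f x)) l.
Proof. by elim: l => //= x l ->. Qed.

Lemma map_rank_enum (T : finType) :
  [seq (enum_rank x : nat) | x <- enum T] = iota 0 #|T|.
Proof.
apply: (@eq_from_nth _ 0); rewrite size_map -cardE ?size_iota // => j lt_j.
pose x := enum_val (Ordinal lt_j); rewrite (nth_map x) -?cardE // nth_iota //.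
by rewrite -(enum_val_nth x (Ordinal lt_j)) enum_valK.
Qed.

Lemma enc_enum (T : finType) : enc_seq (@enc_elt T) (enum T) = enc_seq enc_nat (iota 0 #|T|).
Proof. by rewrite -map_rank_enum enc_seq_map. Qed.

Lemma enum_filter (T : finType) (p : pred T) : enum p = [seq x <- enum T | p x].
Proof. by rewrite enumT /enum_mem; apply: eq_filter => x. Qed.

Section Finite.
Variable c : context.
Implicit Types T : c -> finType.

Lemma listable_card T : polybounded (fun i => #|T i|) ->
  computable c (fun=> eNat) (fun i => #|T i|) -> listable c T.
Proof.
move=> bT cT; split=> //.
have ci : computable c (fun=> eSeq eNat) (fun i => iota 0 #|T i|).
  exact: computable_iota0.
by apply: computable_recode ci => i _; apply: enc_enum.
Qed.

Lemma listable_size T (X : c -> etype) (l : forall i, seq (X i)) :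
  (forall i, dom i -> size (l i) = #|T i|) -> polybounded (fun i => #|T i|) ->
  computable c (fun i => eSeq (X i)) l -> listable c T.
Proof.
move=> size_l bT cl; apply: listable_card => //.
apply: (@computable_ext _ (fun=> eNat) (fun i => size (l i))) => [i /size_l//|].
by apply: computable_size cl; apply: polybounded_le bT => i /size_l ->.
Qed.

Lemma polybounded_enum_rank T (x : forall i, T i) :
  polybounded (fun i => #|T i|) -> polybounded (fun i => enum_rank (x i) : nat).
Proof. by apply: polybounded_le => i _; apply: ltnW; apply: ltn_ord. Qed.

Lemma polybounded_enum T (A : forall i, {set T i}) :
  polybounded (fun i => #|T i|) -> polybounded (fun i => size (enum (A i))).
Proof. by apply: polybounded_le => i _; rewrite -cardE max_card. Qed.

Lemma computable_rank T (x : forall i, T i) :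
  computable c (fun i => eElt (T i)) x -> computable c (fun=> eNat) (fun i => enum_rank (x i) : nat).
Proof. by move=> cx; apply: computable_recode cx. Qed.

Lemma computable_eqelt T (x y : forall i, T i) : polybounded (fun i => #|T i|) ->
  computable c (fun i => eElt (T i)) x -> computable c (fun i => eElt (T i)) y ->
  computable c (fun=> eBool) (fun i => x i == y i).
Proof.
move=> bT cx cy.
apply: (@computable_ext _ (fun=> eBool) (fun i => (enum_rank (x i) : nat) == enum_rank (y i))).
  by move=> i _; rewrite (inj_eq (@ord_inj _)) (inj_eq enum_rank_inj).
by apply: computable_eqn; try apply: computable_rank => //; apply: polybounded_enum_rank.
Qed.

(** No program for [f] is required, only its table in the order of ranks. Adjacency, parents and
    bags are read off the input in this way. *)
Lemma computable_lookup T (X : c -> etype) (f : forall i, T i -> X i) (t : forall i, T i) :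
  polybounded (fun i => #|T i|) ->
  computable c (fun i => eSeq (X i)) (fun i => [seq f i x | x <- enum (T i)]) ->
  computable c (fun i => eElt (T i)) t ->
  computable c X (fun i => f i (t i)).
Proof.
move=> bT cf ct.
pose l i := drop (enum_rank (t i)) [seq f i x | x <- enum (T i)].
have lE i : exists s, l i = f i (t i) :: s.
  have lt_t : enum_rank (t i) < size (enum (T i)) by rewrite -cardE ltn_ord.
  have nthE := nth_map (t i) (f i (t i)) (f i) lt_t.
  exists (drop (enum_rank (t i)).+1 [seq f i x | x <- enum (T i)]).
  have lt_m : enum_rank (t i) < size [seq f i x | x <- enum (T i)] by rewrite size_map.
  by rewrite /l (drop_nth (f i (t i)) lt_m) [X in X :: _]nthE -enum_val_nth enum_rankK.
apply: (@computable_ext _ X (fun i => if l i is x :: _ then x else f i (t i))).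
  by move=> i _; have [s ->] := lE i.
apply: (@computable_seqcase _ X X); last known.
- apply: computable_drop; [exact: polybounded_enum_rank | exact: computable_rank | by []].
- by apply: computable_absurd => i [_ /=]; have [s ->] := lE i.
Qed.

Lemma computable_enum_set T (A : forall i, {set T i}) :
  computable c (fun i => eSet (T i)) A ->
  computable c (fun i => eSeq (eElt (T i))) (fun i => enum (A i)).
Proof. by move=> cA; apply: computable_recode cA. Qed.

(** Filtering the enumeration of the type produces exactly the increasing list that codes the set,
    so the set operations reduce to membership tests. *)
Lemma computable_set T (p : forall i, T i -> bool) : listable c T ->
  computable (ext c (fun i => eElt (T i)) (fun i x => List.In x (enum (T i))))
    (fun=> eBool) (fun k => p (projT1 k) (projT2 k)) ->
  computable c (fun i => eSet (T i)) (fun i => [set x | p i x]).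
Proof.
move=> [bT cT] cp.
have cf : computable c (fun i => eSeq (eElt (T i))) (fun i => [seq x <- enum (T i) | p i x]).
  by apply: computable_filter => //; apply: polybounded_le bT => i _; rewrite -cardE.
apply: computable_recode cf => i _ /=; rewrite /enc_set; congr enc_seq.
by rewrite -enum_filter; apply: eq_enum => x; rewrite inE.
Qed.

Lemma computable_exists T (A : forall i, {set T i}) (p : forall i, T i -> bool) :
  polybounded (fun i => #|T i|) -> computable c (fun i => eSet (T i)) A ->
  computable (ext c (fun i => eElt (T i)) (fun i x => List.In x (enum (A i))))
    (fun=> eBool) (fun k => p (projT1 k) (projT2 k)) ->
  computable c (fun=> eBool) (fun i => [exists x in A i, p i x]).
Proof.
move=> bT cA cp; apply: (@computable_ext _ (fun=> eBool) (fun i => has (p i) (enum (A i)))).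
  move=> i _; apply/exists_inP/hasP => [][x Ax px]; exists x => //; by rewrite mem_enum in Ax *.
by apply: (@computable_has _ (fun i => eElt (T i))) => //; exact: polybounded_enum.
Qed.

Lemma computable_forall T (A : forall i, {set T i}) (p : forall i, T i -> bool) :
  polybounded (fun i => #|T i|) -> computable c (fun i => eSet (T i)) A ->
  computable (ext c (fun i => eElt (T i)) (fun i x => List.In x (enum (A i))))
    (fun=> eBool) (fun k => p (projT1 k) (projT2 k)) ->
  computable c (fun=> eBool) (fun i => [forall x in A i, p i x]).
Proof.
move=> bT cA cp; apply: (@computable_ext _ (fun=> eBool) (fun i => all (p i) (enum (A i)))).
  move=> i _; apply/forall_inP/allP => pA x Ax; apply: pA; by rewrite mem_enum in Ax *.
by apply: (@computable_all _ (fun i => eElt (T i))) => //; exact: polybounded_enum.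
Qed.

Lemma computable_card T (A : forall i, {set T i}) : polybounded (fun i => #|T i|) ->
  computable c (fun i => eSet (T i)) A -> computable c (fun=> eNat) (fun i => #|A i|).
Proof.
move=> bT cA; apply: (@computable_ext _ (fun=> eNat) (fun i => size (enum (A i)))).
  by move=> i _; rewrite cardE.
apply: (@computable_size _ (fun i => eElt (T i))); first exact: polybounded_enum.
exact: computable_enum_set.
Qed.

End Finite.

Lemma computable_mem (c : context) (T : c -> finType) (x : forall i, T i)
    (A : forall i, {set T i}) :
  polybounded (fun i => #|T i|) ->
  computable c (fun i => eElt (T i)) x -> computable c (fun i => eSet (T i)) A ->
  computable c (fun=> eBool) (fun i => x i \in A i).
Proof.
move=> bT cx cA; apply: (@computable_ext _ (fun=> eBool) (fun i => [exists y in A i, y == x i])).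
  by move=> i _; apply/idP/exists_inP => [Ax|[y Ay /eqP <-] //]; exists (x i).
apply: computable_exists => //; apply: computable_eqelt; known.
Qed.

Lemma computable_subset (c : context) (T : c -> finType) (A B : forall i, {set T i}) :
  polybounded (fun i => #|T i|) ->
  computable c (fun i => eSet (T i)) A -> computable c (fun i => eSet (T i)) B ->
  computable c (fun=> eBool) (fun i => A i \subset B i).
Proof.
move=> bT cA cB; apply: (@computable_ext _ (fun=> eBool) (fun i => [forall y in A i, y \in B i])).
  by move=> i _; apply/subsetP/forall_inP.
apply: computable_forall => //; apply: computable_mem; known.
Qed.

Lemma computable_set0 (c : context) (T : c -> finType) :
  computable c (fun i => eSet (T i)) (fun i => set0).
Proof.
have : computable c (fun=> eSeq eNat) (fun=> [::]) by apply: computable_nil.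
by apply: computable_recode => i _ /=; rewrite /enc_set enum_set0.
Qed.

Section Sets.
Variables (c : context) (T : c -> finType).
Hypothesis lT : listable c T.

Let bT : polybounded (fun i => #|T i|). Proof. by case: lT. Qed.

Lemma computable_setT : computable c (fun i => eSet (T i)) (fun i => [set: T i]).
Proof.
by case: lT => _; apply: computable_recode => i _; rewrite /= /enc_set enum_setT enumT.
Qed.

Lemma computable_set1 (x : forall i, T i) :
  computable c (fun i => eElt (T i)) x -> computable c (fun i => eSet (T i)) (fun i => [set x i]).
Proof.
move=> cx; apply: (@computable_ext _ (fun i => eSet (T i)) (fun i => [set y | y == x i])).
  by move=> i _; apply/setP=> y; rewrite !inE.
by apply: computable_set => //; apply: computable_eqelt; known.
Qed.

Variables A B : forall i, {set T i}.
Hypothesis cA : computable c (fun i => eSet (T i)) A.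
Hypothesis cB : computable c (fun i => eSet (T i)) B.

Lemma computable_setU : computable c (fun i => eSet (T i)) (fun i => A i :|: B i).
Proof.
apply: (@computable_ext _ (fun i => eSet (T i)) (fun i => [set y | (y \in A i) || (y \in B i)])).
  by move=> i _; apply/setP=> y; rewrite !inE.
by apply: computable_set => //; apply: computable_or; apply: computable_mem; known.
Qed.

Lemma computable_setC : computable c (fun i => eSet (T i)) (fun i => ~: A i).
Proof.
apply: (@computable_ext _ (fun i => eSet (T i)) (fun i => [set y | y \notin A i])).
  by move=> i _; apply/setP=> y; rewrite !inE.
by apply: computable_set => //; apply: computable_neg; apply: computable_mem; known.
Qed.

Lemma computable_setD : computable c (fun i => eSet (T i)) (fun i => A i :\: B i).
Proof.
apply: (@computable_ext _ (fun i => eSet (T i)) (fun i => [set y | (y \notin B i) && (y \in A i)])).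
  by move=> i _; apply/setP=> y; rewrite !inE.
apply: computable_set => //; apply: computable_and; last by apply: computable_mem; known.
by apply: computable_neg; apply: computable_mem; known.
Qed.

End Sets.

Lemma computable_adj (c : context) (G : c -> sgraph) (u v : forall i, G i) :
  polybounded (fun i => #|G i|) -> computable c (fun=> eGraph) G ->
  computable c (fun i => eElt (G i)) u -> computable c (fun i => eElt (G i)) v ->
  computable c (fun=> eBool) (fun i => adj (u i) (v i)).
Proof.
move=> bG cG cu cv; apply: (@computable_lookup _ _ (fun=> eBool) (fun i v => adj (u i) v)) => //.
apply: (@computable_lookup _ _ (fun=> eSeq eBool)
  (fun i u => [seq adj u v | v <- enum (G i)])) => //.
Qed.

(** * Closed programs and sizes of encodings *)

Fact enc_rat_value q : is_value (enc_rat q).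
Proof. exact: (@enc_pair_value eNat eNat (_, _)). Qed.
Definition eRat : etype := EType enc_rat_value.

Lemma msubst_nil k t : msubst [::] k t = t.
Proof.
elim: t k => [n|t1 IH1 t2 IH2|t IH] k /=; last by rewrite IH.
  by rewrite nth_nil if_same.
by rewrite IH1 IH2.
Qed.

(** A free variable is exposed by substituting an abstraction for it. *)
Lemma closed_term_scoped s : closed_term s -> scoped 0 s.
Proof.
move=> cs; have {cs}: forall k u, 0 <= k -> subst s k u = s by move=> k u _; apply: cs.
elim: s 0 => [n|s1 IH1 s2 IH2|s IH] m /= cs.
- rewrite ltnNge; apply/negP => le_mn.
  by have := cs n (Lam (Var 0)) le_mn; rewrite eqxx.
- by rewrite IH1 ?IH2 // => k u /(cs k u)[].
- by apply: IH => -[//|k] u lt_mk; have [] := cs k u lt_mk.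
Qed.

Lemma term_size_enc_nat n : term_size (enc_nat n) = 4 * n.+1.
Proof. by elim: n => //= n ->; lia. Qed.

Lemma size_le_enc_seq (X : Type) (e : X -> term) l : size l <= term_size (enc_seq e l).
Proof. by elim: l => //= x l; lia. Qed.

Lemma term_size_enc_seq_le (X : Type) (e : X -> term) l m :
  (forall x, List.In x l -> term_size (e x) <= m) ->
  term_size (enc_seq e l) <= 4 + size l * (5 + m).
Proof.
elim: l => //= x l IH le_m; have := IH (fun y yl => le_m y (or_intror yl)).
have := le_m x (or_introl erefl); rewrite mulSn; lia.
Qed.

Lemma term_size_enc_graph_le G : term_size (enc_graph G) <= 4 + #|G| * (9 + #|G| * 9).
Proof.
rewrite /enc_graph enc_seq_map.
apply: leq_trans (@term_size_enc_seq_le _ _ _ (4 + #|G| * 9) _) _; last by rewrite -cardE addnA.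
move=> u _; rewrite enc_seq_map cardE; apply: (@term_size_enc_seq_le _ _ _ 4) => v _.
by case: adj.
Qed.

Lemma card_le_enc_graph (G : sgraph) : #|G| <= term_size (enc_graph G).
Proof. by apply: leq_trans (size_le_enc_seq _ _); rewrite size_map cardE. Qed.

Lemma term_size_enc_elt_le (T : finType) (x : T) : term_size (enc_elt x) <= 4 * #|T|.
Proof. by rewrite term_size_enc_nat leq_mul2l ltn_ord. Qed.

Lemma term_size_enc_set_le (T : finType) (A : {set T}) :
  term_size (enc_set A) <= 4 + #|T| * (5 + 4 * #|T|).
Proof.
apply: leq_trans (@term_size_enc_seq_le _ _ _ (4 * #|T|) _) _.
  by move=> x _; apply: term_size_enc_elt_le.
by rewrite leq_add2l leq_mul2r -cardE max_card orbT.
Qed.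

Lemma term_size_enc_decomp_le G (D : decomp G) :
  term_size (enc_decomp D) <= 8 + #|G| * (5 + 4 * #|G|) + (4 + #|dforest D| *
    (5 + (4 + (6 + 4 * #|dforest D|) + (4 + #|G| * (5 + 4 * #|G|))))).
Proof.
rewrite /enc_decomp /=; have := term_size_enc_set_le (dL D).
set e := fun t : dforest D => _.
have: term_size (enc_seq e (enum (dforest D))) <= 4 + #|dforest D| *
    (5 + (4 + (6 + 4 * #|dforest D|) + (4 + #|G| * (5 + 4 * #|G|)))).
  rewrite {1}cardE; apply: term_size_enc_seq_le => t _.
  have := term_size_enc_set_le (bag t); rewrite /e /=.
  move: (#|G| * _) (term_size (enc_set _)) => b a.
  case: parent => [s|] /=; last by lia.
  by have := term_size_enc_elt_le s; move: (term_size _) (4 * _) => x y; lia.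
move: (term_size (enc_seq _ _)) (term_size (enc_set _)) (#|G| * _) => x y b.
by move: (#|dforest D| * _) => z; lia.
Qed.

Lemma card_le_enc_decomp G (D : decomp G) : #|dforest D| <= term_size (enc_decomp D).
Proof.
rewrite /enc_decomp /=; set e := fun t : dforest D => _.
rewrite cardE; apply: leq_trans (size_le_enc_seq e _) _.
by move: (term_size (enc_seq _ _)) (term_size (enc_set _)) => x y; lia.
Qed.

(** * Approximation schemes as computable families *)

Record problem (Q : graph_param) := Problem {
  pgraph : sgraph; pwitness : witness Q pgraph; peps : rat }.
Arguments Problem {Q pgraph}.

Definition admissible Q (p : problem Q) : Prop :=
  valid (pwitness p) /\ (0 < peps p)%R.

Definition approximates Q (p : problem Q) (S : {set pgraph p}) : Prop :=
  dominating S /\ (#|S|%:R <= (1 + peps p) * (opt_DS (pgraph p))%:R)%R.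

Section Schemes.
Variable Q : graph_param.
Hypothesis value_witness : forall G (w : witness Q G), is_value (enc_witness w).

Definition eWitness (G : sgraph) : etype := EType (@value_witness G).

Lemma value_instance G (w : witness Q G) : is_value (instance w).
Proof. exact: (@enc_pair_value eGraph (eWitness G) (G, w)). Qed.

Lemma term_size_instance G (w : witness Q G) :
  term_size (instance w) = 4 + term_size (enc_graph G) + term_size (enc_witness w).
Proof. by rewrite /instance /=; move: (term_size _) (term_size _) => x y; lia. Qed.

Definition problem_env (p : problem Q) : seq term :=
  [:: enc_rat (peps p); instance (pwitness p)].

Fact problem_env_values p : all is_value (problem_env p).
Proof. by rewrite /= enc_rat_value value_instance. Qed.

Definition problems (E : nat -> rat -> nat) : context := {|
  idx := problem Q; dom := @admissible Q;
  bound p := term_size (instance (pwitness p)) + E (measure (pwitness p)) (peps p);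
  arity := 2; env := problem_env; size_env := fun=> erefl;
  env_values := problem_env_values |}.

Section Input.
Variable E : nat -> rat -> nat.
Local Notation c := (problems E).

Lemma computable_peps : computable c (fun=> eRat) (@peps Q).
Proof.
exists (Var 0), (fun=> 0); split=> //; first exact: polybounded_const.
by move=> p _; apply: reduces_refl.
Qed.

Lemma computable_instance : computable c (fun p => ePair eGraph (eWitness (pgraph p)))
  (fun p => (pgraph p, pwitness p)).
Proof.
exists (Var 1), (fun=> 0); split=> //; first exact: polybounded_const.
by move=> p _; apply: reduces_refl.
Qed.

Lemma computable_pgraph : computable c (fun=> eGraph) (@pgraph Q).
Proof. exact: computable_fst computable_instance. Qed.

Lemma computable_pwitness : computable c (fun p => eWitness (pgraph p)) (@pwitness Q).
Proof. exact: computable_snd computable_instance. Qed.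

Lemma polybounded_parameter :
  @polybounded c (fun p => E (measure (pwitness p)) (peps p)).
Proof. by apply: polybounded_le (polybounded_bound c) => p _; apply: leq_addl. Qed.

Lemma polybounded_witness : @polybounded c (fun p => term_size (enc_witness (pwitness p))).
Proof.
apply: polybounded_le (polybounded_bound c) => p _.
change (bound p) with
  (term_size (instance (pwitness p)) + E (measure (pwitness p)) (peps p)).
rewrite term_size_instance.
by move: (term_size _) (term_size _) => x y; lia.
Qed.

Lemma polybounded_pgraph : @polybounded c (fun p => #|pgraph p|).
Proof.
apply: polybounded_le (polybounded_bound c) => p _.
change (@bound (problems E) p) with
  (term_size (instance (pwitness p)) + E (measure (pwitness p)) (peps p)).
rewrite term_size_instance; have := card_le_enc_graph (pgraph p).
by move: (term_size _) (term_size _) => x y; lia.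
Qed.

Lemma listable_pgraph : listable c (fun p => pgraph p).
Proof.
apply: (@listable_size c (@pgraph Q) (fun=> eSeq eBool) (fun p : problem Q =>
  [seq [seq adj u v | v <- enum (pgraph p)] | u <- enum (pgraph p)])).
- by move=> p _; rewrite size_map cardE.
- exact: polybounded_pgraph.
- exact: computable_recode computable_pgraph.
Qed.

End Input.

Lemma scheme_of_computable E (S : forall p : problem Q, {set pgraph p}) :
  computable (problems E) (fun p => eSet (pgraph p)) S ->
  (forall p, admissible p -> approximates (S p)) -> DS_FPT_AS Q.
Proof.
case=> t [T [st [e le_T] rt]] apx.
(* With [N >= 1] the size of the instance and [F] the value of [E], the inequality
   [N + F + 2 <= N * (F + 3)] separates the parameter from the input size. The summand [2] pays for
   the two beta-steps that bind the arguments. *)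
exists (Lam (Lam t)), (fun m eps => 2 + (E m eps + 3) ^ e), e; split.
  by move=> k u; apply: (subst_scoped (n := 0)).
move=> G w eps vw eps0; pose p := Problem w eps; have adm : admissible p by [].
have [domS optS] := apx p adm; exists (S p).
have : reduces (App (App (Lam (Lam t)) (instance w)) (enc_rat eps)) (2 + T p) (enc_set (S p)).
  apply: reduces_step (reduces_fun _ (reduces_beta _ (value_instance w))) _.
  rewrite substE; apply: reduces_step (reduces_beta _ (enc_rat_value eps)) _.
  have := rt p adm; rewrite /= /problem_env -subst_msubst /= ?value_instance //.
  by rewrite -subst_msubst // msubst_nil.
move/(reduces_eval (enc_set_value (S p))) => [k le_k ev]; exists k; split=> //.
apply: leq_trans le_k _; have := le_T p adm.
change (@bound (problems E) p) with (term_size (instance w) + E (measure w) eps).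
have : 0 < term_size (instance w) by [].
move: (term_size _) (E _ _) => N F N0 le_Tp.
apply: (@leq_trans (2 + (N * (F + 3)) ^ e)).
  rewrite leq_add2l; apply: leq_trans le_Tp _.
  by case: (e) => // e'; rewrite leq_exp2r //; nia.
by rewrite expnMn mulnDl [N ^ e * _]mulnC leq_add2r leq_pmulr // expn_gt0 N0.
Qed.

(** Choice turns the outputs of the given program into a function [A], about which mathematical
    statements can be made. Calling it is then one more rule for computable families, provided that
    the calling context absorbs the factor [f] and the sizes of the graph and its witness. *)
Lemma oracle_of_scheme : DS_FPT_AS Q ->
  exists (f : nat -> rat -> nat) (A : forall p : problem Q, {set pgraph p}),
    (forall p, admissible p -> approximates (A p)) /\
    forall (c : context) (p : c -> problem Q),
      (forall i : c, dom i -> admissible (p i)) ->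
      polybounded (fun i => f (measure (pwitness (p i))) (peps (p i))) ->
      polybounded (fun i => #|pgraph (p i)|) ->
      polybounded (fun i => term_size (enc_witness (pwitness (p i)))) ->
      computable c (fun=> eGraph) (fun i => pgraph (p i)) ->
      computable c (fun i => eWitness (pgraph (p i))) (fun i => pwitness (p i)) ->
      computable c (fun=> eRat) (fun i => peps (p i)) ->
      computable c (fun i => eSet (pgraph (p i))) (fun i => A (p i)).
Proof.
case=> P [f [e [cP runP]]].
have ex_out (p : problem Q) : exists S : {set pgraph p}, admissible p ->
    approximates S /\ exists2 k, k <= f (measure (pwitness p)) (peps p) *
      term_size (instance (pwitness p)) ^ e &
      eval (App (App P (instance (pwitness p))) (enc_rat (peps p))) k (enc_set S).
  have [[vp eps0]|nadm] := classic (admissible p); last by exists set0.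
  have [S [k [ev le_k domS optS]]] := runP _ _ _ vp eps0.
  by exists S => _; split=> //; exists k.
pose A p := proj1_sig (constructive_indefinite_description _ (ex_out p)).
have AP p : admissible p -> _ := proj2_sig (constructive_indefinite_description _ (ex_out p)).
exists f, A; split=> [p /AP[]//|c p adm bf bG bw cG cw ce].
pose T i := f (measure (pwitness (p i))) (peps (p i)) *
   term_size (instance (pwitness (p i))) ^ e.
apply: (@computable_app2 _ P (fun i => ePair eGraph (eWitness (pgraph (p i)))) (fun=> eRat)
  _ (fun i => (pgraph (p i), pwitness (p i))) _ _ T) => //.
- exact: closed_term_scoped.
- apply: polyboundedM => //; apply: polyboundedX.
  apply: (@polybounded_le _ (fun i => 4 + (4 + #|pgraph (p i)| * (9 + #|pgraph (p i)| * 9)) +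
    term_size (enc_witness (pwitness (p i))))); last by polybound.
  move=> i _; rewrite term_size_instance leq_add2r leq_add2l.
  exact: term_size_enc_graph_le.
- move=> i /adm /AP[_ [k le_k ev]]; apply: reduces_le le_k _.
  exact: (eval_reduces (enc_set_value _) ev).
- by apply: (@computable_pair _ (fun=> eGraph) (fun i => eWitness (pgraph (p i)))).
- by [].
Qed.

End Schemes.

(** Heredity applies to the part of [induced A] hit by [g], and [g] identifies [G'] with that part
    up to isomorphism. *)
Lemma well_behaved_embedding (H : sgraph -> Prop) (G G' : sgraph) (A : {set G}) (g : G' -> G) :
  well_behaved H -> H (induced A) -> injective g -> (forall x, g x \in A) ->
  (forall x y, adj (g x) (g y) = adj x y) -> H G'.
Proof.
case=> [iso her _] HA inj_g gA adj_g.
pose B : {set induced A} := [set y | val y \in codom g].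
have gB x : (Sub (g x) (gA x) : induced A) \in B by rewrite inE; apply: codom_f.
pose f x : induced B := Sub (Sub (g x) (gA x)) (gB x).
have inj_f : injective f by move=> x y /(congr1 (val \o val)); apply: inj_g.
have bij_f : bijective f.
  apply: (inj_card_bij inj_f); rewrite card_sig.
  rewrite -(card_codom inj_g) -[X in X <= _](card_imset _ val_inj) subset_leq_card //.
  by apply/subsetP=> _ /imsetP[y By ->]; rewrite !inE in By.
have [f' fK f'K] := bij_f; apply: (iso (induced B)); last exact: her.
exists f'; first by exists f.
by move=> x y; rewrite -{2}[x]f'K -{2}[y]f'K -adj_g.
Qed.

(** * Encoded decompositions *)

Definition decomp_nodes G (D : decomp G) : seq (option (dforest D) * {set G}) :=
  [seq (parent t, bag t) | t <- enum (dforest D)].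

Lemma enc_decompE G (D : decomp G) : enc_decomp D =
  @encode (ePair (eSeq (ePair (eOption (eElt (dforest D))) (eSet G))) (eSet G))
          (decomp_nodes D, dL D).
Proof. by rewrite /enc_decomp /= /decomp_nodes enc_seq_map. Qed.

Fact enc_decomp_value G (D : decomp G) : is_value (enc_decomp D).
Proof. by rewrite enc_decompE; apply: encodeP. Qed.
Definition eDecomp G : etype := EType (@enc_decomp_value G).

Section Decomp.
Variables (c : context) (G : c -> sgraph) (D : forall i, decomp (G i)).
Local Notation T i := (dforest (D i)).

Lemma computable_decomp :
  computable c (fun i => eSeq (ePair (eOption (eElt (T i))) (eSet (G i))))
    (fun i => decomp_nodes (D i)) ->
  computable c (fun i => eSet (G i)) (fun i => dL (D i)) ->
  computable c (fun i => eDecomp (G i)) D.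
Proof.
move=> cn cL; apply: computable_recode (computable_pair cn cL) => i _.
exact: enc_decompE.
Qed.

Hypothesis cD : computable c (fun i => eDecomp (G i)) D.
Hypothesis bT : polybounded (fun i => #|T i|).

Lemma computable_decomp_data :
  computable c (fun i => ePair (eSeq (ePair (eOption (eElt (T i))) (eSet (G i)))) (eSet (G i)))
    (fun i => (decomp_nodes (D i), dL (D i))).
Proof. by apply: computable_recode cD => i _; rewrite [RHS]enc_decompE. Qed.

Lemma computable_nodes :
  computable c (fun i => eSeq (ePair (eOption (eElt (T i))) (eSet (G i))))
    (fun i => decomp_nodes (D i)).
Proof. exact: computable_fst computable_decomp_data. Qed.

Lemma computable_dL : computable c (fun i => eSet (G i)) (fun i => dL (D i)).
Proof. exact: computable_snd computable_decomp_data. Qed.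

Lemma listable_dforest : listable c (fun i => T i).
Proof.
apply: listable_size computable_nodes => //.
by move=> i _; rewrite size_map cardE.
Qed.

Section Node.
Variable t : forall i, T i.
Hypothesis ct : computable c (fun i => eElt (T i)) t.

Lemma computable_node :
  computable c (fun i => ePair (eOption (eElt (T i))) (eSet (G i)))
    (fun i => (parent (t i), bag (t i))).
Proof.
apply: (@computable_lookup _ (fun i => T i)
  (fun i => ePair (eOption (eElt (T i))) (eSet (G i))) (fun i t => (parent t, bag t))) => //.
exact: computable_nodes.
Qed.

Lemma computable_parent :
  computable c (fun i => eOption (eElt (T i))) (fun i => parent (t i)).
Proof. exact: computable_fst computable_node. Qed.

Lemma computable_bag : computable c (fun i => eSet (G i)) (fun i => bag (t i)).
Proof. exact: computable_snd computable_node. Qed.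

End Node.
End Decomp.

Definition ed_value (H : sgraph -> Prop) : forall G (w : witness (ed_param H) G),
  is_value (enc_witness w) := enc_decomp_value.
Definition tw_value (H : sgraph -> Prop) : forall G (w : witness (tw_param H) G),
  is_value (enc_witness w) := enc_decomp_value.
Definition mod_value (H : sgraph -> Prop) : forall G (w : witness (mod_param H) G),
  is_value (enc_witness w) := fun G w => enc_set_value w.

(** * From modulators to elimination decompositions *)

Section Path.
Variables (G : sgraph) (S : {set G}).
Let p := #|S|.

Definition path_parent (i : 'I_p.+1) : option 'I_p.+1 :=
  if (i : nat) is j.+1 then Some (inord j) else None.

Lemma path_parentP (i j : 'I_p.+1) : path_parent i = Some j <-> i = j.+1 :> nat.
Proof.
rewrite /path_parent; case: i => -[|k] //= lt_k; split=> //.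
  by case=> <-; rewrite inordK // ltnW.
by case=> ->; rewrite inord_val.
Qed.

Fact path_parent_wf : well_founded (fun s t => path_parent t = Some s).
Proof.
suff wf n (t : 'I_p.+1) : t < n -> Acc (fun s t => path_parent t = Some s) t.
  by move=> t; apply: (wf t.+1).
elim: n t => [t|n IH t lt_t]; first by rewrite ltn0.
constructor=> s /path_parentP def_t.
by apply: IH; rewrite -ltnS -def_t.
Qed.

Definition path_forest : rforest := RForest path_parent_wf.

(* Vertices outside [S] have index [#|S|], so they all lie in the last bag. *)
Definition path_bag (i : path_forest) : {set G} := [set x | index x (enum S) == i].

Definition path_decomp : decomp G := Decomp path_bag (~: S).

Lemma path_ancestor (s t : path_forest) : s <= t -> ancestor s t.
Proof.
rewrite /ancestor; move def_n: (t : nat) => n; elim: n t def_n => [|n IH] t def_t.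
  by rewrite leqn0 -def_t => /eqP/ord_inj->; apply: connect0.
rewrite leq_eqVlt => /predU1P[def_s|lt_sn].
  by rewrite (_ : s = t) ?connect0 //; apply: ord_inj; rewrite def_t.
have lt_n : n < p.+1 by rewrite -def_t ltnW.
apply: (connect_trans (IH (Ordinal lt_n) erefl lt_sn)); apply: connect1.
by apply/eqP/path_parentP.
Qed.

Lemma path_leaf (t : path_forest) : leaf t = (t == ord_max).
Proof.
apply/forallP/eqP => [nt|-> s].
  apply: ord_inj => /=; apply/eqP; rewrite eqn_leq -ltnS ltn_ord /= leqNgt.
  apply/negP=> lt_t; have := nt (Ordinal (lt_t : t.+1 < p.+1)).
  by case/negP; apply/eqP/path_parentP.
by apply/eqP=> /path_parentP /= def_s; have := ltn_ord s; rewrite def_s ltnn.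
Qed.

Lemma path_depth : depth path_forest <= p.
Proof.
apply/bigmax_leqP => t _; rewrite -ltnS -[p.+1]card_ord; apply: proper_card.
by apply/properP; split; [apply/subsetP | exists t; rewrite ?inE ?eqxx ?andbF].
Qed.

(** On a path any two nodes are comparable, so edges impose nothing, and the single leaf takes all
    of [L]. *)
Lemma path_decompP (H : sgraph -> Prop) : modulator H S -> elim_decomp H path_decomp.
Proof.
move=> HS; have sizeE : size (enum S) = p by rewrite -cardE.
have idx_lt x : index x (enum S) < p.+1 by rewrite ltnS -sizeE index_size.
have bag_max : path_bag ord_max = ~: S.
  apply/setP=> x; rewrite !inE -mem_enum -index_mem sizeE -leqNgt eqn_leq.
  by rewrite -ltnS idx_lt.
have bag_lt (t : path_forest) : ~~ leaf t -> t < p.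
  by rewrite path_leaf -val_eqE /= ltn_neqAle -ltnS ltn_ord andbT.
have part v : exists! t : path_forest, v \in path_bag t.
  exists (Ordinal (idx_lt v)); split=> [|t]; rewrite inE ?eqxx //.
  by move/eqP=> def_t; apply: ord_inj.
split=> /=.
- move=> t /bag_lt lt_t; apply/card_le1_eqP => x y; rewrite !inE => /eqP ix /eqP iy.
  have Sx : x \in enum S by rewrite -index_mem ix sizeE.
  have Sy : y \in enum S by rewrite -index_mem iy sizeE.
  by rewrite -(nth_index x Sx) -(nth_index x Sy) ix iy.
- move=> t /bag_lt lt_t; apply/setP=> x; rewrite !inE -mem_enum -index_mem.
  by case: eqP => //= ->; rewrite sizeE lt_t.
- exact: part.
- by move=> t; rewrite path_leaf => /eqP->; rewrite bag_max.
- by move=> t; rewrite path_leaf => /eqP->; rewrite bag_max.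
- move=> v; rewrite -bag_max => Lv; exists ord_max; split.
    by rewrite path_leaf eqxx.
  by move=> t []; rewrite path_leaf => /eqP.
- move=> u v s t _ _ _; case: (leqP s t) => [/path_ancestor-> //|/ltnW/path_ancestor->].
  by rewrite orbT.
Qed.

End Path.

Lemma computable_index (c : context) (T : c -> finType) (x : forall i, T i)
    (A : forall i, {set T i}) :
  polybounded (fun i => #|T i|) ->
  computable c (fun i => eElt (T i)) x -> computable c (fun i => eSet (T i)) A ->
  computable c (fun=> eNat) (fun i => index (x i) (enum (A i))).
Proof.
move=> bT cx cA; apply: (@computable_ext _ (fun=> eNat)
  (fun i => foldr (fun y n => if y == x i then 0 else n.+1) 0 (enum (A i)))).
  by move=> i _; elim: (enum _) => //= y s ->.
apply: (@computable_foldr _ (fun i => eElt (T i)) (fun=> eNat) (fun _ _ => True)) => //.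
- exact: polybounded_enum.
- exact: computable_nat.
apply: computable_if; first by apply: computable_eqelt; known.
  exact: computable_nat.
by apply: computable_succ; known.
Qed.

(** [f] need not be monotone, and of the new structure only an upper bound [w i] on its measure is
    known; the sum dominates whichever value occurs. *)
Lemma polybounded_sum_parameter (c : context) (f : nat -> rat -> nat) (d w : c -> nat) eps :
  (forall i, dom i -> d i <= w i) ->
  polybounded (fun i => \sum_(m < (w i).+1) f m (eps i)) ->
  polybounded (fun i => f (d i) (eps i)).
Proof.
move=> le_dw; apply: polybounded_le => i /le_dw; rewrite -ltnS => lt_d.
by rewrite (bigD1 (Ordinal lt_d)) //= leq_addr.
Qed.

Theorem mod_of_ed H : DS_FPT_AS (ed_param H) -> DS_FPT_AS (mod_param H).
Proof.
case/(oracle_of_scheme (@ed_value H)) => f [A [apxA compA]].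
pose E w eps := \sum_(d < w.+1) f d eps.
pose D (p : problem (mod_param H)) : problem (ed_param H) :=
  @Problem (ed_param H) _ (path_decomp (pwitness p)) (peps p).
have admD p : admissible p -> admissible (D p).
  by case=> vp eps0; split=> //; apply: path_decompP.
pose c := problems (@mod_value H) E.
have bG : @polybounded c (fun p => #|pgraph p|) by apply: polybounded_pgraph.
have lG : listable c (fun p => pgraph p) by apply: listable_pgraph.
have cS : computable c (fun p => eSet (pgraph p)) (fun p => pwitness p).
  exact: computable_pwitness.
have cp : computable c (fun=> eNat) (fun p => #|pwitness p|.+1).
  by apply: computable_succ; apply: computable_card.
pose T (p : c) : finType := 'I_#|pwitness p|.+1.
have bT : @polybounded c (fun p => #|T p|).
  apply: (@polybounded_le c (fun p => #|pgraph p|.+1)); last exact: polyboundedS.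
  by move=> p _; rewrite card_ord ltnS max_card.
have lT : listable c T.
  apply: listable_card => //; apply: computable_ext cp => p _.
  by rewrite card_ord.
apply: (@scheme_of_computable _ (@mod_value H) E (fun p => A (D p))); last first.
  by move=> p /admD /apxA.
apply: (compA c D).
- exact: admD.
- apply: (@polybounded_sum_parameter c f _ (fun p => #|pwitness p|)).
    by move=> p _; apply: path_depth.
  exact: (polybounded_parameter (@mod_value H) E).
- exact: bG.
- apply: (@polybounded_le c _ _ (fun (p : c) _ => term_size_enc_decomp_le (path_decomp (pwitness p)))).
  by polybound.
- exact: computable_pgraph.
- apply: computable_decomp; last by apply: computable_setC.
  apply: (@computable_map _ (fun p => eElt (T p))
    (fun p => ePair (eOption (eElt (T p))) (eSet (pgraph p)))); last first.
    apply: computable_pair.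
      set ck := ext _ _ _.
      pose j (k : ck) : nat := enum_rank (projT2 k : T (projT1 k)).
      have cj : computable ck (fun=> eNat) j.
        exact: (@computable_rank ck (fun k => T (projT1 k)) _ (@computable_var _ _ _)).
      (* The rank of an ordinal is its value, so on codes the parent map is the predecessor, with
         [None] at [0]. *)
      have cn : computable ck (fun=> eOption eNat)
          (fun k => if j k is m.+1 then Some m else None).
        apply: computable_natcase => //; first exact: (@computable_const _ (eOption eNat)).
        by apply: (@computable_Some _ (fun=> eNat)); known.
      apply: computable_recode cn => k _ /=; rewrite /path_parent /j enum_rank_ord /=.
      case: k => p [[|m] lt_m] //=.
      by rewrite /enc_elt enum_rank_ord /= inordK // ltnW.
    apply: computable_set; first by known.
    set ck := ext _ _ _.
    apply: (@computable_ext _ (fun=> eBool) (fun k : ck => index (projT2 k)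
        (enum (pwitness (projT1 (projT1 k)))) ==
        enum_rank (projT2 (projT1 k) : T (projT1 (projT1 k))))).
      by move=> k _; rewrite enum_rank_ord.
    have bG' : @polybounded ck (fun k => #|pgraph (projT1 (projT1 k))|) by known.
    have bT' : @polybounded ck (fun k => #|T (projT1 (projT1 k))|) by known.
    apply: computable_eqn.
    - apply: polybounded_le bG' => k _; apply: leq_trans (index_size _ _) _.
      by rewrite -cardE max_card.
    - exact: (@polybounded_enum_rank ck (fun k => T (projT1 (projT1 k))) _ bT').
    - by apply: computable_index => //; known.
    - by apply: (@computable_rank ck (fun k => T (projT1 (projT1 k)))); known.
    by case: lT.
  by apply: polybounded_le bT => p _; rewrite -cardE.
- exact: computable_peps.
Qed.

(** * Forests *)

Section ForestTheory.
Variable T : rforest.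
Implicit Types s t : T.

Lemma ancestor_refl t : ancestor t t. Proof. exact: connect0. Qed.

Lemma ancestor_trans : transitive (@ancestor T).
Proof. by move=> t s u; apply: connect_trans. Qed.

Lemma parent_ancestor s t : parent t = Some s -> ancestor s t.
Proof. by move=> pt; apply: connect1; apply/eqP. Qed.

Lemma ancestor_parent s t r : ancestor s t -> s != t -> parent t = Some r -> ancestor s r.
Proof.
case/connectP=> p; case/lastP: p => [|p x]; first by move=> _ -> /eqP.
rewrite rcons_path last_rcons => /andP[sp /eqP px] -> _; rewrite px => -[<-].
by apply/connectP; exists p.
Qed.

(** A cycle through [t] is also a cycle through its parent, so well-founded induction along parents
    excludes it. *)
Lemma parent_acyclic s t : parent t = Some s -> ~~ ancestor t s.
Proof.
elim/(well_founded_ind (@parent_wf T)): t s => t IH s pt.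
apply/negP=> anc_ts; have [eq_ts|neq_ts] := eqVneq t s.
  by rewrite -eq_ts in pt; have := IH t pt t pt; rewrite ancestor_refl.
case pS: (parent s) => [r|].
  have /negP := IH s pt r pS; apply; apply: ancestor_trans (parent_ancestor pt) _.
  exact: ancestor_parent pS.
case/connectP: anc_ts neq_ts => p; case/lastP: p => [|p x]; first by move=> _ ->; rewrite eqxx.
by rewrite rcons_path last_rcons => /andP[_ /eqP] + def_s; rewrite -def_s pS.
Qed.

Lemma leaf_ancestor s t : leaf s -> ancestor s t -> t = s.
Proof.
move/forallP=> ls /connectP[[_ -> //|x p] /= /andP[sx _] _].
by have := ls x; rewrite sx.
Qed.

Lemma root_ancestor t : exists2 r, is_root r & ancestor r t.
Proof.
elim/(well_founded_ind (@parent_wf T)): t => t IH.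
case pt: (parent t) => [s|]; last by exists t; rewrite ?ancestor_refl // /is_root pt.
have [r rr rs] := IH s pt; exists r => //.
exact: ancestor_trans rs (parent_ancestor pt).
Qed.

(** Take a descendant with the most ancestors: a child of it would have more. *)
Lemma leaf_descendant t : exists2 s, leaf s & ancestor t s.
Proof.
case: (@arg_maxnP _ t (ancestor t) (fun s => #|[set r | ancestor r s]|)).
  exact: ancestor_refl.
move=> s anc_ts max_s; exists s => //; apply/forallP=> x; apply/negP=> /eqP px.
have anc_sx := parent_ancestor px.
have le_xs : #|[set r | ancestor r x]| <= #|[set r | ancestor r s]|.
  exact: max_s (ancestor_trans anc_ts anc_sx).
move: le_xs; rewrite leqNgt => /negP; apply.
apply: proper_card; apply/properP; split.
  by apply/subsetP=> r; rewrite !inE => /ancestor_trans; apply.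
by exists x; rewrite !inE ?ancestor_refl // parent_acyclic.
Qed.

Definition walk (j : nat) t : option T := iter j (obind (@parent T)) (Some t).

(** Turns ancestry into a bounded search that a program can run: a path without repetition has fewer
    than [#|T|] edges. *)
Lemma walk_ancestor s t : ancestor s t = has (fun j => walk j t == Some s) (iota 0 #|T|).
Proof.
apply/idP/hasP => [/connectP[p0 sp0 ->]|[j _]].
  case/shortenP: sp0 => p sp up _.
  exists (size p).
    by rewrite mem_iota add0n; have := max_card (mem (s :: p)); rewrite (card_uniqP up).
  elim/last_ind: p sp {up} => [|p x IH] //=.
  rewrite rcons_path last_rcons size_rcons /walk iterSr /= => /andP[/IH pE /eqP->].
  exact: pE.
elim: j t => [|j IH] t; first by case/eqP=> ->; apply: ancestor_refl.
rewrite /walk iterSr /=; case pt: (parent t) => [r|]; last first.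
  by have -> : iter j (obind (@parent T)) None = None by elim: (j) => //= k ->.
by move/IH=> anc_sr; apply: ancestor_trans anc_sr (parent_ancestor pt).
Qed.

End ForestTheory.

Lemma enum_option (T : finType) : enum {: option T} = None :: [seq Some x | x <- enum T].
Proof. by rewrite !enumT [in LHS]unlock. Qed.

Lemma enum_rank_index (T : finType) (x : T) : enum_rank x = index x (enum T) :> nat.
Proof.
rewrite -{2}[x]enum_rankK (enum_val_nth x) index_uniq ?enum_uniq //.
by rewrite -cardE ltn_ord.
Qed.

(** Codes depend on the order of enumeration: [None] comes first, so every old rank shifts by
    one. *)
Lemma enum_rank_option (T : finType) (o : option T) :
  enum_rank o = (if o is Some x then (enum_rank x : nat).+1 else 0) :> nat.
Proof.
rewrite enum_rank_index enum_option; case: o => //= x.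
by rewrite index_map // => [|y z []//]; rewrite enum_rank_index.
Qed.

Lemma card_bigcup_le (I T : finType) (B : {set I}) (F : I -> {set T}) :
  #|\bigcup_(i in B) F i| <= \sum_(i in B) #|F i|.
Proof.
apply: (big_ind2 (fun (A : {set T}) n => #|A| <= n)) => //; first by rewrite cards0.
move=> A1 n1 A2 n2 le1 le2; apply: leq_trans (leq_add le1 le2).
by rewrite cardsU leq_subr.
Qed.

(** * From elimination decompositions to tree decompositions *)

Section AncestorBags.
Variables (H : sgraph -> Prop) (G : sgraph) (D : decomp G).
Local Notation T := (dforest D).

(** [None] becomes a parent of all former roots, which joins the forest into one tree; the bag of
    this new root is empty. *)
Definition option_parent (x : option T) : option (option T) := omap (@parent T) x.

Fact option_parent_wf : well_founded (fun s t => option_parent t = Some s).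
Proof.
have accN : Acc (fun s t => option_parent t = Some s) None by split.
case=> [t|]; last exact: accN.
elim/(well_founded_ind (@parent_wf T)): t => t IH.
by constructor=> -[s [pt]|_]; [apply: IH | apply: accN].
Qed.

Definition option_forest : rforest := RForest option_parent_wf.

Definition ancestor_bag (x : option_forest) : {set G} :=
  if x is Some t then [set v | [exists s, ancestor s t && (v \in bag s)]] else set0.

Definition ancestor_decomp : decomp G := Decomp ancestor_bag (dL D).

Hypothesis HD : elim_decomp H D.

Lemma ancestor_bagP t v :
  reflect (exists2 s, ancestor s t & v \in bag s) (v \in ancestor_bag (Some t)).
Proof. by rewrite inE; apply: exists_inP. Qed.

Lemma bag_unique v (s t : T) : v \in bag s -> v \in bag t -> s = t.
Proof. by have [r [_ ur]] := ed_partition HD v => /ur <- /ur <-. Qed.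

Lemma option_leaf (t : T) : leaf (Some t : option_forest) = leaf t.
Proof.
apply/forallP/forallP => lt s; first exact: (lt (Some s)).
by case: s => [s|] //; apply: lt.
Qed.

(** Proper ancestors of a leaf are internal, and internal bags avoid [L]; what a leaf inherits
    therefore stays outside [L]. *)
Lemma leaf_ancestor_bag (t : T) v :
  leaf t -> (v \in ancestor_bag (Some t)) && (v \in dL D) = (v \in bag t).
Proof.
move=> lt; apply/andP/idP => [[/ancestor_bagP[s anc_st vs] Lv]|vt].
  have [ls|ns] := boolP (leaf s); first by rewrite (leaf_ancestor ls anc_st).
  by have /setP/(_ v) := ed_internal_L HD ns; rewrite !inE vs Lv.
split; last exact: (subsetP (ed_leaf_L HD lt)).
by apply/ancestor_bagP; exists t; first exact: ancestor_refl.
Qed.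

(** Outside [L] the new bag of [t] has at most one vertex per internal ancestor of [t], and all of
    these are proper ancestors of any leaf below [t]. *)
Lemma ancestor_width : width ancestor_decomp <= depth (dforest D).
Proof.
apply/bigmax_leqP=> -[t|] _ /=; last by rewrite set0D cards0.
apply: leq_trans (leq_subr _ _) _; have [t' lt' anc_tt'] := leaf_descendant t.
apply: leq_trans (@leq_bigmax_cond _ _ _ t' lt').
pose B := [set s | ancestor s t && ~~ leaf s].
apply: (@leq_trans #|B|); last first.
  apply: subset_leq_card; apply/subsetP=> s; rewrite !inE => /andP[anc_st ns].
  by rewrite (ancestor_trans anc_st anc_tt'); apply: contraNneq ns => ->.
apply: (@leq_trans (\sum_(s in B) 1)); last by rewrite sum1_card.
apply: leq_trans (leq_trans (card_bigcup_le B (@bag G D)) _); last first.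
  by apply: leq_sum => s; rewrite inE => /andP[_ /(ed_internal_card HD)].
apply: subset_leq_card; apply/subsetP=> v; rewrite inE => /andP[nLv].
case/ancestor_bagP=> s anc_st vs; apply/bigcupP; exists s => //.
rewrite inE anc_st /=; apply: contra nLv => ls.
exact: (subsetP (ed_leaf_L HD ls)).
Qed.

Lemma ancestor_connect v (s t : T) :
  ancestor s t -> v \in bag s ->
  connect [rel x y : option_forest | [&& tree_adj x y, v \in ancestor_bag x
    & v \in ancestor_bag y]] (Some s) (Some t).
Proof.
case/connectP=> p + -> vs; elim/last_ind: p => [|p x IH] /=; first by rewrite connect0.
rewrite rcons_path last_rcons => /andP[sp px]; apply: connect_trans (IH sp) _.
apply: connect1; rewrite /= {1}/tree_adj {1}/is_parent /= -[_ == Some (Some _)]/(_ == _).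
have anc_sp : ancestor s (last s p) by apply/connectP; exists p.
apply/and3P; split.
- by apply/orP; left; rewrite (eqP px).
- by apply/ancestor_bagP; exists s.
- by apply/ancestor_bagP; exists s => //; apply: ancestor_trans anc_sp (connect1 px).
Qed.

(** A vertex with original bag at [s] now occupies exactly the nodes below [s], and the ends of an
    edge meet at the lower of their two nodes. The vertex [v0] rules out the empty forest, where the
    added root would be a leaf and would require the empty graph to be in [H]. *)
Lemma ancestor_decompP (v0 : G) : tree_decomp H ancestor_decomp.
Proof.
split=> /=.
- exists None; split=> // -[t|] //.
- move=> v; have [t [vt _]] := ed_partition HD v; exists (Some t).
  by apply/ancestor_bagP; exists t; first exact: ancestor_refl.
- move=> v [s|] [t|] /=; rewrite ?in_set0 //.
  case/ancestor_bagP=> s' anc_s vs /ancestor_bagP[t' anc_t vt].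
  have eq_st := bag_unique vs vt; rewrite -{t'}eq_st in vt anc_t *.
  apply: connect_trans (ancestor_connect anc_t vs).
  rewrite (sym_connect_sym _); first exact: ancestor_connect.
  by move=> x y /=; rewrite /tree_adj orbC [(v \in ancestor_bag x) && _]andbC.
- move=> u v uv; have [s [us _]] := ed_partition HD u.
  have [t [vt _]] := ed_partition HD v.
  case/orP: (ed_edge HD uv us vt) => anc; [exists (Some t) | exists (Some s)];
    apply/andP; split; apply/ancestor_bagP;
    by [exists s | exists t | exists s; first exact: ancestor_refl
       | exists t; first exact: ancestor_refl].
- move=> v Lv; have [t [[lt vt] _]] := ed_leaf_partition HD Lv.
  exists (Some t); split; first by rewrite option_leaf.
  case=> [s|]; last by rewrite inE.
  rewrite (inj_eq (@Some_inj _)); apply/ancestor_bagP/eqP => [[t' anc_t vt']|->].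
    by rewrite (bag_unique vt' vt) in anc_t; apply: leaf_ancestor anc_t.
  by exists t; first exact: ancestor_refl.
- case=> [t|].
    rewrite option_leaf => lt; rewrite (_ : _ :&: _ = bag t); first exact: ed_leaf_H.
    by apply/setP=> v; rewrite inE leaf_ancestor_bag.
  have [t _] := ed_partition HD v0; have [r /eqP rr _] := root_ancestor t.
  by move/forallP/(_ (Some r)); rewrite /is_parent /= rr.
Qed.

End AncestorBags.

(** * Computing ancestor bags *)

Lemma computable_None (c : context) (X : c -> etype) :
  computable c (fun i => eOption (X i)) (fun i => None).
Proof. by apply: computable_recode (@computable_const c (eOption eNat) None). Qed.

Lemma computable_cardT (c : context) (T : c -> finType) :
  listable c T -> computable c (fun=> eNat) (fun i => #|T i|).
Proof.
case=> bT cT; apply: (@computable_ext _ (fun=> eNat) (fun i => size (enum (T i)))).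
  by move=> i _; rewrite cardE.
by apply: computable_size cT; apply: polybounded_le bT => i _; rewrite -cardE.
Qed.

Lemma polybounded_enumT (c : context) (T : c -> finType) :
  polybounded (fun i => #|T i|) -> polybounded (fun i => size (enum (T i))).
Proof. by apply: polybounded_le => i _; rewrite -cardE. Qed.

Section AncestorBagComputable.
Variables (c : context) (G : c -> sgraph) (D : forall i, decomp (G i)).
Local Notation T i := (dforest (D i)).
Hypothesis bT : polybounded (fun i => #|T i|).
Hypothesis cD : computable c (fun i => eDecomp (G i)) D.

Lemma computable_walk (j : c -> nat) (t : forall i, T i) : polybounded j ->
  computable c (fun=> eNat) j -> computable c (fun i => eElt (T i)) t ->
  computable c (fun i => eOption (eElt (T i))) (fun i => walk (j i) (t i)).
Proof.
move=> bj cj ct.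
apply: (@computable_iter _ (fun i => eOption (eElt (T i))) (fun _ _ => True)) => //.
  exact: (@computable_Some _ (fun i => eElt (T i))).
set c1 := ext _ _ _.
apply: (@computable_optioncase c1 (fun k => eElt (T (projT1 k))) (fun k => eOption (eElt (T (projT1 k))))
  (fun k => projT2 k) (fun k => None) (fun k s => parent s)).
- by known.
- exact: computable_None.
set ck := ext _ _ _.
apply: (@computable_parent ck (fun k => G (projT1 (projT1 k))) (fun k => D (projT1 (projT1 k)))).
- by known.
- by known.
- by known.
Qed.

End AncestorBagComputable.

Lemma computable_ancestor_bag (c : context) (G : c -> sgraph) (D : forall i, decomp (G i))
    (t : forall i, dforest (D i)) :
  listable c (fun i => G i) -> polybounded (fun i => #|dforest (D i)|) ->
  computable c (fun i => eDecomp (G i)) D ->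
  computable c (fun i => eElt (dforest (D i))) t ->
  computable c (fun i => eSet (G i)) (fun i => ancestor_bag (Some (t i))).
Proof.
move=> lG bT cD ct; have bG := lG.1; have lT := listable_dforest cD bT.
have cn := computable_cardT lT.
have ci : computable c (fun=> eSeq eNat) (fun i => iota 0 #|dforest (D i)|).
  exact: computable_iota0.
apply: (@computable_ext _ (fun i => eSet (G i)) (fun i => [set v | has (fun j =>
    if walk j (t i) is Some s then v \in bag s else false) (iota 0 #|dforest (D i)|)])).
  move=> i _; apply/setP=> v; rewrite /ancestor_bag !inE.
  apply/exists_inP/hasP => [[s]|[j Ij]].
    rewrite walk_ancestor => /hasP[j Ij /eqP def_s] vs.
    by exists j => //; rewrite def_s.
  case def_s: walk => [s|] // vs; exists s => //.
  by rewrite walk_ancestor; apply/hasP; exists j; rewrite ?def_s.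
apply: computable_set => //; set c1 := ext _ _ _.
apply: (@computable_has _ (fun=> eNat)).
- by apply: (@polybounded_le c1 (fun k => #|dforest (D (projT1 k))|)) => [k _|]; [rewrite size_iota | known].
- by known.
set c2 := ext _ _ _.
apply: (@computable_optioncase c2 (fun k => eElt (dforest (D (projT1 (projT1 k))))) (fun=> eBool)
  (fun k => walk (projT2 k) (t (projT1 (projT1 k)))) (fun=> false)
  (fun k s => projT2 (projT1 k) \in bag s)).
- apply: (@computable_walk c2 (fun k => G (projT1 (projT1 k))) (fun k => D (projT1 (projT1 k)))).
  + by known.
  + by known.
  + apply: (@polybounded_le c2 (fun k => #|dforest (D (projT1 (projT1 k)))|)); last by known.
    move=> [[i v] j] [_ /= In_j].
    have /(_ j In_j): forall j, List.In j (iota 0 #|dforest (D i)|) -> j < 0 + #|dforest (D i)|.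
      elim: (#|_|) 0 => // m IH a j' /= [<-|/IH]; lia.
    by move/ltnW.
  + by known.
  + by known.
- exact: computable_bool.
set c3 := ext _ _ _.
apply: (@computable_mem c3 (fun k => G (projT1 (projT1 (projT1 k))))).
- by known.
- by known.
apply: (@computable_bag c3 (fun k => G (projT1 (projT1 (projT1 k))))
  (fun k => D (projT1 (projT1 (projT1 k))))); by known.
Qed.

Theorem ed_of_tw H : DS_FPT_AS (tw_param H) -> DS_FPT_AS (ed_param H).
Proof.
case/(oracle_of_scheme (@tw_value H)) => f [A [apxA compA]].
pose E w eps := \sum_(d < w.+1) f d eps.
pose D (p : problem (ed_param H)) : problem (tw_param H) :=
  @Problem (tw_param H) _ (ancestor_decomp (pwitness p)) (peps p).
have admD p : 0 < #|pgraph p| -> admissible p -> admissible (D p).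
  case/card_gt0P => v _ [vp eps0]; split=> //.
  exact: ancestor_decompP vp v.
pose c := problems (@ed_value H) E.
pose DD (p : c) : decomp (pgraph p) := pwitness p.
have bG : @polybounded c (fun p => #|pgraph p|) by apply: polybounded_pgraph.
have lG : listable c (fun p => pgraph p) by apply: listable_pgraph.
have cD : computable c (fun p => eDecomp (pgraph p)) DD.
  exact: (@computable_pwitness _ (@ed_value H)).
have bT : @polybounded c (fun p => #|dforest (DD p)|).
  apply: polybounded_le (polybounded_witness (@ed_value H) E) => p _.
  exact: card_le_enc_decomp.
have lT : listable c (fun p => dforest (DD p)) by apply: listable_dforest.
have cG : computable c (fun=> eGraph) (fun p => pgraph p) by apply: computable_pgraph.
have ce : computable c (fun=> eRat) (fun p => peps p) by apply: computable_peps.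
(* The empty graph is answered directly, since its ancestor decomposition may fail to be valid. *)
apply: (@scheme_of_computable _ (@ed_value H) E
  (fun p => if #|pgraph p| == 0 then set0 else A (D p))); last first.
  move=> p adm; case: eqP => [G0|/eqP]; last by rewrite -lt0n => G0; apply: apxA (admD p G0 adm).
  split; first by apply/forallP=> v; have := fintype0 v G0.
  by rewrite cards0 mulr_ge0 // ?ler0n // addr_ge0 // ltW //; case: adm.
rewrite -/c; apply: computable_if.
- by apply: computable_eq0; apply: computable_cardT.
- exact: computable_set0.
set c' := restrict _ _.
have bT' : @polybounded c' (fun p => #|dforest (DD p)|) by known.
have bG' : @polybounded c' (fun p => #|pgraph p|) by known.
apply: (compA c' D).
- by move=> p [/= adm G0]; apply: admD => //; rewrite lt0n.
- apply: (@polybounded_sum_parameter c' f _ (fun p => depth (dforest (DD p)))).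
    by move=> p [[/= vp _] _]; apply: (ancestor_width vp).
  have := polybounded_parameter (@ed_value H) E; exact: polybounded_restrict.
- exact: bG'.
- apply: (@polybounded_le c' _ _ (fun (p : c') _ => term_size_enc_decomp_le (ancestor_decomp (DD p)))).
  have bT'' : @polybounded c' (fun p => #|dforest (ancestor_decomp (DD p))|).
    apply: (@polybounded_le c' (fun p => #|dforest (DD p)|.+1)); last exact: polyboundedS.
    by move=> p _; rewrite card_option.
  by polybound.
- by known.
- apply: (@computable_decomp c' (fun p => pgraph p) (fun p => ancestor_decomp (DD p))); last first.
    by apply: (@computable_dL c' (fun p => pgraph p) DD); known.
  pose X (p : c) := ePair (eOption (eElt (option (dforest (DD p))))) (eSet (pgraph p)).
  apply: (@computable_ext c' (fun p => eSeq (X p)) (fun p => (None, set0) ::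
     [seq (Some (parent t), ancestor_bag (Some t)) | t <- enum (dforest (DD p))])).
    by move=> p _; rewrite /decomp_nodes /= enum_option /= -map_comp.
  apply: computable_cons.
    apply: computable_pair; first exact: computable_None.
    exact: computable_set0.
  apply: (@computable_map c' (fun p => eElt (dforest (DD p)))).
  - exact: polybounded_enumT.
  - by have [_ ?] := lT; known.
  set c1 := ext _ _ _.
  apply: computable_pair; last first.
    by apply: (@computable_ancestor_bag c1 (fun k => pgraph (projT1 k)) (fun k => DD (projT1 k))); known.
  apply: computable_Some.
  have cp : computable c1 (fun k => eOption (eElt (dforest (DD (projT1 k)))))
      (fun k => parent (projT2 k)).
    by apply: (@computable_parent c1 (fun k => pgraph (projT1 k)) (fun k => DD (projT1 k))); known.
  have cn : computable c1 (fun=> eNat)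
      (fun k => if parent (projT2 k) is Some s then (enum_rank s : nat).+1 else 0).
    apply: computable_optioncase cp _ _; first exact: computable_nat.
    set c2 := ext _ _ _; apply: computable_succ.
    by apply: (@computable_rank c2 (fun k => dforest (DD (projT1 (projT1 k))))); known.
  by apply: computable_recode cn => k _ /=; rewrite /enc_elt enum_rank_option.
- by known.
Qed.

(** * Dynamic programming over a tree decomposition *)

(** Inclusion-exclusion for weights against inclusion-exclusion for sizes: what the two weights
    count twice, [wI], is at most the amount [d] that the union of the two partial solutions
    saves. *)
Lemma union_bound s r p u d wS wR wI wU : s <= wS -> r <= wR -> wI <= d ->
  wU + wI = wS + wR -> p <= u -> u + d <= s + r -> p <= wU.
Proof. lia. Qed.

Section PartialSolutions.
Variable G : sgraph.
Implicit Types (S R X B : {set G}) (l : seq {set G}) (p : pred {set G}).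

Definition covered S v := (v \in S) || [exists u in S, adj u v].

Lemma coveredP S v : reflect (exists2 u, u \in S & (u == v) || adj u v) (covered S v).
Proof.
apply: (iffP orP) => [[Sv|/exists_inP[u Su uv]]|[u Su /predU1P[<-|uv]]].
- by exists v; rewrite ?eqxx.
- by exists u; rewrite ?uv ?orbT.
- by left.
- by right; apply/exists_inP; exists u.
Qed.

Lemma covered_sub S R v : S \subset R -> covered S v -> covered R v.
Proof. by move=> /subsetP sSR /coveredP[u Su uv]; apply/coveredP; exists u; auto. Qed.

Definition subsets B : seq {set G} :=
  foldr (fun x l => l ++ [seq x |: X | X <- l]) [:: set0] (enum B).

Lemma mem_subsets X B : X \subset B -> X \in subsets B.
Proof.
move=> sXB; rewrite /subsets; have {sXB}: {subset X <= enum B}.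
  by move=> x Xx; rewrite mem_enum (subsetP sXB).
elim: (enum B) X => [|x s IH] X sX /=.
  rewrite inE; apply/eqP/setP=> y; rewrite in_set0.
  by apply/negP=> /sX.
rewrite mem_cat; have [Xx|nXx] := boolP (x \in X).
  apply/orP; right; rewrite -(setD1K Xx); apply: map_f; apply: IH => y.
  by case/setD1P=> neq_yx /sX; rewrite inE (negPf neq_yx).
apply/orP; left; apply: IH => y Xy; have := sX y Xy; rewrite inE => /predU1P[eq_yx|//].
by rewrite -eq_yx Xy in nXx.
Qed.

Lemma size_subsets B : size (subsets B) = 2 ^ #|B|.
Proof.
by rewrite /subsets cardE; elim: (enum B) => //= x s IH; rewrite size_cat size_map IH expnS mul2n addnn.
Qed.

(** An optional set, written as a list so that the results for all pairs can be concatenated; [[::]]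
    means that no candidate satisfies [p]. *)
Definition best (p : pred {set G}) l : seq {set G} :=
  foldr (fun S m => if p S && all (fun R => #|S| <= #|R|) m then [:: S] else m) [::] l.

Lemma size_best p l : size (best p l) <= 1.
Proof. by elim: l => //= S l IH; case: ifP. Qed.

Lemma mem_best p l S : S \in best p l -> p S && (S \in l).
Proof.
elim: l => //= R l IH; case: ifP => [/andP[pR _]|_].
  by rewrite inE => /eqP->; rewrite pR mem_head.
by move/IH/andP=> [-> Sl]; rewrite inE Sl orbT.
Qed.

Lemma best_min p l S : S \in l -> p S -> exists2 R, best p l = [:: R] & #|R| <= #|S|.
Proof.
elim: l => //= R l IH; rewrite inE => /predU1P[->|/IH{}IH] pS.
  rewrite pS /=; have := size_best p l; case: best => [|Q [|//]] _ /=; first by exists R.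
  by rewrite andbT; case: leqP => [_|/ltnW]; [exists R | exists Q].
have [Q -> le_QS] := IH pS; rewrite /= andbT.
by case: ifP => [/andP[_ le_RQ]|_]; [exists R => //; apply: leq_trans le_QS | exists Q].
Qed.

Definition meets (X Y : {set G}) : pred {set G} := fun S => (X \subset S) && [forall v in Y, covered S v].

Definition prune B l : seq {set G} :=
  flatten [seq flatten [seq best (meets X Y) l | Y <- subsets B] | X <- subsets B].

Lemma size_prune B l : size (prune B l) <= 4 ^ #|B|.
Proof.
have size_flatten_le (A : Type) (f : A -> seq {set G}) s m :
    (forall x, size (f x) <= m) -> size (flatten [seq f x | x <- s]) <= size s * m.
  by move=> le_m; elim: s => //= x s IH; rewrite size_cat mulSn leq_add.
rewrite (expnMn 2 2) -size_subsets; apply: (size_flatten_le _ _ _ _ _) => X.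
by rewrite -[X in _ <= X]muln1; apply: size_flatten_le => Y; apply: size_best.
Qed.

Lemma prune_sub B l S : S \in prune B l -> S \in l.
Proof. by case/flatten_mapP=> X _ /flatten_mapP[Y _ /mem_best/andP[]]. Qed.

(** The pair to look up is the trace of [S] on [B] together with the part of [B] that [S] covers.
    The survivor may contain or cover more than that, which does no harm. *)
Lemma pruneP B l S : S \in l -> exists R, [/\ R \in prune B l, S :&: B \subset R,
  forall v, v \in B -> covered S v -> covered R v & #|R| <= #|S|].
Proof.
move=> Sl; pose Y := [set v in B | covered S v].
have mS : meets (S :&: B) Y S.
  by rewrite /meets subsetIl; apply/forall_inP=> v; rewrite inE => /andP[].
have [R def_R le_RS] := best_min Sl mS; exists R.
have /mem_best/andP[/andP[sSR /forall_inP cR] _] : R \in best (meets (S :&: B) Y) l.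
  by rewrite def_R mem_head.
split=> // [|v Bv cv]; last by apply: cR; rewrite inE Bv.
apply/flatten_mapP; exists (S :&: B); first by rewrite mem_subsets ?subsetIr.
apply/flatten_mapP; exists Y; last by rewrite def_R mem_head.
by apply: mem_subsets; apply/subsetP=> v; rewrite inE => /andP[].
Qed.

Definition unions l m : seq {set G} := flatten [seq [seq A :|: B | B <- m] | A <- l].

Lemma unionsP l m Q :
  reflect (exists S R, [/\ S \in l, R \in m & Q = S :|: R]) (Q \in unions l m).
Proof.
apply: (iffP flatten_mapP) => [[S Sl /mapP[R Rm ->]]|[S [R [Sl Rm ->]]]].
  by exists S, R.
by exists S => //; apply: map_f.
Qed.

Definition keep (X : {set G}) l : seq {set G} := [seq A <- l | [forall v in X, covered A v]].

End PartialSolutions.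

(** * Tables of partial solutions and their correctness *)

Section Table.
Variables (G : sgraph) (D : decomp G).
Local Notation T := (dforest D).
Variable leaf_table : T -> seq {set G}.

(** Vertices of [bag s] outside [bag t] are forgotten here. All their neighbours lie below [s], so
    they must be covered by now, which [keep] enforces. Pruning after each child keeps the table
    small whatever the number of children. *)
Definition attach (F : T -> seq {set G}) (t s : T) (l : seq {set G}) : seq {set G} :=
  if parent s == Some t
  then prune (bag t) (unions l (keep (bag s :\: bag t) (F s))) else l.

Definition update (F : T -> seq {set G}) (t : T) : seq {set G} :=
  if leaf t then leaf_table t
  else foldr (attach F t) (subsets (bag t)) (enum T).

(** Simultaneous rounds at all nodes replace recursion on the tree; a node has its final quality
    after as many rounds as it has descendants. *)
Definition table n : T -> seq {set G} := iter n update (fun=> [::]).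

(** Searching all tables spares the program a search for the root; the test for domination discards
    the sets that are only partial. *)
Definition solution : {set G} :=
  head set0 (best (@dominating G) (flatten [seq table #|T| t | t <- enum T])).

Variables (H : sgraph -> Prop) (HD : tree_decomp H D) (O : {set G}) (q : nat).
Hypothesis domO : dominating O.

Definition below (t : T) : {set G} := [set v | [exists s, ancestor t s && (v \in bag s)]].
(** A budget: [q] units for each vertex, and one more for each vertex of [L] to pay for the error
    [1 / q] allowed there. *)
Definition weight (S : {set G}) : nat := \sum_(v in S) (q + (v \in dL D)).

(** [S] need not contain the vertices of [O] in [L]: an approximate solution at a leaf may choose
    others, and no other bag sees the difference. *)
Definition complete (l : seq {set G}) (t : T) : Prop := exists S, [/\ S \in l,
  O :&: bag t :\: dL D \subset S,
  forall v, v \in bag t -> covered (O :&: below t) v -> covered S v &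
  q * #|S| <= weight (O :&: below t)].

Definition sound (l : seq {set G}) (t : T) : Prop :=
  forall S v, S \in l -> v \in below t :\: bag t -> covered S v.

Hypothesis leaf_table_spec : forall (t : T) (S : {set G}), leaf t -> S \subset bag t ->
  (forall v, v \in bag t :&: dL D -> covered S v) ->
  exists R, [/\ R \in leaf_table t, S :\: dL D \subset R,
    forall v, v \in bag t -> covered S v -> covered R v & q * #|R| <= weight S].

Lemma belowP t v : reflect (exists2 s, ancestor t s & v \in bag s) (v \in below t).
Proof. by rewrite inE; apply: exists_inP. Qed.

Lemma bag_below t : bag t \subset below t.
Proof. by apply/subsetP=> v vt; apply/belowP; exists t => //; apply: ancestor_refl. Qed.

(** The edge between [c] and [t] is the only way out of the subtree of [c]. If one of its two bags
    misses [v], the connected set of bags containing [v] cannot cross it. *)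
Lemma separator (t c s : T) v : parent c = Some t -> v \in below c -> v \in bag s ->
  ~~ ancestor c s -> (v \in bag c) && (v \in bag t).
Proof.
move=> pc /belowP[d anc_cd vd] vs; apply: contraNT => n_sep.
have cl : closed [rel x y | [&& tree_adj x y, v \in bag x & v \in bag y]] (ancestor c).
  apply: (intro_closed (sym_connect_sym _)).
    by move=> x y /=; rewrite /tree_adj orbC [(v \in bag x) && _]andbC.
  move=> x y /= /and3P[/orP[/eqP py|/eqP px] vx vy] anc_cx.
    exact: ancestor_trans anc_cx (parent_ancestor py).
  have [eq_cx|neq_cx] := eqVneq c x; last exact: ancestor_parent px.
  move: px; rewrite -eq_cx pc => -[eq_ty]; case/negP: n_sep.
  by rewrite eq_cx eq_ty vx.
by rewrite -[ancestor c s](closed_connect cl (td_connected HD vd vs)).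
Qed.

Lemma neighbour_below (t c : T) u v : parent c = Some t -> adj u v ->
  v \in below c :\: bag t -> u \in below c.
Proof.
move=> pc uv /setDP[vc nvt]; have [s /andP[us vs]] := td_edge HD uv.
have [anc_cs|n_anc] := boolP (ancestor c s); first by apply/belowP; exists s.
by case/andP: (separator pc vc vs n_anc) => _; rewrite (negPf nvt).
Qed.

Lemma below_bag (t c : T) v : parent c = Some t -> v \in below c -> v \in bag t -> v \in bag c.
Proof.
by move=> pc vc vt; case/andP: (separator pc vc vt (parent_acyclic pc)).
Qed.

Lemma ancestor_comparable (s r t : T) : ancestor s t -> ancestor r t ->
  ancestor s r || ancestor r s.
Proof.
elim/(well_founded_ind (@parent_wf T)): t => t IH anc_s anc_r.
have [->|neq_st] := eqVneq s t; first by rewrite anc_r orbT.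
have [->|neq_rt] := eqVneq r t; first by rewrite anc_s.
case pt: (parent t) => [p|].
  by apply: (IH p pt); [apply: ancestor_parent pt | apply: ancestor_parent pt].
case/connectP: anc_s neq_st => p; case/lastP: p => [|p x]; first by move=> _ ->; rewrite eqxx.
by rewrite rcons_path last_rcons => /andP[_ /eqP] + def_x; rewrite -def_x pt.
Qed.

Lemma sibling_bag (t c d : T) v : parent c = Some t -> parent d = Some t -> c != d ->
  v \in below c -> v \in below d -> v \in bag t.
Proof.
move=> pc pd neq_cd vc /belowP[s anc_ds vs].
suff n_anc: ~~ ancestor c s by case/andP: (separator pc vc vs n_anc).
apply/negP=> anc_cs; case/orP: (ancestor_comparable anc_cs anc_ds) => anc.
  by have := ancestor_parent anc neq_cd pd; apply/negP/parent_acyclic.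
by have := ancestor_parent anc _ pc; rewrite eq_sym => /(_ neq_cd); apply/negP/parent_acyclic.
Qed.

Lemma below_cases (t : T) v : v \in below t -> v \in bag t \/
  exists2 c, parent c = Some t & v \in below c.
Proof.
case/belowP=> s /connectP[[_ ->|c p /= /andP[/eqP pc cp] def_s] vs]; first by left.
by right; exists c => //; apply/belowP; exists s => //; apply/connectP; exists p.
Qed.

Lemma internal_dL (t : T) v : ~~ leaf t -> v \in bag t -> v \notin dL D.
Proof.
move=> nt vt; apply/negP=> /(td_L HD)[s [ls bag_s]].
by move: nt; rewrite (eqP (etrans (esym (bag_s t)) vt)) ls.
Qed.

Lemma weight_setID (A B : {set G}) : weight A = weight (A :&: B) + weight (A :\: B).
Proof. exact: big_setID. Qed.

Lemma weight_setU (A B : {set G}) : weight (A :|: B) = weight A + weight (B :\: A).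
Proof. by rewrite (weight_setID (A :|: B) A) setUK setDUl setDv set0U. Qed.

Lemma weight_sub (A B : {set G}) : A \subset B -> weight A <= weight B.
Proof. by move=> sAB; rewrite (weight_setID B A) (setIidPr sAB) leq_addr. Qed.

Lemma weight_card (A : {set G}) : (forall v, v \in A -> v \notin dL D) -> weight A = q * #|A|.
Proof.
move=> nA; rewrite /weight mulnC -sum_nat_const.
by apply: eq_bigr => v /nA/negPf ->; rewrite addn0.
Qed.

Lemma leq_weight_card (A : {set G}) : weight A <= q.+1 * #|A|.
Proof. by rewrite /weight mulnC -sum_nat_const leq_sum // => v _; rewrite -addn1 leq_add2l leq_b1. Qed.

Section Step.
Variables (F : T -> seq {set G}) (t : T).
Hypothesis internal : ~~ leaf t.
Hypothesis soundF : forall c, parent c = Some t -> sound (F c) c.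
Hypothesis completeF : forall c, parent c = Some t -> complete (F c) c.

(** The counterpart of [below t] in the middle of the fold, when only the children in [l] have been
    attached. *)
Definition reached (l : seq T) : {set G} :=
  bag t :|: \bigcup_(c | (c \in l) && (parent c == Some t)) below c.

Lemma attach_sound l S c v : S \in foldr (attach F t) (subsets (bag t)) l ->
  c \in l -> parent c = Some t -> v \in below c :\: bag t -> covered S v.
Proof.
elim: l S => //= d l IH S; rewrite /attach; case: ifP => [/eqP pd|n_pd].
  move/prune_sub/unionsP=> [S1 [S2 [l1 l2 ->]]].
  rewrite inE => /predU1P[->|cl] pc vc; last first.
    exact: covered_sub (subsetUl _ _) (IH _ l1 cl pc vc).
  move: l2; rewrite mem_filter => /andP[/forall_inP keep2 F2].
  apply: covered_sub (subsetUr _ _) _; have [vd|nvd] := boolP (v \in bag d).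
    by apply: keep2; move: vc; rewrite !inE vd => /andP[->].
  by apply: (soundF pd F2); move: vc; rewrite !inE nvd => /andP[_ ->].
move=> lS; rewrite inE => /predU1P[->|cl] pc; last exact: IH.
by rewrite pc eqxx in n_pd.
Qed.

Lemma attach_complete l : uniq l -> exists S,
  [/\ S \in foldr (attach F t) (subsets (bag t)) l, O :&: bag t \subset S,
      forall v, v \in bag t -> covered (O :&: reached l) v -> covered S v &
      q * #|S| <= weight (O :&: reached l)].
Proof.
elim: l => [_|c l IH /= /andP[ncl uniq_l]].
  have -> : reached [::] = bag t by rewrite /reached big_pred0 ?setU0.
  exists (O :&: bag t); split=> //; first by rewrite mem_subsets ?subsetIr.
  rewrite weight_card // => v /setIP[_ vt]; exact: internal_dL internal vt.
have {IH}[S [lS sOS covS leS]] := IH uniq_l; rewrite {1}/attach.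
have [/eqP pc|n_pc] := ifP; last first.
  have -> : reached (c :: l) = reached l.
    congr (_ :|: _); apply: eq_bigl => d; rewrite inE.
    by case: eqVneq => [->|] //=; rewrite n_pc andbF.
  by exists S.
have def_reached : reached (c :: l) = reached l :|: below c.
  rewrite /reached (bigD1 c) /= ?mem_head ?pc ?eqxx // -setUA; congr (_ :|: _).
  rewrite setUC; congr (_ :|: _); apply: eq_bigl => d; rewrite inE.
  have [->|neq_dc] := eqVneq d c; first by rewrite (negPf ncl) andbF.
  by rewrite andbT.
have [R [FR sOR covR leR]] := completeF pc.
(* The optimum dominates a forgotten vertex from below [c], so completeness at the child makes [R]
   pass the filter. *)
have keepR : R \in keep (bag c :\: bag t) (F c).
  rewrite mem_filter FR andbT; apply/forall_inP=> v /setDP[vc nvt]; apply: covR => //.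
  have /coveredP[u Ou uv] := forallP domO v; apply/coveredP; exists u => //.
  have bv : v \in below c by apply: (subsetP (bag_below c)).
  rewrite inE Ou; case/predU1P: uv => [->//|uv].
  by apply: (neighbour_below pc uv); rewrite inE nvt.
have /(pruneP (bag t))[P [lP sP covP leP]] :
    S :|: R \in unions (foldr (attach F t) (subsets (bag t)) l) (keep (bag c :\: bag t) (F c)).
  by apply/unionsP; exists S, R.
have sOtR : O :&: bag t :&: bag c \subset R.
  apply: subset_trans sOR; apply/subsetP=> v; rewrite !inE => /andP[/andP[-> vt] ->].
  by rewrite (internal_dL internal vt).
exists P; split=> //.
- apply: subset_trans sP; rewrite subsetI subsetIr andbT.
  by apply: subset_trans sOS _; apply: subsetUl.
- move=> v vt; rewrite def_reached => /coveredP[u Ou uv]; apply: covP => //.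
  have [ul|nul] := boolP (u \in reached l).
    apply: covered_sub (subsetUl _ _) _; apply: covS => //; apply/coveredP; exists u => //.
    by move: Ou; rewrite !inE => /andP[-> _]; move: ul; rewrite inE.
  have uc : u \in below c by move: Ou; rewrite !inE -in_setU -/(reached l) (negPf nul) => /andP[].
  have Ou' : u \in O by case/setIP: Ou.
  have nut : u \notin bag t by apply: contra nul => ut; rewrite inE ut.
  have uv' : adj u v by case/predU1P: uv => // eq_uv; rewrite eq_uv vt in nut.
  have vc : v \in below c by apply: (neighbour_below (u := v) pc (v := u)); rewrite 1?adj_sym // inE nut.
  apply: covered_sub (subsetUr _ _) _; apply: covR; first exact: below_bag vt.
  by apply/coveredP; exists u => //; rewrite inE Ou'.
(* [C] contains everything counted on both sides, since the subtree of [c] meets the part already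
   reached only in [bag t]. It avoids [L], so its vertices cost exactly [q] each, and it is
   contained in both [S] and [R]. *)
- pose C := O :&: bag t :&: bag c.
  have sub_C : O :&: below c :&: (O :&: reached l) \subset C.
    apply/subsetP=> v /setIP[/setIP[Ov vc] /setIP[_ vl]].
    suff vt : v \in bag t by rewrite 2!inE Ov vt (below_bag pc).
    case/setUP: vl => [//|/bigcupP[d /andP[dl /eqP pd] vd]].
    by apply: sibling_bag pc pd _ vc vd; apply: contraNneq ncl => ->.
  have leC : weight (O :&: below c :&: (O :&: reached l)) <= q * #|C|.
    apply: leq_trans (weight_sub sub_C) _; rewrite weight_card // => v.
    by rewrite !inE => /andP[/andP[_ vt] _]; apply: internal_dL internal vt.
  have cardC : #|S :|: R| + #|C| <= #|S| + #|R|.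
    rewrite -(cardsUI S R) leq_add2l; apply: subset_leq_card; rewrite subsetI sOtR andbT.
    by apply: subset_trans sOS; apply: subsetIl.
  have def_w : weight (O :&: reached (c :: l)) + weight (O :&: below c :&: (O :&: reached l))
      = weight (O :&: reached l) + weight (O :&: below c).
    rewrite def_reached setIUr weight_setU.
    by rewrite (weight_setID (O :&: below c) (O :&: reached l)) -addnA [_ + weight (_ :&: _)]addnC.
  have leC' := leq_mul (leqnn q) cardC; rewrite !mulnDr in leC'.
  exact: union_bound leS leR leC def_w (leq_mul (leqnn q) leP) leC'.
Qed.

End Step.

Lemma attach_step F t : ~~ leaf t ->
  (forall c, parent c = Some t -> sound (F c) c) ->
  sound (foldr (attach F t) (subsets (bag t)) (enum T)) t /\
  ((forall c, parent c = Some t -> complete (F c) c) ->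
   complete (foldr (attach F t) (subsets (bag t)) (enum T)) t).
Proof.
move=> nt soundF; split=> [S v lS /setDP[vb nvt]|completeF].
  case: (below_cases vb) => [|[c pc vc]]; first by rewrite (negPf nvt).
  by apply: (attach_sound soundF lS _ pc); rewrite ?mem_enum // inE nvt.
have [S [lS sOS covS leS]] := attach_complete nt completeF (enum_uniq T).
have def_below : reached t (enum T) = below t.
  apply/setP=> v; rewrite inE; apply/orP/idP => [[|/bigcupP[c /andP[_ /eqP pc] /belowP[s anc_cs vs]]]|].
  - exact: (subsetP (bag_below t)).
  - apply/belowP; exists s => //; exact: ancestor_trans (parent_ancestor pc) anc_cs.
  - case/below_cases=> [|[c pc vc]]; [by left | right].
    by apply/bigcupP; exists c; rewrite ?mem_enum ?pc ?eqxx.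
rewrite def_below in covS leS; exists S; split=> //.
by apply: subset_trans sOS; apply: subsetDl.
Qed.

Lemma leaf_below t : leaf t -> below t = bag t.
Proof.
move=> lt; apply/setP=> v; apply/belowP/idP => [[s /(leaf_ancestor lt)->]|vt] //.
by exists t => //; apply: ancestor_refl.
Qed.

Lemma leaf_complete t : leaf t -> sound (leaf_table t) t /\ complete (leaf_table t) t.
Proof.
move=> lt; rewrite /sound /complete leaf_below //.
split=> [S v _|]; first by rewrite setDv inE.
have [|v /setIP[vt Lv]|R [lR sR covR leR]] := leaf_table_spec lt (S := O :&: bag t).
- exact: subsetIr.
(* A vertex of [L] has no other bag, so the vertex of [O] that dominates it lies in this bag as
   well. *)
- have /coveredP[u Ou uv] := forallP domO v; apply/coveredP; exists u => //.
  rewrite inE Ou; case/predU1P: uv => [->//|uv].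
  have [s [_ bag_s]] := td_L HD Lv; have [r /andP[ur vr]] := td_edge HD uv.
  by move: vt vr; rewrite !bag_s => /eqP-> /eqP <-.
- by exists R.
Qed.

(** Empty tables are vacuously sound, so soundness holds after any number of rounds. Completeness
    needs one round per descendant, [t] included, and a child has strictly fewer of them. *)
Lemma table_correct n t : sound (table n t) t /\
  (#|[set s | ancestor t s]| <= n -> complete (table n t) t).
Proof.
elim: n t => [|n IH] t.
  split=> //; rewrite leqn0 cards_eq0 => /eqP/setP/(_ t).
  by rewrite !inE ancestor_refl.
rewrite /table iterS -/(table n) /update; have [lt|nt] := boolP (leaf t).
  by have [] := leaf_complete lt.
have [snd cmp] := attach_step nt (fun c _ => (IH c).1); split=> // le_n; apply: cmp => c pc.
apply: (IH c).2; rewrite -ltnS; apply: leq_trans le_n; apply: proper_card.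
apply/properP; split.
  apply/subsetP=> s; rewrite !inE; exact: ancestor_trans (parent_ancestor pc).
by exists t; rewrite !inE ?ancestor_refl // parent_acyclic.
Qed.

Theorem solution_correct : dominating solution /\ q * #|solution| <= q.+1 * #|O|.
Proof.
have [r [_ uniq_r]] := td_tree HD.
have below_r : below r = [set: G].
  apply/setP=> v; rewrite [in RHS]inE; have [t vt] := td_cover HD v.
  have [r' root_r anc_t] := root_ancestor t.
  by apply/belowP; exists t => //; rewrite (uniq_r _ root_r).
have [snd cmp] := table_correct #|T| r; have {cmp}[|S [lS _ covS leS]] := cmp.
  exact: max_card.
rewrite below_r setIT in covS leS.
(* Completeness covers the root bag, because [O] dominates everything; soundness covers the vertices
   already forgotten. *)
have domS : dominating S.
  apply/forallP=> v; have [vr|nvr] := boolP (v \in bag r).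
    by apply: covS => //; apply: (forallP domO v).
  by apply: (snd _ _ lS); rewrite below_r inE nvr inE.
have Sl : S \in flatten [seq table #|T| t | t <- enum T].
  by apply/flatten_mapP; exists r; rewrite ?mem_enum.
have [R def_R le_RS] := best_min Sl domS; rewrite /solution def_R /=.
have /mem_best/andP[domR _] : R \in best (@dominating G) (flatten [seq table #|T| t | t <- enum T]).
  by rewrite def_R mem_head.
split=> //; apply: leq_trans (leq_mul (leqnn q) le_RS) _.
exact: leq_trans leS (leq_weight_card _).
Qed.

End Table.

(** * The gadget at a leaf *)

Section Gadget.
Variables (G : sgraph) (A L X Z : {set G}).
Local Notation B := (A :\: L).

(* [(Some v, false)] is the vertex [v], [(Some v, true)] a new vertex attached to [v]
   if [v \in X] and to [(None, false)] otherwise; [(None, false)] dominates [Z] and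
   has the pendant vertex [(None, true)]. *)
Local Notation label := (option G * bool)%type.

Definition link (x y : label) : bool :=
  if x.1 is Some u then
    if y.1 is Some v then
      ~~ x.2 && (if y.2 then (u == v) && (u \in X) else adj u v)
    else false
  else ~~ x.2 && (if y.1 is Some v then if y.2 then v \notin X else v \in Z else y.2).

Definition label_adj : rel label := fun x y => link x y || link y x.

Fact label_sym : symmetric label_adj.
Proof. by move=> x y; rewrite /label_adj orbC. Qed.

Fact label_irr : irreflexive label_adj.
Proof. by move=> [[v|] [|]]; rewrite /label_adj /link //= adj_irr. Qed.

Definition label_graph : sgraph := SGraph label_sym label_irr.

(** The choice of labels does not involve [X] or [Z]: for [v \notin X] the extra vertex of [v] is
    attached to the hub [(None, false)], which can be put into a solution anyway because of its
    pendant vertex. *)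
Definition labels : {set label_graph} :=
  [set x : label | if x.1 is Some v then (v \in A) && (x.2 ==> (v \notin L)) else true].

Definition gadget : sgraph := induced labels.

Definition gadget_modulator : {set gadget} :=
  [set w : gadget | if (val w).1 is Some v then (val w).2 || (v \notin L) else true].

Lemma gadget_modulatorP (H : sgraph -> Prop) : well_behaved H -> H (induced (A :&: L)) ->
  modulator H gadget_modulator.
Proof.
move=> wH HA; rewrite /modulator.
have ex (w : induced (~: gadget_modulator)) :
    {v | val (val w) = (Some v, false) & v \in A :&: L}.
  case: w => [[[[v|] [|]] l] m] /=; move: (m); rewrite !inE //= negbK => Lv.
  by exists v => //; move: (l); rewrite !inE Lv /= andbT.
pose g w := s2val (ex w).
have gE w : val (val w) = (Some (g w), false) by rewrite /g; case: (ex w).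
apply: (well_behaved_embedding wH HA (g := g)).
- by move=> w1 w2 eq_g; apply: val_inj; apply: val_inj; rewrite !gE eq_g.
- by move=> w; rewrite /g; case: (ex w).
move=> w1 w2; rewrite [RHS]/adj /= /induced_adj /= /induced_adj [RHS]/= /label_adj /link.
by rewrite !gE /= [adj (g w2) _]adj_sym orbb.
Qed.

Lemma card_gadget_modulator : #|gadget_modulator| <= 2 * #|B| + 2.
Proof.
rewrite -(card_imset _ val_inj).
pose f (x : G * bool) : label := (Some x.1, x.2).
have sub : val @: gadget_modulator \subset
    f @: setX B setT :|: [set (None, true); (None, false)].
  apply/subsetP=> _ /imsetP[w mw ->]; move: mw (valP w); rewrite !inE.
  case: (val w) => [[v|] b] /=; last by case: b => _ _; rewrite !eqxx ?orbT.
  move=> bL /andP[Av bL']; apply/orP; left; apply/imsetP; exists (v, b) => //.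
  by rewrite !inE Av !andbT; case: b bL bL' => //=.
apply: leq_trans (subset_leq_card sub) _; rewrite cardsU.
apply: leq_trans (leq_subr _ _) _; rewrite leq_add //; last by rewrite cards2; case: eqP.
apply: leq_trans (leq_imset_card _ _) _.
by rewrite cardsX cardsT card_bool mulnC.
Qed.

Definition decode (S : {set gadget}) : {set G} :=
  X :|: [set v | [exists w in S, val w == (Some v, false)]].

Hypothesis sXB : X \subset B.

(** First components map [S] onto a set containing [None] and all of [decode S]: the pendant vertex
    of the hub forces a preimage of [None], and the pendant vertex of each [v \in X] forces one of
    [v]. The additional value [None] makes the inequality strict. *)
Lemma card_decode (S : {set gadget}) : dominating S -> #|decode S| < #|S|.
Proof.
move=> domS; pose f (w : gadget) := (val w).1.
apply: leq_trans (leq_imset_card f _); rewrite -(card_imset _ (@Some_inj _)).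
have <- : #|None |: Some @: decode S| = (#|Some @: decode S|).+1.
  by rewrite cardsU1 (_ : _ \notin _) //; apply/imsetP => -[].
apply: subset_leq_card; apply/subsetP=> o /setU1P[->|/imsetP[v dv ->]].
  have lN : (None, true) \in labels by rewrite inE.
  have /coveredP[w Sw adj_w] := forallP domS (Sub (None, true) lN).
  apply/imsetP; exists w => //; rewrite /f; case/predU1P: adj_w => [->//|].
  rewrite /adj /= /induced_adj /adj /= /label_adj /link /= orbF.
  by case: (val w).1.
case/setUP: dv => [Xv|]; last first.
  rewrite inE => /exists_inP[w Sw /eqP def_w].
  by apply/imsetP; exists w; rewrite // /f def_w.
have lv : (Some v, true) \in labels.
  by rewrite inE /=; have := subsetP sXB v Xv; rewrite !inE => /andP[-> ->].
have /coveredP[w Sw adj_w] := forallP domS (Sub (Some v, true) lv).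
apply/imsetP; exists w => //; rewrite /f; case/predU1P: adj_w => [->//|].
rewrite /adj /= /induced_adj /adj /= /label_adj /link /=.
case: (val w).1 => [u|]; last by rewrite Xv andbF.
by rewrite orbF => /andP[_ /andP[/eqP->]].
Qed.

(** Among original vertices the hub reaches only [Z], and an extra vertex reaches [v] only if
    [v \in X], in which case [decode] contains [v]. *)
Lemma covered_decode (S : {set gadget}) v : dominating S ->
  v \in A -> v \notin Z -> covered (decode S) v.
Proof.
move=> domS Av nZv; have lv : (Some v, false) \in labels by rewrite inE /= Av.
have dec w u : w \in S -> val w = (Some u, false) -> u \in decode S.
  by move=> Sw def_w; apply/setUP; right; rewrite inE; apply/exists_inP; exists w; rewrite ?def_w.
have /coveredP[w Sw adj_w] := forallP domS (Sub (Some v, false) lv).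
case/predU1P: adj_w => [def_w|].
  apply/coveredP; exists v; rewrite ?eqxx //.
  by apply: (dec w) => //; rewrite def_w.
rewrite /adj /= /induced_adj /adj /= /label_adj /link /=.
case def_w: (val w) => [[u|] [|]] //=.
- by move/andP=> [_ Xv]; apply/coveredP; exists v; rewrite ?eqxx // inE Xv.
- rewrite [adj v u]adj_sym orbb => uv; apply/coveredP; exists u; rewrite ?uv ?orbT //.
  exact: dec def_w.
- by rewrite orbF (negPf nZv).
Qed.

(** Add the hub to [S]: it dominates [Z], its pendant vertex and the extra vertices of [B] outside
    [X]. *)
Lemma opt_gadget (S : {set G}) : S \subset A -> X \subset S ->
  (forall v, v \in A -> v \notin Z -> covered S v) -> opt_DS gadget <= #|S|.+1.
Proof.
move=> sSA sXS covS.
pose S' := [set w : gadget | ~~ (val w).2 && (if (val w).1 is Some v then v \in S else true)].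
have inl v : v \in S -> (Some v, false) \in labels by move=> Sv; rewrite inE /= (subsetP sSA).
have lN : (None, false) \in labels by rewrite inE.
have domS' : dominating S'.
  apply/forallP=> w; apply/coveredP.
  have byN : label_adj (None, false) (val w) -> exists2 u, u \in S' & (u == w) || adj u w.
    by move=> adj_w; exists (Sub (None, false) lN); [rewrite inE | apply/orP; right].
  have byS v : v \in S -> label_adj (Some v, false) (val w) ->
      exists2 u, u \in S' & (u == w) || adj u w.
    move=> Sv adj_w; exists (Sub (Some v, false) (inl v Sv)); first by rewrite inE.
    by apply/orP; right.
  move: byN byS (valP w); rewrite inE /label_adj /link.
  case def_w: (val w) => [[v|] [|]] /= byN byS; rewrite ?andbT ?orbF.
  - case/andP=> Av nLv; have [Xv|nXv] := boolP (v \in X); last by apply: byN; rewrite nXv.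
    by apply: (byS v); rewrite ?eqxx ?Xv ?(subsetP sXS).
  - move=> Av; have [Zv|nZv] := boolP (v \in Z); first by apply: byN; rewrite Zv.
    have /coveredP[u Su /predU1P[eq_uv|uv]] := covS v Av nZv; last first.
      by apply: (byS u) => //; rewrite uv.
    by exists w; rewrite ?eqxx // inE def_w -eq_uv.
  - by move=> _; apply: byN.
  - by move=> _; exists w; rewrite ?eqxx // inE def_w.
have leS' : #|S'| <= #|S|.+1.
  rewrite -(card_imset _ val_inj); pose f v : label := (Some v, false).
  have sub : val @: S' \subset (None, false) |: f @: S.
    apply/subsetP=> _ /imsetP[w S'w ->]; move: S'w; rewrite inE.
    case: (val w) => [[v|] [|]] //= Sv; last exact: setU11.
    by apply/setU1P; right; apply: imset_f.
  apply: leq_trans (subset_leq_card sub) _; rewrite cardsU1.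
  by rewrite -add1n leq_add ?leq_b1 ?leq_imset_card.
rewrite /opt_DS; case: arg_minnP => [|Q _ minQ]; last exact: leq_trans (minQ _ domS') leS'.
by apply/forallP=> v; rewrite inE.
Qed.

End Gadget.

Lemma approximates_inv Q (p : problem Q) (S : {set pgraph p}) (m : nat) :
  0 < m -> peps p = ((m%:R)^-1)%R -> approximates S ->
  m * #|S| <= m.+1 * opt_DS (pgraph p).
Proof.
move=> m0 def_eps [_]; rewrite def_eps; have m0' : (0 < m%:R :> rat)%R by rewrite ltr0n.
rewrite -(ler_pM2l m0') mulrA mulrDr mulr1 mulfV ?gt_eqF // -[1%R]/(1%:R)%R -natrD -!natrM.
by rewrite ler_nat addn1.
Qed.

(** [1 / m] is in lowest terms, so the error for a call is written down as the pair of [1] and [m],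
    without rational arithmetic. *)
Lemma enc_rat_inv m : 0 < m -> enc_rat ((m%:R)^-1)%R = enc_pair (enc_nat 1) (enc_nat m).
Proof.
move=> m0; have m0' : (m%:Z != 0)%R by rewrite -lt0n.
have co : coprime `|Posz 1| `|Posz m| by rewrite /coprime gcd1n.
have def_m : ((m%:R)^-1 = (1%:Z)%:~R / (m%:Z)%:~R :> rat)%R by rewrite -[in LHS]div1r.
have := coprimeq_num co; have := coprimeq_den co; rewrite -def_m (negPf m0') => denE numE.
rewrite /enc_rat numE denE mulr1.
by rewrite gtr0_sg ?ltz_nat ?gtr0_norm ?ltz_nat //.
Qed.

(* With [m = q * (#|A :\: L| + 2)] the error of the scheme, relative to the vertices
   chosen outside [A :\: L], is at most [1 / q], and it is [0] if there are none. *)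
Lemma decode_weight q b s o r m : 0 < q -> s <= b + o -> m = q * (b + 2) ->
  m * r.+1 <= m.+1 * s.+1 -> q * r <= q * s + o.
Proof.
move=> q0 le_s -> le_r; rewrite leqNgt; apply/negP=> lt_r.
(* Otherwise [q * r >= q * s + o + 1]; multiplied by [b + 2] this gives
   [(b + 2) * (o + 1) <= s + 1 <= b + o + 1], which is impossible. *)
have: q * (b + 2) * r <= q * (b + 2) * s + s.+1 by nia.
have: (b + 2) * (q * s + o).+1 <= (b + 2) * (q * r) by rewrite leq_mul2l lt_r orbT.
nia.
Qed.

Lemma enum_sig (T : finType) (A : {set T}) :
  [seq val x | x <- enum {: {x : T | x \in A}}] = enum A.
Proof.
have -> : enum {: {x : T | x \in A}} = pmap insub (enum T) by rewrite !enumT [in LHS]unlock.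
rewrite (pmap_filter (insubK _)) (enum_filter (mem A)); apply: eq_filter => x.
by rewrite isSome_insub.
Qed.

Lemma enum_prod (T1 T2 : finType) :
  enum {: T1 * T2} = flatten [seq [seq (x, y) | y <- enum T2] | x <- enum T1].
Proof. by rewrite !enumT [in LHS]unlock /= /prod_enum !enumT. Qed.

Lemma enum_boolE : enum {: bool} = [:: true; false].
Proof. by rewrite enumT unlock. Qed.

(** * Computability of the gadget *)

Definition eLabel (G : finType) : etype := ePair (eOption (eElt G)) eBool.

Lemma computable_flatmap (c : context) (X Y : c -> etype) (l : forall i, seq (X i))
    (f : forall i, X i -> seq (Y i)) :
  polybounded (fun i => size (l i)) ->
  @polybounded (ext c X (fun i x => List.In x (l i))) (fun k => size (f (projT1 k) (projT2 k))) ->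
  computable c (fun i => eSeq (X i)) l ->
  computable (ext c X (fun i x => List.In x (l i))) (fun k => eSeq (Y (projT1 k)))
    (fun k => f (projT1 k) (projT2 k)) ->
  computable c (fun i => eSeq (Y i)) (fun i => flatten [seq f i x | x <- l i]).
Proof.
move=> bl bf cl cf.
apply: (@computable_ext c (fun i => eSeq (Y i))
  (fun i => foldr (fun x m => f i x ++ m) [::] (l i))).
  by move=> i _; elim: (l i) => //= x m ->.
apply: (@computable_foldr c X (fun i => eSeq (Y i)) (fun _ _ => True)) => //.
  exact: computable_nil.
by apply: computable_cat; known.
Qed.

Section GadgetComputable.
Variables (c : context) (G : c -> sgraph).
Variables A L X Z : forall i, {set G i}.
Hypothesis lG : listable c (fun i => G i).
Hypothesis cG : computable c (fun=> eGraph) G.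
Hypothesis cA : computable c (fun i => eSet (G i)) A.
Hypothesis cL : computable c (fun i => eSet (G i)) L.
Hypothesis cX : computable c (fun i => eSet (G i)) X.
Hypothesis cZ : computable c (fun i => eSet (G i)) Z.
Local Notation gad i := (gadget (A i) (L i) (X i) (Z i)).

Let bG : polybounded (fun i => #|G i|). Proof. exact: lG.1. Qed.

Lemma polybounded_gadget : polybounded (fun i => #|gad i|).
Proof.
apply: (@polybounded_le c (fun i => 2 * (#|G i|).+1)); last by polybound.
move=> i _; rewrite card_sig; apply: leq_trans (max_card _) _.
by rewrite card_prod card_option card_bool mulnC.
Qed.

Lemma computable_labels : computable c (fun i => eSeq (eLabel (G i)))
  (fun i => [seq val w | w <- enum (gad i)]).
Proof.
(* Vertices are coded by rank, so the program has to list labels in the order of [enum], with [None]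
   first and [true] before [false]. *)
pose all_labels i := flatten [seq [:: (x, true); (x, false)] |
  x <- None :: [seq Some v | v <- enum (G i)]].
have bl : polybounded (fun i => size (None :: [seq Some v | v <- enum (G i)])).
  apply: (@polybounded_le c (fun i => (#|G i|).+1)); last by polybound.
  by move=> i _; rewrite /= size_map -cardE.
have cl : computable c (fun i => eSeq (eLabel (G i))) all_labels.
  apply: (@computable_flatmap c (fun i => eOption (eElt (G i))) (fun i => eLabel (G i))
    (fun i => None :: [seq Some v | v <- enum (G i)]) (fun i x => [:: (x, true); (x, false)])) => //.
  - exact: (polybounded_const _ 2).
  - apply: computable_cons; first exact: computable_None.
    apply: (@computable_map c (fun i => eElt (G i)) (fun i => eOption (eElt (G i)))).
    + exact: polybounded_enumT.
    + by case: lG.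
    + by apply: computable_Some; known.
  - cbv beta; set ck := ext _ _ _.
    have cb b : computable ck (fun k => eLabel (G (projT1 k))) (fun k => (projT2 k, b)).
      by apply: computable_pair; [known | apply: computable_bool].
    by do 2 apply: computable_cons => //; apply: computable_nil.
apply: (@computable_ext c (fun i => eSeq (eLabel (G i))) (fun i => [seq x <- all_labels i |
   if x.1 is Some v then (v \in A i) && (x.2 ==> (v \notin L i)) else true])).
  move=> i _; rewrite enum_sig enum_filter enum_prod enum_boolE enum_option.
  by apply: eq_filter => x; rewrite -[LHS]/(x \in labels _ _ _ _) inE.
apply: (@computable_filter c (fun i => eLabel (G i))) => //.
  apply: (@polybounded_le c (fun i => (#|G i|).+1 * 2)); last by polybound.
  move=> i _; have size2 (W : Type) (s : seq W) :
      size (flatten [seq [:: (x, true); (x, false)] | x <- s]) = size s * 2.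
    by elim: s => //= x s ->.
  by rewrite size2 /= size_map -cardE.
set ck := ext _ _ _.
apply: (@computable_optioncase ck (fun k => eElt (G (projT1 k))) (fun=> eBool)
  (fun k => (projT2 k).1) (fun=> true)
  (fun k v => (v \in A (projT1 k)) && ((projT2 k).2 ==> (v \notin L (projT1 k))))).
- by apply: (@computable_fst _ _ (fun=> eBool)); known.
- exact: computable_bool.
set c2 := ext _ _ _.
have cb : computable c2 (fun=> eBool) (fun k => (projT2 (projT1 k)).2).
  by apply: (@computable_snd c2 (fun k => eOption (eElt (G (projT1 (projT1 k)))))); known.
apply: computable_and; first by apply: computable_mem; known.
set c3 := restrict _ _.
apply: (@computable_ext c3 (fun=> eBool)
  (fun k => ~~ (projT2 (projT1 k)).2 || (projT2 k \notin L (projT1 (projT1 k))))).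
  by move=> k _; rewrite implybE.
apply: computable_or; first by apply: computable_neg; known.
by apply: computable_neg; apply: computable_mem; known.
Qed.

Lemma listable_gadget : listable c (fun i => gad i).
Proof.
apply: (listable_size _ polybounded_gadget computable_labels) => i _.
by rewrite size_map -cardE.
Qed.

End GadgetComputable.

Lemma computable_option_eq (c : context) (T : c -> finType) (o : forall i, option (T i))
    (t : forall i, T i) : polybounded (fun i => #|T i|) ->
  computable c (fun i => eOption (eElt (T i))) o -> computable c (fun i => eElt (T i)) t ->
  computable c (fun=> eBool) (fun i => o i == Some (t i)).
Proof.
move=> bT co ct; apply: (@computable_ext c (fun=> eBool)
  (fun i => if o i is Some s then s == t i else false)).
  by move=> i _; case: (o i).
apply: (@computable_optioncase c (fun i => eElt (T i)) (fun=> eBool)) => //.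
  exact: computable_bool.
by apply: computable_eqelt; known.
Qed.

Section LinkComputable.
Variables (c : context) (G : c -> sgraph) (X Z : forall i, {set G i}).
Variables (x y : forall i, option (G i) * bool).
Hypothesis bG : polybounded (fun i => #|G i|).
Hypothesis cG : computable c (fun=> eGraph) G.
Hypothesis cX : computable c (fun i => eSet (G i)) X.
Hypothesis cZ : computable c (fun i => eSet (G i)) Z.
Hypothesis cx : computable c (fun i => eLabel (G i)) x.
Hypothesis cy : computable c (fun i => eLabel (G i)) y.

Lemma computable_link : computable c (fun=> eBool) (fun i => link (X i) (Z i) (x i) (y i)).
Proof.
have cx1 : computable c (fun i => eOption (eElt (G i))) (fun i => (x i).1).
  by apply: (@computable_fst c _ (fun=> eBool)).
have cy1 : computable c (fun i => eOption (eElt (G i))) (fun i => (y i).1).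
  by apply: (@computable_fst c _ (fun=> eBool)).
have cx2 : computable c (fun=> eBool) (fun i => (x i).2).
  by apply: (@computable_snd c (fun i => eOption (eElt (G i)))).
have cy2 : computable c (fun=> eBool) (fun i => (y i).2).
  by apply: (@computable_snd c (fun i => eOption (eElt (G i)))).
apply: (@computable_optioncase c (fun i => eElt (G i)) (fun=> eBool) (fun i => (x i).1)
  (fun i => ~~ (x i).2 && (if (y i).1 is Some v then if (y i).2 then v \notin X i else v \in Z i
                           else (y i).2))
  (fun i u => if (y i).1 is Some v then
      ~~ (x i).2 && (if (y i).2 then (u == v) && (u \in X i) else adj u v) else false)) => //.
  apply: computable_and; first by apply: computable_neg; known.
  set c1 := restrict _ _.
  apply: (@computable_optioncase c1 (fun i => eElt (G i)) (fun=> eBool) (fun i => (y i).1)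
     (fun i => (y i).2) (fun i v => if (y i).2 then v \notin X i else v \in Z i)); try known.
  apply: computable_if; first by known.
    by apply: computable_neg; apply: computable_mem; known.
  by apply: computable_mem; known.
set c1 := ext _ _ _.
apply: (@computable_optioncase c1 (fun k => eElt (G (projT1 k))) (fun=> eBool)
  (fun k => (y (projT1 k)).1) (fun=> false)
  (fun k v => ~~ (x (projT1 k)).2 && (if (y (projT1 k)).2 then
     (projT2 k == v) && (projT2 k \in X (projT1 k)) else adj (projT2 k) v))).
- by known.
- exact: computable_bool.
apply: computable_and; first by apply: computable_neg; known.
apply: computable_if; first by known.
  by apply: computable_and; [apply: computable_eqelt; known | apply: computable_mem; known].
set c2 := restrict _ _.
by apply: (@computable_adj c2 (fun k => G (projT1 (projT1 k)))); known.
Qed.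

End LinkComputable.

Section GadgetParts.
Variables (c : context) (G : c -> sgraph).
Variables A L X Z : forall i, {set G i}.
Hypothesis lG : listable c (fun i => G i).
Hypothesis cG : computable c (fun=> eGraph) G.
Hypothesis cA : computable c (fun i => eSet (G i)) A.
Hypothesis cL : computable c (fun i => eSet (G i)) L.
Hypothesis cX : computable c (fun i => eSet (G i)) X.
Hypothesis cZ : computable c (fun i => eSet (G i)) Z.
Local Notation gad i := (gadget (A i) (L i) (X i) (Z i)).

Let bG : polybounded (fun i => #|G i|). Proof. exact: lG.1. Qed.
Let bgad : polybounded (fun i => #|gad i|).
Proof. exact: polybounded_gadget. Qed.
Let lgad : listable c (fun i => gad i).
Proof. exact: listable_gadget. Qed.
Let clab := computable_labels (A := A) (L := L) X Z lG cA cL.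

Lemma computable_gadget : computable c (fun=> eGraph) (fun i => gad i).
Proof.
pose lab i := [seq val w | w <- enum (gad i)].
have blab : polybounded (fun i => size (lab i)).
  by apply: polybounded_le bgad => i _; rewrite size_map -cardE.
have cm : computable c (fun=> eSeq (eSeq eBool))
    (fun i => [seq [seq link (X i) (Z i) x y || link (X i) (Z i) y x | y <- lab i] | x <- lab i]).
  apply: (@computable_map c (fun i => eLabel (G i)) (fun=> eSeq eBool)) => //.
  set c1 := ext _ _ _.
  apply: (@computable_map c1 (fun k => eLabel (G (projT1 k))) (fun=> eBool)).
  - by known.
  - by known.
  set c2 := ext _ _ _; apply: computable_or.
    by apply: (@computable_link c2 (fun k => G (projT1 (projT1 k)))); known.
  set c3 := restrict _ _.
  by apply: (@computable_link c3 (fun k => G (projT1 (projT1 k)))); known.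
apply: computable_recode cm => i _ /=; rewrite /enc_graph /lab; congr enc_seq.
symmetry; rewrite -[LHS]map_comp; apply: eq_map => u; rewrite /= -[LHS]map_comp.
by apply: eq_map.
Qed.

Lemma computable_gadget_modulator :
  computable c (fun i => eSet (gad i)) (fun i => gadget_modulator (A i) (L i) (X i) (Z i)).
Proof.
apply: (@computable_set c (fun i => gad i)) => //; set c1 := ext _ _ _.
pose w (k : c1) : gad (projT1 k) := projT2 k.
have cw : computable c1 (fun k => eLabel (G (projT1 k))) (fun k => val (w k)).
  apply: (@computable_lookup c1 (fun k => gad (projT1 k)) (fun k => eLabel (G (projT1 k)))
    (fun k u => val u)); by known.
apply: (@computable_optioncase c1 (fun k => eElt (G (projT1 k))) (fun=> eBool)
  (fun k => (val (w k)).1) (fun=> true) (fun k v => (val (w k)).2 || (v \notin L (projT1 k)))).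
- by apply: (@computable_fst c1 _ (fun=> eBool)).
- exact: computable_bool.
have cw2 : computable c1 (fun=> eBool) (fun k => (val (w k)).2).
  by apply: (@computable_snd c1 (fun k => eOption (eElt (G (projT1 k))))).
apply: computable_or; first by known.
by apply: computable_neg; apply: computable_mem; known.
Qed.

Variable S : forall i, {set gad i}.
Hypothesis cS : computable c (fun i => eSet (gad i)) S.

Lemma computable_decode : computable c (fun i => eSet (G i)) (fun i => decode (S i)).
Proof.
apply: computable_setU => //; apply: computable_set => //; set c1 := ext _ _ _.
apply: (@computable_exists c1 (fun k => gad (projT1 k))); try by known.
set c2 := ext _ _ _; pose w (k : c2) : gad (projT1 (projT1 k)) := projT2 k.
have cw : computable c2 (fun k => eLabel (G (projT1 (projT1 k)))) (fun k => val (w k)).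
  apply: (@computable_lookup c2 (fun k => gad (projT1 (projT1 k)))
    (fun k => eLabel (G (projT1 (projT1 k)))) (fun k u => val u)); by known.
apply: (@computable_ext c2 (fun=> eBool)
  (fun k => ((val (w k)).1 == Some (projT2 (projT1 k))) && ~~ (val (w k)).2)).
  by move=> k _; rewrite -/(w k); case: (val (w k)) => o b; rewrite xpair_eqE eqbF_neg.
apply: computable_and.
  apply: (@computable_option_eq c2 (fun k => G (projT1 (projT1 k)))); try by known.
  by apply: (@computable_fst c2 _ (fun=> eBool)).
set c3 := restrict _ _; apply: computable_neg.
by apply: (@computable_snd c3 (fun k => eOption (eElt (G (projT1 (projT1 k)))))); known.
Qed.

End GadgetParts.

(** * Computability of the dynamic program *)

Lemma computable_covered (c : context) (G : c -> sgraph) (S : forall i, {set G i})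
    (v : forall i, G i) : polybounded (fun i => #|G i|) -> computable c (fun=> eGraph) G ->
  computable c (fun i => eSet (G i)) S -> computable c (fun i => eElt (G i)) v ->
  computable c (fun=> eBool) (fun i => covered (S i) (v i)).
Proof.
move=> bG cG cS cv; apply: computable_or; first exact: computable_mem.
set c1 := restrict _ _; apply: (@computable_exists c1 (fun i => G i)); try by known.
by set c2 := ext _ _ _; apply: (@computable_adj c2 (fun k => G (projT1 k))); known.
Qed.

Lemma computable_cover (c : context) (G : c -> sgraph) (S Y : forall i, {set G i}) :
  polybounded (fun i => #|G i|) -> computable c (fun=> eGraph) G ->
  computable c (fun i => eSet (G i)) S -> computable c (fun i => eSet (G i)) Y ->
  computable c (fun=> eBool) (fun i => [forall v in Y i, covered (S i) v]).
Proof.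
move=> bG cG cS cY; apply: computable_forall => //.
by set c2 := ext _ _ _; apply: (@computable_covered c2 (fun k => G (projT1 k))); known.
Qed.

Lemma computable_dominating (c : context) (G : c -> sgraph) (S : forall i, {set G i}) :
  listable c (fun i => G i) -> computable c (fun=> eGraph) G ->
  computable c (fun i => eSet (G i)) S ->
  computable c (fun=> eBool) (fun i => dominating (S i)).
Proof.
move=> lG cG cS; have bG := lG.1.
apply: (@computable_ext c (fun=> eBool) (fun i => [forall v in [set: G i], covered (S i) v])).
  by move=> i _; apply/forallP/forall_inP => dom v; [move=> _|]; apply: dom.
by apply: computable_cover => //; apply: computable_setT.
Qed.

Lemma computable_subsets (c : context) (G : c -> sgraph) (B : forall i, {set G i}) :
  listable c (fun i => G i) -> polybounded (fun i => 2 ^ #|B i|) ->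
  computable c (fun i => eSet (G i)) B ->
  computable c (fun i => eSeq (eSet (G i))) (fun i => subsets (B i)).
Proof.
move=> lG bB cB; have bG := lG.1.
(* The list doubles at each element, so the invariant bounds every intermediate list by the final
   length. *)
apply: (@computable_foldr c (fun i => eElt (G i)) (fun i => eSeq (eSet (G i)))
  (fun i l => size l <= 2 ^ #|B i|)).
- move=> i s1 s2 _ def_B.
  have -> : size (foldr (fun (x : G i) l => l ++ [seq x |: X | X <- l]) [:: set0] s2) = 2 ^ size s2.
    by elim: s2 {def_B} => //= x s IH; rewrite size_cat size_map IH expnS mul2n addnn.
  by rewrite leq_exp2l // cardE def_B size_cat leq_addl.
- exact: polybounded_enum.
- exact: computable_enum_set.
- by apply: computable_cons; [exact: computable_set0 | exact: computable_nil].
set c1 := ext _ _ _.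
have bl : @polybounded c1 (fun k => size (projT2 k)).
  apply: (@polybounded_le c1 (fun k => 2 ^ #|B (projT1 (projT1 k))|)); last by known.
  by move=> k [].
apply: computable_cat => //; first by known.
apply: (@computable_map c1 (fun k => eSet (G (projT1 (projT1 k))))) => //; first by known.
set c2 := ext _ _ _; apply: computable_setU; try by known.
by apply: (@computable_set1 c2 (fun k => G (projT1 (projT1 (projT1 k))))); known.
Qed.

Lemma computable_best (c : context) (G : c -> sgraph) (p : forall i, pred {set G i})
    (l : forall i, seq {set G i}) :
  polybounded (fun i => #|G i|) -> polybounded (fun i => size (l i)) ->
  computable c (fun i => eSeq (eSet (G i))) l ->
  computable (ext c (fun i => eSet (G i)) (fun i x => @List.In (eSet (G i)) x (l i))) (fun=> eBool)
    (fun k => p (projT1 k) (projT2 k)) ->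
  computable c (fun i => eSeq (eSet (G i))) (fun i => best (p i) (l i)).
Proof.
move=> bG bl cl cp.
apply: (@computable_foldr c (fun i => eSet (G i)) (fun i => eSeq (eSet (G i)))
  (fun i m => size m <= 1)) => //.
- by move=> i s1 s2 _ _; apply: size_best.
- exact: computable_nil.
set c1 := ext _ _ _; apply: computable_if; try by known.
  apply: computable_and; first by known.
  set c2 := restrict _ _.
  apply: (@computable_all c2 (fun k => eSet (G (projT1 (projT1 k))))); try by known.
    apply: (@polybounded_le c2 (fun=> 1)); last exact: polybounded_const.
    by move=> k [[]].
  set c3 := ext _ _ _; apply: computable_leq.
  - apply: (@polybounded_le c3 (fun k => #|G (projT1 (projT1 (projT1 k)))|)); last by known.
    by move=> k _; apply: max_card.
  - by apply: (@computable_card c3 (fun k => G (projT1 (projT1 (projT1 k))))); known.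
  - by apply: (@computable_card c3 (fun k => G (projT1 (projT1 (projT1 k))))); known.
by apply: computable_cons; [known | exact: computable_nil].
Qed.

Lemma computable_prune (c : context) (G : c -> sgraph) (B : forall i, {set G i})
    (l : forall i, seq {set G i}) :
  listable c (fun i => G i) -> computable c (fun=> eGraph) G ->
  polybounded (fun i => 2 ^ #|B i|) -> polybounded (fun i => size (l i)) ->
  computable c (fun i => eSet (G i)) B -> computable c (fun i => eSeq (eSet (G i))) l ->
  computable c (fun i => eSeq (eSet (G i))) (fun i => prune (B i) (l i)).
Proof.
move=> lG cG bB bl cB cl; have bG := lG.1.
have cs := computable_subsets lG bB cB.
have bs : polybounded (fun i => size (subsets (B i))).
  by apply: polybounded_le bB => i _; rewrite size_subsets.
apply: (@computable_flatmap c (fun i => eSet (G i)) (fun i => eSet (G i))) => //.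
  set c1 := ext _ _ _.
  apply: (@polybounded_le c1 (fun k => 2 ^ #|B (projT1 k)|)); last by known.
  move=> k _; rewrite -size_subsets; elim: (subsets _) => //= Y s IH.
  by rewrite size_cat -add1n leq_add // size_best.
set c1 := ext _ _ _.
apply: (@computable_flatmap c1 (fun k => eSet (G (projT1 k))) (fun k => eSet (G (projT1 k)))).
- by known.
- set c2 := ext _ _ _; apply: (@polybounded_le c2 (fun=> 1)); last exact: polybounded_const.
  by move=> k _; apply: size_best.
- by known.
set c2 := ext _ _ _.
apply: (@computable_best c2 (fun k => G (projT1 (projT1 k)))); try by known.
set c3 := ext _ _ _; apply: computable_and.
  by apply: (@computable_subset c3 (fun k => G (projT1 (projT1 (projT1 k))))); known.
by set c4 := restrict _ _;
  apply: (@computable_cover c4 (fun k => G (projT1 (projT1 (projT1 k))))); known.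
Qed.

Lemma size_unions (G : sgraph) (l m : seq {set G}) : size (unions l m) = size l * size m.
Proof.
rewrite /unions; elim: l => //= S l IH; by rewrite size_cat size_map IH mulSn.
Qed.

Lemma computable_unions (c : context) (G : c -> sgraph) (l m : forall i, seq {set G i}) :
  listable c (fun i => G i) ->
  polybounded (fun i => size (l i)) -> polybounded (fun i => size (m i)) ->
  computable c (fun i => eSeq (eSet (G i))) l -> computable c (fun i => eSeq (eSet (G i))) m ->
  computable c (fun i => eSeq (eSet (G i))) (fun i => unions (l i) (m i)).
Proof.
move=> lG bl bm cl cm.
apply: (@computable_flatmap c (fun i => eSet (G i)) (fun i => eSet (G i))) => //.
  set c1 := ext _ _ _.
  apply: (@polybounded_le c1 (fun k => size (m (projT1 k)))); last by known.
  by move=> k _; rewrite size_map.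
set c1 := ext _ _ _.
apply: (@computable_map c1 (fun k => eSet (G (projT1 k))) (fun k => eSet (G (projT1 k))));
  try by known.
by set c2 := ext _ _ _; apply: computable_setU; known.
Qed.

Lemma computable_keep (c : context) (G : c -> sgraph) (Y : forall i, {set G i})
    (l : forall i, seq {set G i}) :
  polybounded (fun i => #|G i|) -> computable c (fun=> eGraph) G ->
  polybounded (fun i => size (l i)) ->
  computable c (fun i => eSet (G i)) Y -> computable c (fun i => eSeq (eSet (G i))) l ->
  computable c (fun i => eSeq (eSet (G i))) (fun i => keep (Y i) (l i)).
Proof.
move=> bG cG bl cY cl; apply: (@computable_filter c (fun i => eSet (G i))) => //.
by set c1 := ext _ _ _; apply: (@computable_cover c1 (fun k => G (projT1 k))); known.
Qed.

Lemma computable_leaf (c : context) (G : c -> sgraph) (D : forall i, decomp (G i))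
    (t : forall i, dforest (D i)) :
  polybounded (fun i => #|dforest (D i)|) -> computable c (fun i => eDecomp (G i)) D ->
  computable c (fun i => eElt (dforest (D i))) t ->
  computable c (fun=> eBool) (fun i => leaf (t i)).
Proof.
move=> bT cD ct; have lT := listable_dforest cD bT; have cE := lT.2.
apply: (@computable_ext c (fun=> eBool)
  (fun i => all (fun s => parent s != Some (t i)) (enum (dforest (D i))))).
  move=> i _; apply/forallP/allP => [lt s _|lt s]; first exact: lt.
  by apply: lt; rewrite mem_enum.
apply: (@computable_all c (fun i => eElt (dforest (D i)))) => //.
  exact: polybounded_enumT.
set c1 := ext _ _ _; apply: computable_neg.
apply: (@computable_option_eq c1 (fun k => dforest (D (projT1 k)))); try by known.
by apply: (@computable_parent c1 (fun k => G (projT1 k)) (fun k => D (projT1 k))); known.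
Qed.

Lemma update_ext (G : sgraph) (D : decomp G) (lt : dforest D -> seq {set G}) F F' t :
  F =1 F' -> update lt F t = update lt F' t.
Proof.
move=> eqF; rewrite /update; case: ifP => // _.
by elim: (enum _) => //= s l ->; rewrite /attach eqF.
Qed.

Section TableComputable.
Variables (c : context) (G : c -> sgraph) (D : forall i, decomp (G i)).
Local Notation T i := (dforest (D i)).
Variables (leaf_table : forall i, T i -> seq {set G i}) (W : c -> nat).
Hypothesis lG : listable c (fun i => G i).
Hypothesis cG : computable c (fun=> eGraph) G.
Hypothesis cD : computable c (fun i => eDecomp (G i)) D.
Hypothesis bT : polybounded (fun i => #|T i|).
Hypothesis bW : polybounded (fun i => 4 ^ W i).
Hypothesis size_leaf : forall i (t : T i), dom i -> leaf t -> size (leaf_table t) <= 4 ^ W i.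
Hypothesis size_bag : forall i (t : T i), dom i -> ~~ leaf t -> #|bag t| <= W i.
(** Calls to the scheme are legitimate at leaves only; the entries of the other nodes are filled
    with [[::]]. *)
Hypothesis cleaf : computable c (fun i => eSeq (eSeq (eSet (G i))))
  (fun i => [seq (if leaf t then leaf_table t else [::]) | t <- enum (T i)]).

Let bG : polybounded (fun i => #|G i|). Proof. exact: lG.1. Qed.
Let lT : listable c (fun i => T i). Proof. exact: listable_dforest. Qed.

Definition lookup i (tb : seq (seq {set G i})) (s : T i) := nth [::] tb (enum_rank s).
Definition update_row i (tb : seq (seq {set G i})) : seq (seq {set G i}) :=
  [seq update (@leaf_table i) (lookup tb) t | t <- enum (T i)].
(** Says nothing about the number of rows: [lookup] reads a missing row as [[::]], which is short as
    well. *)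
Definition short i (tb : seq (seq {set G i})) : Prop := all (fun l => size l <= 4 ^ W i) tb.

Lemma size_attach i F (t : T i) s : dom i -> ~~ leaf t ->
  size (foldr (attach F t) (subsets (bag t)) s) <= 4 ^ W i.
Proof.
move=> ci nt; elim: s => [|r s IH] /=.
  rewrite size_subsets; apply: leq_trans (leq_pexp2l _ (size_bag ci nt)) _ => //.
  by case: (W i) => // n; rewrite leq_exp2r.
rewrite /attach; case: ifP => // _; apply: leq_trans (size_prune _ _) _.
by rewrite leq_exp2l // size_bag.
Qed.

Lemma size_lookup i tb (s : T i) : short tb -> size (lookup tb s) <= 4 ^ W i.
Proof.
move=> /allP tb_short; rewrite /lookup; have [lt_s|ge_s] := ltnP (enum_rank s) (size tb).
  by apply: tb_short; apply: mem_nth.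
by rewrite nth_default.
Qed.

Lemma update_short i (tb : seq (seq {set G i})) : dom i -> short (update_row tb).
Proof.
move=> ci; rewrite /short all_map; apply/allP=> t _ /=; rewrite /update.
by case: ifP => [|/negbT]; [apply: size_leaf | apply: size_attach].
Qed.

Lemma iter_update i n : iter n (@update_row i) [seq [::] | _ <- enum (T i)] =
  [seq table (@leaf_table i) n t | t <- enum (T i)].
Proof.
elim: n => // n IH; rewrite iterS IH; apply: eq_map => t.
rewrite /table iterS -/(table _ n); apply: update_ext => s; rewrite /lookup.
have lt_s : enum_rank s < size (enum (T i)) by rewrite -cardE ltn_ord.
by rewrite (nth_map s) // -enum_val_nth enum_rankK.
Qed.

Lemma computable_update_row :
  computable (ext c (fun i => eSeq (eSeq (eSet (G i)))) short)
    (fun k => eSeq (eSeq (eSet (G (projT1 k))))) (fun k => update_row (projT2 k)).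
Proof.
have cE := lT.2; set c1 := ext _ _ _.
apply: (@computable_map c1 (fun k => eElt (T (projT1 k))) (fun k => eSeq (eSet (G (projT1 k))))).
- by apply: polybounded_enumT; known.
- by known.
set c2 := ext _ _ _; apply: computable_if.
- by apply: (@computable_leaf c2 (fun k => G (projT1 (projT1 k))) (fun k => D (projT1 (projT1 k))));
    known.
- set c3 := restrict _ _.
  apply: (@computable_ext c3 (fun k => eSeq (eSet (G (projT1 (projT1 k)))))
    (fun k => if leaf (projT2 k) then leaf_table (projT2 k) else [::])).
    by move=> k [_ ->].
  by apply: (@computable_lookup c3 (fun k => T (projT1 (projT1 k)))
    (fun k => eSeq (eSet (G (projT1 (projT1 k)))))
    (fun k t => if leaf t then leaf_table t else [::])); known.
set c3 := restrict _ _.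
have bW3 : @polybounded c3 (fun k => 4 ^ W (projT1 (projT1 k))) by known.
have bB3 : @polybounded c3 (fun k => 2 ^ #|bag (projT2 k)|).
  (* With no child attached, [size_attach] is a bound on the number of subsets of the bag. *)
  apply: (@polybounded_le c3 _ _ _ bW3) => -[[i tb] t] [[[ci _] _] nt].
  by have /= := size_attach (fun=> [::]) [::] ci nt; rewrite size_subsets.
have cB3 : computable c3 (fun k => eSet (G (projT1 (projT1 k)))) (fun k => bag (projT2 k)).
  by apply: (@computable_bag c3 (fun k => G (projT1 (projT1 k)))
     (fun k => D (projT1 (projT1 k)))); known.
apply: (@computable_foldr c3 (fun k => eElt (T (projT1 (projT1 k))))
  (fun k => eSeq (eSet (G (projT1 (projT1 k)))))
  (fun k l => size l <= 4 ^ W (projT1 (projT1 k)))).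
- by move=> [[i tb] t] s1 s2 [[[ci _] _] nt] _; apply: size_attach.
- by apply: polybounded_enumT; known.
- by known.
- by apply: (@computable_subsets c3 (fun k => G (projT1 (projT1 k)))); known.
set c5 := ext _ _ _.
have bW5 : @polybounded c5 (fun k => 4 ^ W (projT1 (projT1 (projT1 (projT1 k))))) by known.
have bl : @polybounded c5 (fun k => size (projT2 k)).
  by apply: (@polybounded_le c5 _ _ _ bW5) => k [].
pose F (k : c5) := lookup (projT2 (projT1 (projT1 (projT1 k)))) (projT2 (projT1 k)).
have bF : @polybounded c5 (fun k => size (F k)).
  apply: (@polybounded_le c5 _ _ _ bW5) => -[[[[i tb] t] s] l] [[[[[_ tb_short] _] _] _] _].
  exact: size_lookup.
have cF : computable c5 (fun k => eSeq (eSet (G (projT1 (projT1 (projT1 (projT1 k))))))) F.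
  apply: (@computable_nth c5 (fun k => eSeq (eSet (G (projT1 (projT1 (projT1 (projT1 k)))))))
    (fun=> [::])).
  - apply: (@polybounded_enum_rank c5 (fun k => T (projT1 (projT1 (projT1 (projT1 k)))))).
    by known.
  - exact: computable_nil.
  - by apply: (@computable_rank c5 (fun k => T (projT1 (projT1 (projT1 (projT1 k)))))); known.
  - by known.
have cbs : computable c5 (fun k => eSet (G (projT1 (projT1 (projT1 (projT1 k))))))
    (fun k => bag (projT2 (projT1 k))).
  by apply: (@computable_bag c5 (fun k => G (projT1 (projT1 (projT1 (projT1 k)))))
     (fun k => D (projT1 (projT1 (projT1 (projT1 k)))))); known.
rewrite /attach; apply: computable_if; last by known.
  apply: (@computable_option_eq c5 (fun k => T (projT1 (projT1 (projT1 (projT1 k)))))); try by known.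
  by apply: (@computable_parent c5 (fun k => G (projT1 (projT1 (projT1 (projT1 k)))))
     (fun k => D (projT1 (projT1 (projT1 (projT1 k)))))); known.
set c6 := restrict _ _.
have bk : @polybounded c6 (fun k => size (keep (bag (projT2 (projT1 k)) :\: bag (projT2 (projT1 (projT1 k)))) (F k))).
  apply: (@polybounded_le c6 (fun k => size (F k))); last by known.
  by move=> k _; rewrite size_filter count_size.
have bl6 : @polybounded c6 (fun k => size (projT2 k)) by known.
have ck : computable c6 (fun k => eSeq (eSet (G (projT1 (projT1 (projT1 (projT1 k)))))))
    (fun k => keep (bag (projT2 (projT1 k)) :\: bag (projT2 (projT1 (projT1 k)))) (F k)).
  apply: (@computable_keep c6 (fun k => G (projT1 (projT1 (projT1 (projT1 k)))))); try by known.
  by apply: computable_setD; known.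
apply: (@computable_prune c6 (fun k => G (projT1 (projT1 (projT1 (projT1 k)))))); try by known.
- apply: (@polybounded_le c6 (fun k => size (projT2 k) *
    size (keep (bag (projT2 (projT1 k)) :\: bag (projT2 (projT1 (projT1 k)))) (F k)))).
    by move=> k _; rewrite size_unions.
  exact: polyboundedM.
by apply: (@computable_unions c6 (fun k => G (projT1 (projT1 (projT1 (projT1 k)))))); known.
Qed.

Lemma computable_solution :
  computable c (fun i => eSet (G i)) (fun i => solution (@leaf_table i)).
Proof.
have cE := lT.2; have cn := computable_cardT lT.
have ct : computable c (fun i => eSeq (eSeq (eSet (G i))))
    (fun i => [seq table (@leaf_table i) #|T i| t | t <- enum (T i)]).
  apply: (@computable_ext c (fun i => eSeq (eSeq (eSet (G i)))) (fun i =>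
    iter #|T i| (@update_row i) [seq [::] | _ <- enum (T i)])).
    by move=> i _; rewrite iter_update.
  apply: (@computable_iter c (fun i => eSeq (eSeq (eSet (G i)))) short).
  - by move=> i _; rewrite /short all_map; apply/allP.
  - by move=> i tb ci _; apply: update_short.
  - by [].
  - by [].
  - apply: (@computable_map c (fun i => eElt (T i))) => //.
      exact: polybounded_enumT.
    exact: computable_nil.
  - exact: computable_update_row.
have bt i t : dom i -> size (table (@leaf_table i) #|T i| t) <= 4 ^ W i.
  move=> ci; case: (#|T i|) => // n; rewrite /table iterS /update.
  by case: ifP => [|/negbT]; [apply: size_leaf | apply: size_attach].
have bf : polybounded (fun i => size (flatten [seq table (@leaf_table i) #|T i| t | t <- enum (T i)])).
  apply: (@polybounded_le c (fun i => #|T i| * 4 ^ W i)); last exact: polyboundedM.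
  move=> i ci; rewrite [X in _ <= X * _]cardE; elim: (enum _) => //= t s IH.
  rewrite size_cat mulSn; apply: leq_add => //; exact: bt.
apply: computable_head; first exact: computable_set0.
apply: (@computable_best c (fun i => G i)) => //.
  apply: (@computable_flatten c (fun i => eSet (G i))) => //.
  - by apply: (@polybounded_le c (fun i => #|T i|)) => // i _; rewrite size_map -cardE.
  - set c1 := ext _ _ _; apply: (@polybounded_le c1 (fun k => 4 ^ W (projT1 k))); last by known.
    move=> [i l] [/= ci]; elim: (enum _) => //= t s IH [<-|/IH //]; exact: bt.
by set c1 := ext _ _ _; apply: (@computable_dominating c1 (fun k => G (projT1 k))); known.
Qed.

End TableComputable.

(** * Errors as natural numbers and the tables at the leaves *)

Lemma computable_mul (c : context) (m n : c -> nat) : polybounded m -> polybounded n ->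
  computable c (fun=> eNat) m -> computable c (fun=> eNat) n ->
  computable c (fun=> eNat) (fun i => m i * n i).
Proof.
move=> bm bn cm cn; apply: (@computable_ext c (fun=> eNat) (fun i => iter (n i) (addn (m i)) 0)).
  by move=> i _; rewrite iter_addn_0.
apply: (@computable_iter c (fun=> eNat) (fun _ _ => True)) => //.
  exact: computable_nat.
by apply: computable_add; known.
Qed.

(** A positive rational has numerator at least 1, so [1 / q <= eps] for its denominator [q], which
    can be read off the code of [eps]. *)
Lemma ge_inv_denq (eps : rat) : (0 < eps -> 1 <= eps * `|denq eps|%N%:R)%R.
Proof.
move=> eps0; rewrite pmulrn absz_denq -numqE -[1%R]/((Posz 1)%:~R)%R ler_int.
by rewrite -gtz0_ge1 numq_gt0.
Qed.

Lemma approximates_of_nat Q (p : problem Q) (S : {set pgraph p}) :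
  (0 < peps p)%R -> dominating S ->
  `|denq (peps p)|%N * #|S| <= `|denq (peps p)|%N.+1 * opt_DS (pgraph p) ->
  approximates S.
Proof.
move=> eps0 domS; rewrite -(ler_nat rat) !natrM -addn1 natrD => le_S; split=> //.
have q0 : (0 < `|denq (peps p)|%N%:R :> rat)%R by rewrite ltr0n absz_gt0 denq_neq0.
rewrite -(ler_pM2l q0); apply: le_trans le_S _.
rewrite mulrA ler_wpM2r ?ler0n // mulrDr mulr1 lerD2l mulrC.
exact: ge_inv_denq.
Qed.

Section LeafTable.
Variables (H : sgraph -> Prop) (A : forall p : problem (mod_param H), {set pgraph p}).
Hypothesis apxA : forall p, admissible p -> approximates (A p).
Hypothesis wH : well_behaved H.

Variables (G : sgraph) (D : decomp G) (q : nat).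
Local Notation B t := (bag t :\: dL D).

Definition leaf_problem (t : dforest D) (X Z : {set G}) : problem (mod_param H) :=
  @Problem (mod_param H) (gadget (bag t) (dL D) X Z)
    (gadget_modulator (bag t) (dL D) X Z) ((q * (#|B t| + 2))%:R^-1)%R.

Definition leaf_solutions (t : dforest D) : seq {set G} :=
  flatten [seq [seq decode (A (leaf_problem t X Z)) | Z <- subsets (B t)] | X <- subsets (B t)].

Lemma size_leaf_solutions t : size (leaf_solutions t) = 4 ^ #|B t|.
Proof.
have sizeE (s s' : seq {set G}) : size (flatten
    [seq [seq decode (A (leaf_problem t X Z)) | Z <- s'] | X <- s]) = size s * size s'.
  by elim: s => //= X s IH; rewrite size_cat size_map IH mulSn.
by rewrite (expnMn 2 2) -!size_subsets -sizeE.
Qed.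

Hypothesis HD : tree_decomp H D.
Hypothesis q0 : 0 < q.

Lemma leaf_problem_admissible t X Z : leaf t -> admissible (leaf_problem t X Z).
Proof.
move=> lt; split; first exact: gadget_modulatorP wH (td_leaf_H HD lt).
by rewrite /= invr_gt0 ltr0n muln_gt0 q0 addn2.
Qed.

Lemma leaf_solutions_spec (t : dforest D) (S : {set G}) : leaf t -> S \subset bag t ->
  (forall v, v \in bag t :&: dL D -> covered S v) ->
  exists R, [/\ R \in leaf_solutions t, S :\: dL D \subset R,
    forall v, v \in bag t -> covered S v -> covered R v & q * #|R| <= weight D q S].
Proof.
(* Once the uncovered vertices of [B] are exempted, [S] itself is feasible for the gadget, since it
   covers the rest of the bag. *)
move=> lt sS covL; pose X := S :\: dL D; pose Z := [set v in B t | ~~ covered S v].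
have sXB : X \subset B t by apply: setSD.
have sZB : Z \subset B t by apply/subsetP=> v; rewrite inE => /andP[].
have adm := leaf_problem_admissible X Z lt.
have apx := apxA adm; have domA := apx.1.
exists (decode (A (leaf_problem t X Z))); split.
- apply/flatten_mapP; exists X; first exact: mem_subsets.
  by apply: map_f; apply: mem_subsets.
- exact: subsetUl.
- move=> v vt cv; apply: covered_decode => //; rewrite inE negb_and negbK cv orbT //.
have covS v : v \in bag t -> v \notin Z -> covered S v.
  move=> vt; rewrite !inE vt andbT negb_and !negbK => /orP[Lv|//].
  by apply: covL; rewrite inE vt.
have le_opt : opt_DS (gadget (bag t) (dL D) X Z) <= #|S|.+1.
  by apply: opt_gadget => //; apply: subsetDl.
have m0 : 0 < q * (#|B t| + 2) by rewrite muln_gt0 q0 addn2.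
have le_A := approximates_inv m0 (erefl : peps (leaf_problem t X Z) = _) apx.
have -> : weight D q S = q * #|S| + #|S :&: dL D|.
  rewrite /weight big_split /= sum_nat_const mulnC; congr (_ + _).
  rewrite -big_mkcondr /= sum1_card; apply: eq_card => v; by rewrite !inE.
apply: (@decode_weight q #|B t| _ _ _ _ q0 _ erefl).
  by rewrite -(cardsID (dL D) S) addnC leq_add2r subset_leq_card.
apply: leq_trans (leq_mul (leqnn _) (card_decode sXB domA)) _.
by apply: leq_trans le_A _; rewrite leq_mul2l le_opt orbT.
Qed.

End LeafTable.

Theorem tw_of_mod H : well_behaved H -> DS_FPT_AS (mod_param H) -> DS_FPT_AS (tw_param H).
Proof.
move=> wH /(oracle_of_scheme (@mod_value H)) [f [A [apxA compA]]].
pose q (eps : rat) : nat := `|denq eps|%N.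
(* A bag has [b <= w + 1] vertices outside [L] and its gadget a modulator of size at most
   [2 * b + 2]. Both arguments of [f] vary with the leaf, and [f] need not be monotone in either,
   hence the double sum. *)
pose F w eps := \sum_(m < 2 * w.+1 + 3) \sum_(b < w.+2) f m ((q eps * (b + 2))%:R^-1)%R.
(* The summands pay for arithmetic with [q], for the length of the tables, and for the calls to the
   given scheme. *)
pose E w eps := q eps + 4 ^ w.+1 + F w eps.
pose c := problems (@tw_value H) E.
pose D (p : c) : decomp (pgraph p) := pwitness p.
have q0 (p : c) : 0 < q (peps p) by rewrite absz_gt0 denq_neq0.
pose lt (p : c) := leaf_solutions A (D := D p) (q (peps p)).
apply: (@scheme_of_computable _ (@tw_value H) E (fun p => solution (lt p))); last first.
  move=> p [vp eps0].
  pose O := [arg min_(S < [set: pgraph p] | dominating S) #|S|].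
  have domO : dominating O.
    by rewrite /O; case: arg_minnP => //; apply/forallP=> v; rewrite inE.
  have [domS leS] := solution_correct vp domO (leaf_solutions_spec apxA wH vp (q0 p)).
  exact: approximates_of_nat.
have bG : @polybounded c (fun p => #|pgraph p|) by apply: polybounded_pgraph.
have lG : listable c (fun p => pgraph p) by apply: listable_pgraph.
have cD : computable c (fun p => eDecomp (pgraph p)) D.
  exact: (@computable_pwitness _ (@tw_value H)).
have bT : @polybounded c (fun p => #|dforest (D p)|).
  apply: polybounded_le (polybounded_witness (@tw_value H) E) => p _.
  exact: card_le_enc_decomp.
have lT : listable c (fun p => dforest (D p)) by apply: listable_dforest.
have cG : computable c (fun=> eGraph) (fun p => pgraph p) by apply: computable_pgraph.
have ce : computable c (fun=> eRat) (fun p => peps p) by apply: computable_peps.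
have cq : computable c (fun=> eNat) (fun p => q (peps p)).
  apply: (@computable_snd c (fun=> eNat) (fun=> eNat)
    (fun p => (`|numq (peps p)|%N, `|denq (peps p)|%N))).
  exact: computable_recode ce.
have bE := polybounded_parameter (@tw_value H) E.
have bq : @polybounded c (fun p => q (peps p)).
  by apply: polybounded_le bE => p _; rewrite /E -addnA leq_addr.
have bW : @polybounded c (fun p => 4 ^ (width (D p)).+1).
  by apply: polybounded_le bE => p _; rewrite /E -addnA addnCA leq_addr.
have bF : @polybounded c (fun p => F (width (D p)) (peps p)).
  by apply: polybounded_le bE => p _; rewrite /E leq_addl.
have le_width (p : c) (t : dforest (D p)) : #|bag t :\: dL (D p)| <= (width (D p)).+1.
  by rewrite -add1n -leq_subLR; apply: (leq_bigmax t).
rewrite -/c; apply: (@computable_solution c _ D lt (fun p => (width (D p)).+1)) => //.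
- by move=> p t _ _; rewrite size_leaf_solutions leq_exp2l // le_width.
(* An internal bag avoids [L], so the width bounds all of it. *)
- move=> p t [vp _] nt; rewrite -(_ : bag t :\: dL (D p) = bag t) ?le_width //.
  apply/setP=> v; rewrite inE; case: (boolP (v \in bag t)); rewrite ?andbF // => vt.
  by rewrite (internal_dL vp nt vt).
have cE := lT.2.
apply: (@computable_map c (fun p => eElt (dforest (D p))) (fun p => eSeq (eSet (pgraph p)))) => //.
  exact: polybounded_enumT.
set c1 := ext _ _ _; apply: computable_if; last exact: computable_nil.
  by apply: (@computable_leaf c1 (fun k => pgraph (projT1 k)) (fun k => D (projT1 k))); known.
set c2 := restrict _ _.
pose B (k : c2) := bag (projT2 k) :\: dL (D (projT1 k)).
have cbag : computable c2 (fun k => eSet (pgraph (projT1 k))) (fun k => bag (projT2 k)).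
  by apply: (@computable_bag c2 (fun k => pgraph (projT1 k)) (fun k => D (projT1 k))); known.
have cdL : computable c2 (fun k => eSet (pgraph (projT1 k))) (fun k => dL (D (projT1 k))).
  by apply: (@computable_dL c2 (fun k => pgraph (projT1 k)) (fun k => D (projT1 k))); known.
have cB : computable c2 (fun k => eSet (pgraph (projT1 k))) B.
  by apply: computable_setD => //; known.
have bW2 : @polybounded c2 (fun k => 4 ^ (width (D (projT1 k))).+1) by known.
have bB : @polybounded c2 (fun k => 2 ^ #|B k|).
  apply: (@polybounded_le c2 _ _ _ bW2) => k _; apply: (@leq_trans (4 ^ #|B k|)).
    by case: #|B k| => // n; rewrite leq_exp2r.
  by rewrite leq_exp2l // le_width.
have csub : computable c2 (fun k => eSeq (eSet (pgraph (projT1 k)))) (fun k => subsets (B k)).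
  by apply: computable_subsets => //; known.
have bsub : @polybounded c2 (fun k => size (subsets (B k))).
  by apply: (@polybounded_le c2 _ _ _ bB) => k _; rewrite size_subsets.
pose M (k : c2) := q (peps (projT1 k)) * (#|B k| + 2).
have cM : computable c2 (fun=> eNat) M.
  have bcard : @polybounded c2 (fun k => #|B k|).
    apply: (@polybounded_le c2 (fun k => #|pgraph (projT1 k)|)); last by known.
    by move=> k _; apply: max_card.
  apply: computable_mul; try by known.
    by apply: polyboundedD => //; apply: polybounded_const.
  apply: computable_add => //; last exact: computable_nat.
  by apply: (@computable_card c2 (fun k => pgraph (projT1 k))); known.
have cdelta : computable c2 (fun=> eRat) (fun k => ((M k)%:R^-1)%R).
  have cpair : computable c2 (fun=> ePair eNat eNat) (fun k => (1, M k)).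
    by apply: computable_pair => //; apply: computable_nat.
  apply: computable_recode cpair => k _ /=; rewrite enc_rat_inv //.
  by rewrite /M muln_gt0 q0 addn2.
apply: (@computable_flatmap c2 (fun k => eSet (pgraph (projT1 k)))
  (fun k => eSet (pgraph (projT1 k)))) => //.
  set c3 := ext _ _ _; apply: (@polybounded_le c3 (fun k => size (subsets (B (projT1 k))))).
    by move=> k _; rewrite size_map.
  by known.
set c3 := ext _ _ _.
apply: (@computable_map c3 (fun k => eSet (pgraph (projT1 (projT1 k))))
  (fun k => eSet (pgraph (projT1 (projT1 k))))); try by known.
set c4 := ext _ _ _.
pose t (k : c4) := projT2 (projT1 (projT1 k)).
pose p (k : c4) := projT1 (projT1 (projT1 k)).
have lG4 : listable c4 (fun k => pgraph (p k)) by known.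
have cG4 : computable c4 (fun=> eGraph) (fun k => pgraph (p k)) by known.
have cb4 : computable c4 (fun k => eSet (pgraph (p k))) (fun k => bag (t k)) by known.
have cL4 : computable c4 (fun k => eSet (pgraph (p k))) (fun k => dL (D (p k))) by known.
have cX4 : computable c4 (fun k => eSet (pgraph (p k))) (fun k => projT2 (projT1 k)) by known.
have cZ4 : computable c4 (fun k => eSet (pgraph (p k))) (fun k => projT2 k) by known.
pose P (k : c4) := leaf_problem H (q (peps (p k))) (t k) (projT2 (projT1 k)) (projT2 k).
apply: (@computable_decode c4 (fun k => pgraph (p k)) (fun k => bag (t k))
  (fun k => dL (D (p k))) (fun k => projT2 (projT1 k)) (fun k => projT2 k)) => //.
have bgad : @polybounded c4 (fun k => #|pgraph (P k)|).
  exact: (@polybounded_gadget c4 (fun k => pgraph (p k))).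
have bM : @polybounded c4 (fun k => f #|gadget_modulator (bag (t k)) (dL (D (p k)))
    (projT2 (projT1 k)) (projT2 k)| ((q (peps (p k)) * (#|B (projT1 (projT1 k))| + 2))%:R^-1)%R).
  apply: (@polybounded_le c4 (fun k => F (width (D (p k))) (peps (p k)))); last by known.
  move=> k _; rewrite /F.
  have lt_m : #|gadget_modulator (bag (t k)) (dL (D (p k))) (projT2 (projT1 k)) (projT2 k)|
      < 2 * (width (D (p k))).+1 + 3.
    rewrite addnS ltnS; apply: leq_trans (card_gadget_modulator _ _ _ _) _.
    by rewrite leq_add2r leq_mul2l le_width.
  have lt_b : #|B (projT1 (projT1 k))| < (width (D (p k))).+2 by rewrite ltnS le_width.
  by rewrite (bigD1 (Ordinal lt_m)) //= (bigD1 (Ordinal lt_b)) //= -addnA leq_addr.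
apply: (compA c4 P).
- by move=> k [[[[[vp _] _] lk] _] _]; apply: leaf_problem_admissible.
- exact: bM.
- exact: bgad.
- apply: (@polybounded_le c4 _ _ (fun (k : c4) _ => term_size_enc_set_le (pwitness (P k)))).
  by polybound.
- exact: (@computable_gadget c4 (fun k => pgraph (p k))).
- exact: (@computable_gadget_modulator c4 (fun k => pgraph (p k))).
- by known.
Qed.

Theorem theorem9 (H : sgraph -> Prop) (hH : well_behaved H) :
  (DS_FPT_AS (mod_param H) <-> DS_FPT_AS (ed_param H)) /\
  (DS_FPT_AS (ed_param H) <-> DS_FPT_AS (tw_param H)).
Proof.
split; split=> scheme.
- by apply: ed_of_tw; apply: tw_of_mod.
- exact: mod_of_ed.
- by apply: tw_of_mod => //; apply: mod_of_ed.
- exact: ed_of_tw.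
Qed.
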